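(* There exists a constant $0<D<1$ and an integer $k_0$ such that for every integer $k\ge k_0$, setting $m=\lfloor D(2k+1)\rfloor$ (the largest integer not exceeding $D(2k+1)$), there is an $L^2(\mathbb S^2)$-orthonormal set $\{u_i\}_{i=1}^m\subset \mathcal{SH}_k$ such that $$\|u_i\|_{L^p(\mathbb S^2)}\ \ge\ \tfrac12\, C_p k^{\sigma(p)}=\tfrac12\|Q_k\|_{L^p(\mathbb S^2)}\qquad\text{for all } i=1,\dots,m \text{ and all } 2<p\le 6 .$$ Moreover, $D$ can be chosen to be any number satisfying $$(7+1296D)\,c_0^{-1/D}\le \frac1{25},\qquad c_0=e^{1/72}>1$$ (with $k_0$ depending on $D$); for example $D=1/400$ works.
   Context: $\mathbb S^2\subset\mathbb R^3$ is the unit sphere with the round metric and surface measure; $L^p$ norms are taken on $\mathbb S^2$. $\mathcal{SH}_k$ denotes the space of spherical harmonics of degree $k$ (restrictions to $\mathbb S^2$ of homogeneous harmonic polynomials of degree $k$ on $\mathbb R^3$); it is the eigenspace of $-\Delta$ with eigenvalue $k(k+1)$ and has dimension $2k+1$. Using coordinates $x=(\sin\phi\cos\theta,\sin\phi\sin\theta,\cos\phi)$, the Gaussian beam is $Q_k(\phi,\theta)=C_kP_k^k(\cos\phi)e^{ik\theta}$, where $P_k^k$ is the associated Legendre function and $C_k>0$ makes $\|Q_k\|_{L^2}=1$. For a surface, $\sigma(p)=\tfrac12\left(\tfrac12-\tfrac1p\right)$ for $2<p\le 6$, and the paper writes $\|Q_k\|_{L^p}=C_pk^{\sigma(p)}$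 (so $C_pk^{\sigma(p)}$ denotes the $L^p$ norm of $Q_k$, which is of order $k^{\sigma(p)}$). *)

(* Defs.v *)
From Stdlib Require Import Reals Lra List Arith.
From Coquelicot Require Import Coquelicot.
Open Scope R_scope.

(* x^p for x >= 0 and real p > 0, with the convention 0^p = 0
   (Stdlib's Rpower would give Rpower 0 p = 1). *)
Definition rpow (x p : R) : R := if Rlt_dec 0 x then Rpower x p else 0.

Definition sx (phi theta : R) : R := sin phi * cos theta.
Definition sy (phi theta : R) : R := sin phi * sin theta.
Definition sz (phi theta : R) : R := cos phi.

(* Integral over S^2 w.r.t. surface measure of a real function given in
   spherical coordinates: dsigma = sin phi dtheta dphi. *)
Definition sphere_integral (g : R -> R -> R) : R :=
  RInt (fun phi => RInt (fun theta => g phi theta * sin phi) 0 (2 * PI)) 0 PI.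

Definition Lp_norm_coord (p : R) (g : R -> R -> C) : R :=
  rpow (sphere_integral (fun phi theta => rpow (Cmod (g phi theta)) p)) (/ p).

(* Functions on S^2 are represented as functions on R^3 (only values on the
   sphere matter). *)
Definition on_sphere (u : R -> R -> R -> C) : R -> R -> C :=
  fun phi theta => u (sx phi theta) (sy phi theta) (sz phi theta).

Definition Lp_norm (p : R) (u : R -> R -> R -> C) : R :=
  Lp_norm_coord p (on_sphere u).

Definition inner_re (u v : R -> R -> R -> C) : R :=
  sphere_integral (fun phi theta =>
    Re (Cmult (on_sphere u phi theta) (Cconj (on_sphere v phi theta)))).
Definition inner_im (u v : R -> R -> R -> C) : R :=
  sphere_integral (fun phi theta =>
    Im (Cmult (on_sphere u phi theta) (Cconj (on_sphere v phi theta)))).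

(* Homogeneous polynomials of degree k on R^3 with complex coefficients,
   given as a list of monomials c * x^a y^b z^d with a + b + d = k. *)
Definition monomial : Type := (C * (nat * nat * nat))%type.

Definition mono_eval (mo : monomial) (x y z : R) : C :=
  let '(c, (a, b, d)) := mo in Cmult c (RtoC (x ^ a * y ^ b * z ^ d)).

Definition poly_eval (P : list monomial) (x y z : R) : C :=
  fold_right (fun mo acc => Cplus (mono_eval mo x y z) acc) (RtoC 0) P.

Definition homogeneous_of_degree (k : nat) (P : list monomial) : Prop :=
  forall (c : C) (a b d : nat), In (c, (a, b, d)) P -> (a + b + d)%nat = k.

Definition laplacian (f : R -> R -> R -> R) (x y z : R) : R :=
  Derive (fun t => Derive (fun s => f s y z) t) x
  + Derive (fun t => Derive (fun s => f x s z) t) y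
  + Derive (fun t => Derive (fun s => f x y s) t) z.

Definition harmonic (F : R -> R -> R -> C) : Prop :=
  forall x y z : R,
    laplacian (fun a b c => Re (F a b c)) x y z = 0 /\
    laplacian (fun a b c => Im (F a b c)) x y z = 0.

Definition spherical_harmonic (k : nat) (u : R -> R -> R -> C) : Prop :=
  exists P : list monomial,
    homogeneous_of_degree k P /\ harmonic (poly_eval P) /\
    forall x y z : R, x ^ 2 + y ^ 2 + z ^ 2 = 1 -> u x y z = poly_eval P x y z.

(* Legendre polynomial (Rodrigues) and associated Legendre function
   P_l^m(x) = (-1)^m (1 - x^2)^{m/2} d^m/dx^m P_l(x), for -1 <= x <= 1. *)
Definition legendreP (l : nat) (x : R) : R :=
  / (2 ^ l * INR (Factorial.fact l)) * Derive_n (fun t => (t ^ 2 - 1) ^ l) l x.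
Definition assoc_legendreP (l m : nat) (x : R) : R :=
  (-1) ^ m * sqrt (1 - x ^ 2) ^ m * Derive_n (legendreP l) m x.

Definition cexpi (t : R) : C := (cos t, sin t).

Definition beam0 (k : nat) (phi theta : R) : C :=
  Cmult (RtoC (assoc_legendreP k k (cos phi))) (cexpi (INR k * theta)).

(* C_k > 0 with ||Q_k||_{L^2} = 1 *)
Definition beam_const (k : nat) : R := / Lp_norm_coord 2 (beam0 k).

Definition Qk (k : nat) (phi theta : R) : C :=
  Cmult (RtoC (beam_const k)) (beam0 k phi theta).

(* floor of a real, as a natural number (argument assumed >= 0) *)
Definition nat_floor (r : R) : nat := Z.to_nat (Int_part r).

Definition good_constant (D : R) : Prop :=
  exists k0 : nat, forall k : nat, (k0 <= k)%nat ->
    let m := nat_floor (D * (2 * INR k + 1)) in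
    exists u : nat -> (R -> R -> R -> C),
      (forall i, (i < m)%nat -> spherical_harmonic k (u i)) /\
      (forall i j, (i < m)%nat -> (j < m)%nat ->
          inner_re (u i) (u j) = (if Nat.eqb i j then 1 else 0) /\
          inner_im (u i) (u j) = 0) /\
      (forall i, (i < m)%nat -> forall p : R, 2 < p <= 6 ->
          Lp_norm p (u i) >= / 2 * Lp_norm_coord p (Qk k)).

Definition c0 : R := exp (/ 72).

Definition admissible (D : R) : Prop :=
  (7 + 1296 * D) * Rpower c0 (- / D) <= / 25.

(* Main.v *)
Require Import Defs.
From Stdlib Require Import Reals ZArith Lra Lia List Arith.
From Stdlib Require Import FunctionalExtensionality ClassicalEpsilon.
From Coquelicot Require Import Coquelicot.
Open Scope R_scope.

(* The proof replaces perturbed Gaussian beams by exactly orthonormal wave packets.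

   If q is a rotated, L^2-normalised Gaussian beam with axis w, then q |q|^(p-2) transforms under
   the rotations about w by the character that occurs only once in SH_k, on the line of q. Hence
   <u, q |q|^(p-2)> = ||q||_p^p <u, q> for u in SH_k, and Young's inequality yields
   ||u||_p >= |<u, q>| ||q||_p. It therefore suffices to find orthonormal u_i in SH_k, each having
   inner product at least 1/2 with some rotated beam.

   The coefficients W_n of s^n in ((x+iy) - 2sz - s^2(x-iy))^k form an orthogonal basis of SH_k
   with ||W_n||^2 proportional to C(2k,n); in the normalised basis the coefficients of a rotated
   beam are, up to phases e^(i n alpha), the square roots of the binomial(2k, t) probabilities.
   Cut the indices k <= n <= 2k into blocks of length L = floor(sqrt k) and let u_i be the discrete
   Fourier modes of the blocks: they are orthonormal, and since the binomial probabilities with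
   mean in the middle of a block are at least 1/(4L) on the whole block, each u_i has the required
   inner product with the corresponding beam. This uses only blocks close to n = k, which is enough
   for every D <= 1/20; admissible D are smaller than that.

   Rotation invariance of the integral in spherical coordinates is obtained by differentiating in
   the rotation angle, which needs C^1 integrands; |q|^(p-2) is regularised to
   (|z|^2 + eps)^(k(p-2)/2) for this purpose, and eps tends to 0. *)

(** The constant 1/2 arises as follows. In the normalised basis a Fourier mode of a block has L
    coefficients of modulus 1/sqrt L, the beam has coefficients of modulus at least 1/(2 sqrt L)
    there, and once the phases are aligned the L products add up to at least 1/2. Blocks of length
    about sqrt k fit because this is the order of the standard deviation of the binomial law, while
    its maximum is of order 1/sqrt k.

    Aligning the phases costs nothing: the factors e^(i n alpha) amount to a rotation about the
    z-axis, so real coefficients are compared with beams whose axis lies in the xz-plane, and these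
    come from x+iy by rotations about the y-axis.

    All integrals come from one identity. Paired with a weighted beam, the generating function of
    the W_n gives (cos g + s sin g)^(2k) times a constant, and the coefficient of s^n gives the
    pairing with W_n. Weight exponent 0 turns it into the norms of the W_n, degree 0 into the
    rotation invariance of the mass of |q|^p, and the exponent k(p-2)/2 into the duality with q
    |q|^(p-2). *)

Ltac eqR := match goal with |- @eq _ ?a ?b => change (@eq R a b) end.

(** * Continuity, and integrals depending on a parameter *)

Lemma continuous_Rplus {U : UniformSpace} (f g : U -> R) x :
  continuous f x -> continuous g x -> continuous (fun u => f u + g u) x.
Proof. intros Hf Hg; exact (continuous_plus f g x Hf Hg). Qed.

Lemma continuous_Rmult {U : UniformSpace} (f g : U -> R) x :
  continuous f x -> continuous g x -> continuous (fun u => f u * g u) x.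
Proof. intros Hf Hg; exact (continuous_mult f g x Hf Hg). Qed.

Lemma continuous_Ropp {U : UniformSpace} (f : U -> R) x :
  continuous f x -> continuous (fun u => - f u) x.
Proof. intros Hf; exact (continuous_opp f x Hf). Qed.

Lemma continuous_Rminus {U : UniformSpace} (f g : U -> R) x :
  continuous f x -> continuous g x -> continuous (fun u => f u - g u) x.
Proof. intros Hf Hg; exact (continuous_minus f g x Hf Hg). Qed.

Lemma continuous_Rpow {U : UniformSpace} (f : U -> R) n x :
  continuous f x -> continuous (fun u => f u ^ n) x.
Proof.
  intros Hf; induction n as [|n IH]; simpl.
  - apply continuous_const.
  - now apply continuous_Rmult.
Qed.

Lemma continuous_comp_R {U : UniformSpace} (g : R -> R) (f : U -> R) x :
  continuous f x -> continuous g (f x) -> continuous (fun u => g (f u)) x.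
Proof. intros Hf Hg; exact (continuous_comp f g x Hf Hg). Qed.

Lemma continuous_Rsin {U : UniformSpace} (f : U -> R) x :
  continuous f x -> continuous (fun u => sin (f u)) x.
Proof. intros Hf; apply (continuous_comp_R sin f); auto; apply continuous_sin. Qed.

Lemma continuous_Rcos {U : UniformSpace} (f : U -> R) x :
  continuous f x -> continuous (fun u => cos (f u)) x.
Proof. intros Hf; apply (continuous_comp_R cos f); auto; apply continuous_cos. Qed.

Lemma continuous_fst_comp {U V : UniformSpace} (f : U -> R) (x : U * V) :
  continuous f (fst x) -> continuous (fun u : U * V => f (fst u)) x.
Proof.
  intros Hf; destruct x as [x y].
  exact (continuous_comp fst f (x, y) (continuous_fst x y) Hf).
Qed.

Lemma continuous_snd_comp {U V : UniformSpace} (f : V -> R) (x : U * V) :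
  continuous f (snd x) -> continuous (fun u : U * V => f (snd u)) x.
Proof.
  intros Hf; destruct x as [x y].
  exact (continuous_comp snd f (x, y) (continuous_snd x y) Hf).
Qed.

Lemma continuous_Rid (x : R) : continuous (fun t : R => t) x.
Proof. apply continuous_id. Qed.

Create HintDb conts.
#[export] Hint Resolve continuous_Rplus continuous_Rmult continuous_Ropp
  continuous_Rminus continuous_Rpow continuous_Rsin continuous_Rcos
  continuous_const continuous_Rid : conts.
#[export] Hint Extern 2 (continuous (fun _ => ?f (fst _)) _) =>
  apply (continuous_fst_comp f) : conts.
#[export] Hint Extern 2 (continuous (fun _ => ?f (snd _)) _) =>
  apply (continuous_snd_comp f) : conts.
#[export] Hint Extern 3 (continuous (fun _ => fst _) _) =>
  apply (continuous_fst_comp (fun t => t)) : conts.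
#[export] Hint Extern 3 (continuous (fun _ => snd _) _) =>
  apply (continuous_snd_comp (fun t => t)) : conts.
#[export] Hint Extern 3 (continuous (fun _ => fst (fst _)) _) =>
  apply (continuous_fst_comp (fun t => fst t)) : conts.
#[export] Hint Extern 3 (continuous (fun _ => snd (fst _)) _) =>
  apply (continuous_fst_comp (fun t => snd t)) : conts.

(** Tube lemma along the compact segment {x} × [a,b]: joint continuity gives a radius at each t, and
    compactness a common one. The parameter ranges over an arbitrary uniform space because in nested
    integrals it is a pair of reals. *)
Lemma continuous_unif_param {U : UniformSpace} (f : U -> R -> R) (a b : R) (x : U) :
  (forall t, continuous (fun p : U * R => f (fst p) (snd p)) (x, t)) ->
  forall eps : posreal,
  locally x (fun y => forall t, a <= t <= b -> Rabs (f y t - f x t) < eps).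
Proof.
  intros Hc eps.
  assert (Hd : forall t, exists d : posreal, forall y t', ball x d y ->
             Rabs (t' - t) < d -> Rabs (f y t' - f x t) < eps / 2).
  { intros t.
    assert (He : 0 < eps / 2) by (destruct eps; simpl; lra).
    assert (H0 : locally (f x t) (fun z => Rabs (z - f x t) < eps / 2))
      by (exists (mkposreal _ He); intros z Hz; exact Hz).
    destruct (Hc t _ H0) as [d Hd].
    exists d; intros y t' Hy Ht'.
    apply (Hd (y, t')); split; simpl; [exact Hy | exact Ht']. }
  destruct (constructive_indefinite_description
    (fun dl : R -> posreal => forall t y t', ball x (dl t) y ->
             Rabs (t' - t) < dl t -> Rabs (f y t' - f x t) < eps / 2)) as [dl Hdl].
  { exists (fun t => proj1_sig (constructive_indefinite_description _ (Hd t))).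
    intros t; exact (proj2_sig (constructive_indefinite_description _ (Hd t))). }
  destruct (compactness_value_1d a b dl) as [d Hd'].
  exists d; intros y Hy t Ht.
  (* Compactness provides the nearby point [t0] only under a double negation. Both [f y t] and
     [f x t] are compared with [f x t0], whence the eps / 2. *)
  destruct (Classical_Prop.NNPP _ (Hd' t Ht)) as [t0 [_ [H1 H2]]].
  assert (Hb : ball x (dl t0) y) by (apply ball_le with d; auto).
  generalize (Hdl t0 y t Hb H1) (Hdl t0 x t (ball_center _ _) H1).
  intros K1 K2.
  replace (f y t - f x t) with ((f y t - f x t0) - (f x t - f x t0)) by ring.
  unfold Rminus at 1.
  eapply Rle_lt_trans; [apply Rabs_triang|]. rewrite Rabs_Ropp. lra.
Qed.

Lemma continuous_slice {U : UniformSpace} (f : U -> R -> R) x t :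
  continuous (fun p : U * R => f (fst p) (snd p)) (x, t) -> continuous (f x) t.
Proof.
  intros H.
  apply (continuous_comp_2 (fun _ : R => x) (fun t => t) f t).
  - apply continuous_const.
  - apply continuous_id.
  - exact H.
Qed.

Lemma ex_RInt_cont (f : R -> R) a b : (forall t, continuous f t) -> ex_RInt f a b.
Proof. intros H; apply (@ex_RInt_continuous R_CompleteNormedModule); auto. Qed.

Lemma continuous_RInt_param {U : UniformSpace} (f : U -> R -> R) (a b : R) (x : U) :
  a <= b ->
  (forall x t, continuous (fun p : U * R => f (fst p) (snd p)) (x, t)) ->
  continuous (fun x => RInt (f x) a b) x.
Proof.
  intros Hab Hc.
  assert (Hex : forall y, ex_RInt (f y) a b)
    by (intros y; apply ex_RInt_cont; intros t; apply continuous_slice; auto).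
  intros P [eps HP].
  (* The [+ 1] covers the case a = b and makes the final estimate strict. *)
  assert (He : 0 < eps / (b - a + 1)) by (apply Rdiv_lt_0_compat; [apply cond_pos | lra]).
  unfold filtermap. generalize (continuous_unif_param f a b x (Hc x) (mkposreal _ He)); simpl.
  apply filter_imp; intros y Hy.
  apply HP. change (Rabs (minus (RInt (f y) a b) (RInt (f x) a b)) < eps).
  rewrite <- (RInt_minus (V := R_CompleteNormedModule) (f y) (f x) a b) by auto.
  apply Rle_lt_trans with ((b - a) * (eps / (b - a + 1))).
  - apply abs_RInt_le_const; auto.
    + apply ex_RInt_cont; intros t.
      apply (continuous_Rminus (f y) (f x)); apply continuous_slice; auto.
    + intros t Ht; left; exact (Hy t Ht).
  - replace (pos eps) with ((b - a + 1) * (eps / (b - a + 1))) at 2 by (field; lra).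
    apply Rmult_lt_compat_r; lra.
Qed.

Lemma continuous_continuity_2d (f : R -> R -> R) x y :
  continuous (fun p : R * R => f (fst p) (snd p)) (x, y) -> continuity_2d_pt f x y.
Proof.
  intros H eps.
  assert (H0 : locally (f x y) (fun z => Rabs (z - f x y) < eps))
    by (exists eps; intros z Hz; exact Hz).
  destruct (H _ H0) as [d Hd].
  exists d; intros u v Hu Hv. apply (Hd (u, v)); split; simpl; assumption.
Qed.

Lemma is_derive_RInt_under (f df : R -> R -> R) (a b x : R) :
  a <= b ->
  (forall x t, is_derive (fun x => f x t) x (df x t)) ->
  (forall x t, continuous (fun p : R * R => f (fst p) (snd p)) (x, t)) ->
  (forall x t, continuous (fun p : R * R => df (fst p) (snd p)) (x, t)) ->
  is_derive (fun x => RInt (f x) a b) x (RInt (df x) a b).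
Proof.
  intros Hab Hd Hc Hdc.
  assert (E : forall u t, Derive (fun z => f z t) u = df u t)
    by (intros u t; apply is_derive_unique, Hd).
  assert (EE : (fun t => Derive (fun u => f u t) x) = df x)
    by (apply functional_extensionality; intros t; apply E).
  rewrite <- EE.
  apply is_derive_RInt_param.
  - apply filter_forall; intros y t _; exists (df y t); apply Hd.
  - intros t _.
    replace (fun u v => Derive (fun z => f z v) u) with df
      by (do 2 (apply functional_extensionality; intro); symmetry; apply E).
    apply continuous_continuity_2d, Hdc.
  - apply filter_forall; intros y. apply ex_RInt_cont; intros t; apply continuous_slice; auto.
Qed.

Lemma is_derive_Rmult (f g : R -> R) x df dg :
  is_derive f x df -> is_derive g x dg ->
  is_derive (fun t => f t * g t) x (df * g x + f x * dg).
Proof.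
  intros Hf Hg. apply (is_derive_mult f g x df dg Hf Hg). exact Rmult_comm.
Qed.

Lemma is_derive_Rmult_const_r (f : R -> R) (c x df : R) :
  is_derive f x df -> is_derive (fun t => f t * c) x (df * c).
Proof.
  intros Hf. evar_last.
  - apply (is_derive_Rmult f (fun _ => c) x df 0 Hf). apply (is_derive_const (V := R_NormedModule)).
  - ring.
Qed.

Lemma RInt_of_derive (f df : R -> R) a b :
  (forall x, is_derive f x (df x)) -> (forall x, continuous df x) ->
  RInt df a b = f b - f a.
Proof.
  intros Hd Hc. apply is_RInt_unique.
  apply (is_RInt_derive (V := R_CompleteNormedModule) f df); auto.
Qed.

Lemma RInt_Rminus (f g : R -> R) a b :
  (forall x, continuous f x) -> (forall x, continuous g x) ->
  RInt (fun x => f x - g x) a b = RInt f a b - RInt g a b.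
Proof.
  intros Hf Hg.
  apply (RInt_minus (V := R_CompleteNormedModule) f g); apply ex_RInt_cont; auto.
Qed.

Lemma RInt_Rplus (f g : R -> R) a b :
  (forall x, continuous f x) -> (forall x, continuous g x) ->
  RInt (fun x => f x + g x) a b = RInt f a b + RInt g a b.
Proof.
  intros Hf Hg.
  apply (RInt_plus (V := R_CompleteNormedModule) f g); apply ex_RInt_cont; auto.
Qed.

Lemma RInt_Rscal (f : R -> R) (c a b : R) :
  (forall x, continuous f x) -> RInt (fun x => c * f x) a b = c * RInt f a b.
Proof.
  intros Hf. apply (RInt_scal (V := R_CompleteNormedModule) f a b c). apply ex_RInt_cont; auto.
Qed.

(* C^1 functions on R^3, with the chain rule along curves taken as the definition. *)
Record C1_3 (h hx hy hz : R -> R -> R -> R) : Prop := {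
  C1_chain : forall (a b c : R -> R) (t a' b' c' : R),
    is_derive a t a' -> is_derive b t b' -> is_derive c t c' ->
    is_derive (fun t => h (a t) (b t) (c t)) t
      (hx (a t) (b t) (c t) * a' + hy (a t) (b t) (c t) * b'
       + hz (a t) (b t) (c t) * c');
  C1_cont : forall (U : UniformSpace) (a b c : U -> R) (x : U),
    continuous a x -> continuous b x -> continuous c x ->
    continuous (fun u => h (a u) (b u) (c u)) x /\
    continuous (fun u => hx (a u) (b u) (c u)) x /\
    continuous (fun u => hy (a u) (b u) (c u)) x /\
    continuous (fun u => hz (a u) (b u) (c u)) x }.

(** A rotation about the y-axis keeps the spinor (a, b) of [Zab] real, see [Zab_rot]. Rotations
    about the z-axis are shifts of theta and are treated separately. *)
Definition rot_y (beta : R) (h : R -> R -> R -> R) (x y z : R) : R :=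
  h (cos beta * x - sin beta * z) y (sin beta * x + cos beta * z).

Definition on_sphere_R (h : R -> R -> R -> R) (phi theta : R) : R :=
  h (sx phi theta) (sy phi theta) (sz phi theta).

(** * Invariance of the surface integral under rotations about the y-axis *)

Section Rotation.
Variables h hx hy hz : R -> R -> R -> R.
Hypothesis C1h : C1_3 h hx hy hz.

Let X (be ph th : R) := cos be * (sin ph * cos th) - sin be * cos ph.
Let Y (be ph th : R) := sin ph * sin th.
Let Z (be ph th : R) := sin be * (sin ph * cos th) + cos be * cos ph.
Let T be ph th := h (X be ph th) (Y be ph th) (Z be ph th).
Let Tx be ph th := hx (X be ph th) (Y be ph th) (Z be ph th).
Let Ty be ph th := hy (X be ph th) (Y be ph th) (Z be ph th).
Let Tz be ph th := hz (X be ph th) (Y be ph th) (Z be ph th).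
Let Tbe be ph th := Tx be ph th * - Z be ph th + Tz be ph th * X be ph th.
Let Tph be ph th := Tx be ph th * (cos be * (cos ph * cos th) + sin be * sin ph)
  + Ty be ph th * (cos ph * sin th)
  + Tz be ph th * (sin be * (cos ph * cos th) - cos be * sin ph).
Let Tth be ph th := Tx be ph th * - (cos be * (sin ph * sin th))
  + Ty be ph th * (sin ph * cos th)
  + Tz be ph th * - (sin be * (sin ph * sin th)).

Lemma rot_derive_be be ph th : is_derive (fun be => T be ph th) be (Tbe be ph th).
Proof.
  unfold T, Tbe, Tx, Tz.
  evar_last.
  - apply (C1_chain _ _ _ _ C1h (fun be => X be ph th) (fun be => Y be ph th)
      (fun be => Z be ph th) be (- Z be ph th) 0 (X be ph th));
      unfold X, Y, Z; auto_derive; auto; ring.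
  - ring.
Qed.

Lemma rot_derive_ph be ph th : is_derive (fun ph => T be ph th) ph (Tph be ph th).
Proof.
  unfold T, Tph, Tx, Ty, Tz.
  apply (C1_chain _ _ _ _ C1h (fun ph => X be ph th) (fun ph => Y be ph th)
      (fun ph => Z be ph th) ph);
      unfold X, Y, Z; auto_derive; auto; ring.
Qed.

Lemma rot_derive_th be ph th : is_derive (fun th => T be ph th) th (Tth be ph th).
Proof.
  unfold T, Tth, Tx, Ty, Tz.
  apply (C1_chain _ _ _ _ C1h (fun th => X be ph th) (fun th => Y be ph th)
      (fun th => Z be ph th) th);
      unfold X, Y, Z; auto_derive; auto; ring.
Qed.

Lemma rot_cont (U : UniformSpace) (a b c : U -> R) (x : U) :
  continuous a x -> continuous b x -> continuous c x ->
  continuous (fun u => T (a u) (b u) (c u)) x /\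
  continuous (fun u => Tbe (a u) (b u) (c u)) x /\
  continuous (fun u => Tph (a u) (b u) (c u)) x /\
  continuous (fun u => Tth (a u) (b u) (c u)) x.
Proof.
  intros Ha Hb Hc.
  assert (HX : continuous (fun u => X (a u) (b u) (c u)) x) by (unfold X; auto 10 with conts).
  assert (HY : continuous (fun u => Y (a u) (b u) (c u)) x) by (unfold Y; auto 10 with conts).
  assert (HZ : continuous (fun u => Z (a u) (b u) (c u)) x) by (unfold Z; auto 10 with conts).
  destruct (C1_cont _ _ _ _ C1h U _ _ _ x HX HY HZ) as [H0 [H1 [H2 H3]]].
  repeat split.
  - exact H0.
  - unfold Tbe, Tx, Tz. auto 10 with conts.
  - unfold Tph, Tx, Ty, Tz. auto 12 with conts.
  - unfold Tth, Tx, Ty, Tz. auto 12 with conts.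
Qed.

(* sin(ph) dT/dbe is the divergence of the rotation field times T, so that its integral over the
   sphere vanishes. *)
Lemma rot_divergence be ph th :
  Tbe be ph th * sin ph
  = (cos ph * cos th * T be ph th + cos ph * sin th * Tth be ph th)
    - (cos ph * cos th * T be ph th + sin ph * cos th * Tph be ph th).
Proof.
  unfold Tbe, Tth, Tph.
  assert (E : sin th * sin th = 1 - cos th * cos th)
    by (generalize (sin2_cos2 th); unfold Rsqr; lra).
  (* The intermediate form keeps sin^2 + cos^2 of theta unexpanded: [E] proves the first half, and
     the second is a polynomial identity. *)
  transitivity (Tx be ph th * (- sin be * sin ph * sin ph * cos th - cos be * cos ph * sin ph * (sin th * sin th + cos th * cos th)) + Tz be ph th * (cos be * sin ph * cos th * sin ph - sin be * cos ph * sin ph * (sin th * sin th + cos th * cos th))).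
  - rewrite E. unfold X, Z. ring.
  - ring.
Qed.

(** The integral has derivative 0 in the angle: both brackets of [rot_divergence] are exact
    derivatives. The theta-primitive [cos ph * sin th * T] vanishes at 0 and 2 PI through its factor
    sin th, and the phi-primitive carries sin ph, which vanishes at both poles. *)
Lemma sphere_integral_rot_y_aux beta :
  sphere_integral (on_sphere_R (rot_y beta h)) = sphere_integral (on_sphere_R (rot_y 0 h)).
Proof.
  pose proof PI_RGT_0 as Hpi.
  assert (E : forall be, sphere_integral (on_sphere_R (rot_y be h))
     = RInt (fun ph => RInt (fun th => T be ph th * sin ph) 0 (2 * PI)) 0 PI) by reflexivity.
  rewrite !E.
  assert (HD : forall be, is_derive (fun be => RInt (fun ph => RInt (fun th => T be ph th * sin ph) 0 (2 * PI)) 0 PI) be 0).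
  { intros be.
    evar_last.
    - apply (is_derive_RInt_under (fun be ph => RInt (fun th => T be ph th * sin ph) 0 (2 * PI))
        (fun be ph => RInt (fun th => Tbe be ph th * sin ph) 0 (2 * PI))).
      + lra.
      + intros be' ph.
        apply (is_derive_RInt_under (fun be th => T be ph th * sin ph) (fun be th => Tbe be ph th * sin ph)).
        * lra.
        * intros x t. apply is_derive_Rmult_const_r, rot_derive_be.
        * intros x t. destruct (rot_cont _ (fun p : R * R => fst p) (fun _ => ph) (fun p => snd p) (x, t)) as [H0 [H1 _]]; auto with conts.
        * intros x t. destruct (rot_cont _ (fun p : R * R => fst p) (fun _ => ph) (fun p => snd p) (x, t)) as [H0 [H1 _]]; auto with conts.
      + intros x t. apply (continuous_RInt_param (fun (p : R * R) th => T (fst p) (snd p) th * sin (snd p))); [lra|].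
        intros p th. destruct (rot_cont _ (fun p : R * R * R => fst (fst p)) (fun p => snd (fst p)) (fun p => snd p) (p, th)) as [H0 [H1 _]]; auto with conts.
      + intros x t. apply (continuous_RInt_param (fun (p : R * R) th => Tbe (fst p) (snd p) th * sin (snd p))); [lra|].
        intros p th. destruct (rot_cont _ (fun p : R * R * R => fst (fst p)) (fun p => snd (fst p)) (fun p => snd p) (p, th)) as [H0 [H1 _]]; auto with conts.
    - simpl.
      assert (H2 : forall ph, RInt (fun th => Tbe be ph th * sin ph) 0 (2 * PI)
         = - RInt (fun th => cos ph * cos th * T be ph th + sin ph * cos th * Tph be ph th) 0 (2 * PI)).
      { intros ph.
        assert (C1 : forall th, continuous (fun th => cos ph * cos th * T be ph th + cos ph * sin th * Tth be ph th) th).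
        { intros th. destruct (rot_cont _ (fun _ => be) (fun _ => ph) (fun th : R => th) th) as [H0 [H1 [H2 H3]]]; auto 10 with conts. }
        assert (C2 : forall th, continuous (fun th => cos ph * cos th * T be ph th + sin ph * cos th * Tph be ph th) th).
        { intros th. destruct (rot_cont _ (fun _ => be) (fun _ => ph) (fun th : R => th) th) as [H0 [H1 [H2 H3]]]; auto 10 with conts. }
        rewrite (RInt_ext _ _ 0 (2 * PI) (fun th _ => rot_divergence be ph th)).
        rewrite RInt_Rminus by auto.
        rewrite (RInt_of_derive (fun th => cos ph * sin th * T be ph th)); auto.
        - rewrite sin_2PI, sin_0. eqR; ring.
        - intros th.
        evar_last.
          + apply (is_derive_Rmult (fun th => cos ph * sin th) (fun th => T be ph th)).
            * apply is_derive_scal. apply is_derive_sin.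
            * apply rot_derive_th.
          + ring. }
      rewrite (RInt_ext _ _ 0 PI (fun ph _ => H2 ph)).
      assert (Cd : forall ph, continuous (fun ph => RInt (fun th => cos ph * cos th * T be ph th + sin ph * cos th * Tph be ph th) 0 (2 * PI)) ph).
      { intros ph. apply (continuous_RInt_param (fun ph th => cos ph * cos th * T be ph th + sin ph * cos th * Tph be ph th)); [lra|].
        intros x t. destruct (rot_cont _ (fun _ => be) (fun p : R * R => fst p) (fun p => snd p) (x, t)) as [H0 [H1 [H3 _]]]; auto 10 with conts. }
      rewrite (RInt_ext _ (fun ph => -1 * RInt (fun th => cos ph * cos th * T be ph th + sin ph * cos th * Tph be ph th) 0 (2 * PI)))
        by (intros; eqR; ring).
      rewrite RInt_Rscal by auto.
      rewrite (RInt_of_derive (fun ph => RInt (fun th => sin ph * cos th * T be ph th) 0 (2 * PI))); auto.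
      + rewrite (RInt_ext _ (fun _ => 0)) by (intros; rewrite sin_PI; eqR; ring).
        rewrite (RInt_ext (fun th => sin 0 * cos th * T be 0 th) (fun _ => 0)) by (intros; rewrite sin_0; eqR; ring).
        ring.
      + intros ph. apply (is_derive_RInt_under (fun ph th => sin ph * cos th * T be ph th)
          (fun ph th => cos ph * cos th * T be ph th + sin ph * cos th * Tph be ph th)).
        * lra.
        * intros x t. evar_last.
          -- apply (is_derive_Rmult (fun ph => sin ph * cos t) (fun ph => T be ph t)).
            ++ apply is_derive_Rmult_const_r. apply is_derive_sin.
            ++ apply rot_derive_ph.
          -- ring.
        * intros x t. destruct (rot_cont _ (fun _ => be) (fun p : R * R => fst p) (fun p => snd p) (x, t)) as [H0 [H1 [H3 _]]]; auto 10 with conts.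
        * intros x t. destruct (rot_cont _ (fun _ => be) (fun p : R * R => fst p) (fun p => snd p) (x, t)) as [H0 [H1 [H3 _]]]; auto 10 with conts. }
  destruct (Rtotal_order 0 beta) as [Hb | [Hb | Hb]].
  - symmetry. apply (eq_is_derive (fun be => RInt (fun ph => RInt (fun th => T be ph th * sin ph) 0 (2 * PI)) 0 PI) 0 beta); auto.
  - now rewrite <- Hb.
  - apply (eq_is_derive (fun be => RInt (fun ph => RInt (fun th => T be ph th * sin ph) 0 (2 * PI)) 0 PI) beta 0); auto.
Qed.
End Rotation.

Lemma rot_y_0 h : rot_y 0 h = h.
Proof.
  do 3 (apply functional_extensionality; intro).
  unfold rot_y. rewrite cos_0, sin_0. f_equal; ring.
Qed.

Lemma sphere_integral_rot_y h hx hy hz beta :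
  C1_3 h hx hy hz ->
  sphere_integral (on_sphere_R (rot_y beta h)) = sphere_integral (on_sphere_R h).
Proof.
  intros H. rewrite (sphere_integral_rot_y_aux h hx hy hz H beta). now rewrite rot_y_0.
Qed.

(** * Componentwise complex derivatives and the polynomials [W] *)

Definition is_deriveC (f : R -> C) (t : R) (l : C) : Prop :=
  is_derive (fun s => Re (f s)) t (Re l) /\ is_derive (fun s => Im (f s)) t (Im l).

Lemma is_deriveC_const c t : is_deriveC (fun _ => c) t (RtoC 0).
Proof. split; apply (is_derive_const (V := R_NormedModule)). Qed.

Lemma is_deriveC_plus f g t l m :
  is_deriveC f t l -> is_deriveC g t m -> is_deriveC (fun s => f s + g s)%C t (l + m)%C.
Proof.
  intros [F1 F2] [G1 G2]; split.
  - exact (is_derive_plus (V := R_NormedModule) _ _ _ _ _ F1 G1).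
  - exact (is_derive_plus (V := R_NormedModule) _ _ _ _ _ F2 G2).
Qed.

Lemma is_deriveC_mult f g t l m :
  is_deriveC f t l -> is_deriveC g t m ->
  is_deriveC (fun s => f s * g s)%C t (l * g t + f t * m)%C.
Proof.
  intros [F1 F2] [G1 G2]; split.
  - apply (is_derive_ext (fun s => Re (f s) * Re (g s) - Im (f s) * Im (g s)));
      [reflexivity|].
    evar_last.
    + apply (is_derive_minus (V := R_NormedModule));
        apply is_derive_Rmult; eassumption.
    + unfold minus, plus, opp; simpl.
      destruct (f t), (g t), l, m; unfold Re, Im; simpl; ring.
  - apply (is_derive_ext (fun s => Re (f s) * Im (g s) + Im (f s) * Re (g s)));
      [reflexivity|].
    evar_last.
    + apply (is_derive_plus (V := R_NormedModule));
        apply is_derive_Rmult; eassumption.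
    + unfold minus, plus, opp; simpl.
      destruct (f t), (g t), l, m; unfold Re, Im; simpl; ring.
Qed.

Lemma is_deriveC_scal c f t l :
  is_deriveC f t l -> is_deriveC (fun s => c * f s)%C t (c * l)%C.
Proof.
  intros H. generalize (is_deriveC_mult _ _ _ _ _ (is_deriveC_const c t) H).
  now replace (RtoC 0 * f t + c * l)%C with (c * l)%C by ring.
Qed.

(** Multiplication by s on coefficient sequences. Truncated subtraction would return [f 0] at index
    0, where the default [d] has to appear. *)
Definition shift {A : Type} (d : A) (f : nat -> A) (n : nat) : A :=
  match n with O => d | S m => f m end.

Definition pmul (c : C) (i j l : nat) (P : list monomial) : list monomial :=
  map (fun mo : monomial => let '(d, (a, b, e)) := mo in
         (Cmult c d, (i + a, j + b, l + e)%nat)) P.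

(* [wpoly k n] is the coefficient of s^n in ((x+iy) - 2sz - s^2(x-iy))^k. *)
Fixpoint wpoly (k : nat) : nat -> list monomial :=
  match k with
  | O => fun n => match n with O => (RtoC 1, (0, 0, 0)%nat) :: nil | _ => nil end
  | S k => fun n =>
      pmul (RtoC 1) 1 0 0 (wpoly k n) ++ pmul Ci 0 1 0 (wpoly k n)
      ++ pmul (RtoC (-2)) 0 0 1 (shift nil (wpoly k) n)
      ++ pmul (RtoC (-1)) 1 0 0 (shift nil (shift nil (wpoly k)) n)
      ++ pmul Ci 0 1 0 (shift nil (shift nil (wpoly k)) n)
  end.

Lemma poly_eval_app P Q x y z :
  poly_eval (P ++ Q) x y z = (poly_eval P x y z + poly_eval Q x y z)%C.
Proof.
  induction P as [|mo P IH]; simpl.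
  - now rewrite Cplus_0_l.
  - rewrite IH. ring.
Qed.

Lemma poly_eval_pmul c i j l P x y z :
  poly_eval (pmul c i j l P) x y z
  = (c * RtoC (x ^ i * y ^ j * z ^ l) * poly_eval P x y z)%C.
Proof.
  induction P as [|[d [[a b] e]] P IH]; simpl.
  - ring.
  - rewrite IH. rewrite !pow_add. rewrite !RtoC_mult. ring.
Qed.

Lemma homogeneous_app k P Q :
  homogeneous_of_degree k P -> homogeneous_of_degree k Q -> homogeneous_of_degree k (P ++ Q).
Proof.
  intros HP HQ c a b d H; apply in_app_or in H; destruct H; [eapply HP | eapply HQ]; eauto.
Qed.

Lemma homogeneous_pmul k c i j l P :
  homogeneous_of_degree k P -> homogeneous_of_degree (i + j + l + k) (pmul c i j l P).
Proof.
  intros HP c' a b d H. apply in_map_iff in H.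
  destruct H as [[d' [[a' b'] e']] [H1 H2]].
  injection H1; intros; subst.
  generalize (HP _ _ _ _ H2). lia.
Qed.

Lemma homogeneous_nil k : homogeneous_of_degree k nil.
Proof. intros c a b d []. Qed.

Lemma homogeneous_wpoly k n : homogeneous_of_degree k (wpoly k n).
Proof.
  revert n; induction k as [|k IH]; intros n.
  - destruct n; simpl; [|apply homogeneous_nil].
    intros c a b d [H|[]]. injection H; intros; subst; reflexivity.
  - assert (H1 : forall n, homogeneous_of_degree k (shift nil (wpoly k) n))
      by (intros [|m]; simpl; [apply homogeneous_nil | apply IH]).
    assert (H2 : forall n, homogeneous_of_degree k (shift nil (shift nil (wpoly k)) n))
      by (intros [|m]; simpl; [apply homogeneous_nil | apply H1]).
    cbn [wpoly].
    repeat apply homogeneous_app; change (S k) with (1 + k)%nat;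
      [ apply (homogeneous_pmul k _ 1 0 0) | apply (homogeneous_pmul k _ 0 1 0)
      | apply (homogeneous_pmul k _ 0 0 1) | apply (homogeneous_pmul k _ 1 0 0)
      | apply (homogeneous_pmul k _ 0 1 0)]; auto.
Qed.

Local Notation cc x y := (@pair R R x%R y%R).

Definition W (k n : nat) (x y z : R) : C := poly_eval (wpoly k n) x y z.
(* W1, W2, W3, W4 are W with n lowered by 1, 2, 3, 4, and zero when that is negative. *)
Definition W1 (k n : nat) (x y z : R) : C := shift (RtoC 0) (fun n => W k n x y z) n.
Definition W2 (k n : nat) (x y z : R) : C := shift (RtoC 0) (fun n => W1 k n x y z) n.
Definition W3 (k n : nat) (x y z : R) : C := shift (RtoC 0) (fun n => W2 k n x y z) n.
Definition W4 (k n : nat) (x y z : R) : C := shift (RtoC 0) (fun n => W3 k n x y z) n.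

Lemma W_S k n x y z :
  W (S k) n x y z = ((cc x y) * W k n x y z - RtoC (2 * z) * W1 k n x y z
                     - (cc x (- y)) * W2 k n x y z)%C.
Proof.
  unfold W2, W1, W. cbn [wpoly]. rewrite !poly_eval_app, !poly_eval_pmul.
  assert (E1 : forall n, poly_eval (shift nil (wpoly k) n) x y z
    = shift (RtoC 0) (fun n => poly_eval (wpoly k n) x y z) n)
    by (intros [|m]; reflexivity).
  assert (E2 : poly_eval (shift nil (shift nil (wpoly k)) n) x y z
    = shift (RtoC 0) (shift (RtoC 0) (fun n => poly_eval (wpoly k n) x y z)) n)
    by (destruct n as [|[|m]]; reflexivity).
  rewrite E1, E2.
  change (shift (RtoC 0) (fun n0 : nat => shift (RtoC 0) (fun n1 : nat => poly_eval (wpoly k n1) x y z) n0) n)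
    with (shift (RtoC 0) (shift (RtoC 0) (fun n => poly_eval (wpoly k n) x y z)) n).
  generalize (shift (RtoC 0) (shift (RtoC 0) (fun n => poly_eval (wpoly k n) x y z)) n)
    (shift (RtoC 0) (fun n => poly_eval (wpoly k n) x y z) n) (poly_eval (wpoly k n) x y z).
  intros [a a'] [b b'] [c c'].
  unfold Cmult, Cplus, Cminus, Copp, RtoC, Ci; apply injective_projections; simpl; ring.
Qed.

Lemma W1_S k n x y z :
  W1 (S k) n x y z = ((cc x y) * W1 k n x y z - RtoC (2 * z) * W2 k n x y z
                     - (cc x (- y)) * W3 k n x y z)%C.
Proof. destruct n as [|n]; [unfold W1, W2, W3; simpl; ring | apply W_S]. Qed.

Lemma W2_S k n x y z :
  W2 (S k) n x y z = ((cc x y) * W2 k n x y z - RtoC (2 * z) * W3 k n x y z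
                     - (cc x (- y)) * W4 k n x y z)%C.
Proof. destruct n as [|n]; [unfold W2, W3, W4; simpl; ring | apply W1_S]. Qed.

Lemma W_0 n x y z : W 0 n x y z = match n with O => RtoC 1 | _ => RtoC 0 end.
Proof.
  destruct n; unfold W; simpl; [|reflexivity]. rewrite !Rmult_1_l. ring.
Qed.

Lemma W_large k n x y z : (2 * k < n)%nat -> W k n x y z = RtoC 0.
Proof.
  revert n; induction k as [|k IH]; intros n Hn.
  - rewrite W_0. destruct n; [lia | reflexivity].
  - rewrite W_S. destruct n as [|[|n]]; [lia | lia |].
    unfold W2, W1; simpl. rewrite !IH by lia. ring.
Qed.

(** Differentiating the k-th power of the generating form in x, y, z brings down k times 1 - s^2,
    i(1 + s^2) and -2s; powers of s become shifts of n. At k = 0 the factor [INR k] makes the value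
    of [pred] harmless. *)
Definition Wx k n x y z : C :=
  (RtoC (INR k) * (W (pred k) n x y z - W2 (pred k) n x y z))%C.
Definition Wy k n x y z : C :=
  (RtoC (INR k) * (Ci * (W (pred k) n x y z + W2 (pred k) n x y z)))%C.
Definition Wz k n x y z : C := (RtoC (INR k) * (RtoC (-2) * W1 (pred k) n x y z))%C.

Lemma is_deriveC_shift (f : nat -> R -> C) (g : nat -> C) t n :
  (forall n, is_deriveC (f n) t (g n)) ->
  is_deriveC (fun s => shift (RtoC 0) (fun n => f n s) n) t (shift (RtoC 0) g n).
Proof. intros H; destruct n; simpl; [apply is_deriveC_const | apply H]. Qed.

Ltac Wstep :=
  match goal with |- context [pred ?k] => destruct k as [|?k] end;
  [ cbn [pred INR]; ring | ].

Ltac Wneg :=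
  repeat match goal with |- context [RtoC (-2 * ?u)] =>
    replace (RtoC (-2 * u)) with (- RtoC (2 * u))%C by (rewrite <- RtoC_opp; f_equal; ring) end.

Ltac dlin := split; unfold Re, Im; simpl; auto_derive; auto; ring.

Lemma W_derive_x k n x y z : is_deriveC (fun t => W k n t y z) x (Wx k n x y z).
Proof.
  revert n; induction k as [|k IH]; intros n.
  - unfold Wx. simpl INR. rewrite Cmult_0_l.
    replace (fun t => W 0 n t y z) with (fun _ : R => match n with O => RtoC 1 | _ => RtoC 0 end)
      by (apply functional_extensionality; intros t; now rewrite W_0).
    apply is_deriveC_const.
  - replace (fun t => W (S k) n t y z) with
      (fun t => ((cc t y) * W k n t y z + (RtoC (-2 * z) * W1 k n t y z
                     + (cc (- t) y) * W2 k n t y z))%C)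
      by (apply functional_extensionality; intros t; rewrite W_S; Wneg;
          replace (cc (- t) y) with (- (cc t (- y)))%C by (unfold Copp; simpl; f_equal; ring); ring).
    assert (H1 : forall n, is_deriveC (fun t => W1 k n t y z) x (shift (RtoC 0) (fun n => Wx k n x y z) n))
      by (intros m; apply (is_deriveC_shift (fun n t => W k n t y z)); auto).
    assert (H2 : is_deriveC (fun t => W2 k n t y z) x
       (shift (RtoC 0) (shift (RtoC 0) (fun n => Wx k n x y z)) n))
      by (apply (is_deriveC_shift (fun n t => W1 k n t y z)); auto).
    evar_last.
    + apply is_deriveC_plus; [|apply is_deriveC_plus; [apply is_deriveC_scal, H1 |]].
      * apply is_deriveC_mult; [|apply IH].
        instantiate (1 := RtoC 1). dlin.
      * apply is_deriveC_mult; [|apply H2].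
        instantiate (1 := RtoC (-1)). dlin.
    + unfold Wx at 4. cbn [pred]. rewrite S_INR, RtoC_plus.
      replace (shift (RtoC 0) (fun n0 : nat => Wx k n0 x y z) n)
        with (RtoC (INR k) * (W1 (pred k) n x y z - W3 (pred k) n x y z))%C
        by (destruct n; [unfold W1, W3; simpl; ring | reflexivity]).
      replace (shift (RtoC 0) (shift (RtoC 0) (fun n0 : nat => Wx k n0 x y z)) n)
        with (RtoC (INR k) * (W2 (pred k) n x y z - W4 (pred k) n x y z))%C
        by (destruct n as [|[|n]]; [unfold W2, W4; simpl; ring | unfold W2, W4, W1, W3; simpl; ring | reflexivity]).
      unfold Wx.
      (* The terms carrying [INR k] recombine to a multiple of [W k n] - [W2 k n] by the recursion,
         which is available for k >= 1; for k = 0 they vanish. *)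
      Wstep. cbn [pred]. rewrite W_S, W2_S.
      replace (cc (- x) y) with (- (cc x (- y)))%C by (unfold Copp; simpl; f_equal; ring).
      replace (RtoC (-2 * z)) with (- RtoC (2 * z))%C by (rewrite <- RtoC_opp; f_equal; ring).
      ring.
Qed.

Lemma W_derive_y k n x y z : is_deriveC (fun t => W k n x t z) y (Wy k n x y z).
Proof.
  revert n; induction k as [|k IH]; intros n.
  - unfold Wy. simpl INR. rewrite Cmult_0_l.
    replace (fun t => W 0 n x t z) with (fun _ : R => match n with O => RtoC 1 | _ => RtoC 0 end)
      by (apply functional_extensionality; intros t; now rewrite W_0).
    apply is_deriveC_const.
  - replace (fun t => W (S k) n x t z) with
      (fun t => ((cc x t) * W k n x t z + (RtoC (-2 * z) * W1 k n x t z
                     + (cc (- x) t) * W2 k n x t z))%C)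
      by (apply functional_extensionality; intros t; rewrite W_S; Wneg;
          replace (cc (- x) t) with (- (cc x (- t)))%C by (unfold Copp; simpl; f_equal; ring); ring).
    assert (H1 : forall n, is_deriveC (fun t => W1 k n x t z) y (shift (RtoC 0) (fun n => Wy k n x y z) n))
      by (intros m; apply (is_deriveC_shift (fun n t => W k n x t z)); auto).
    assert (H2 : is_deriveC (fun t => W2 k n x t z) y
       (shift (RtoC 0) (shift (RtoC 0) (fun n => Wy k n x y z)) n))
      by (apply (is_deriveC_shift (fun n t => W1 k n x t z)); auto).
    evar_last.
    + apply is_deriveC_plus; [|apply is_deriveC_plus; [apply is_deriveC_scal, H1 |]].
      * apply is_deriveC_mult; [|apply IH].
        instantiate (1 := Ci). dlin.
      * apply is_deriveC_mult; [|apply H2].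
        instantiate (1 := Ci). dlin.
    + unfold Wy at 4. cbn [pred]. rewrite S_INR, RtoC_plus.
      replace (shift (RtoC 0) (fun n0 : nat => Wy k n0 x y z) n)
        with (RtoC (INR k) * (Ci * (W1 (pred k) n x y z + W3 (pred k) n x y z)))%C
        by (destruct n; [unfold W1, W3; simpl; ring | reflexivity]).
      replace (shift (RtoC 0) (shift (RtoC 0) (fun n0 : nat => Wy k n0 x y z)) n)
        with (RtoC (INR k) * (Ci * (W2 (pred k) n x y z + W4 (pred k) n x y z)))%C
        by (destruct n as [|[|n]]; [unfold W2, W4; simpl; ring | unfold W2, W4, W1, W3; simpl; ring | reflexivity]).
      unfold Wy.
      Wstep. cbn [pred]. rewrite W_S, W2_S.
      replace (cc (- x) y) with (- (cc x (- y)))%C by (unfold Copp; simpl; f_equal; ring).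
      replace (RtoC (-2 * z)) with (- RtoC (2 * z))%C by (rewrite <- RtoC_opp; f_equal; ring).
      ring.
Qed.

Lemma W_derive_z k n x y z : is_deriveC (fun t => W k n x y t) z (Wz k n x y z).
Proof.
  revert n; induction k as [|k IH]; intros n.
  - unfold Wz. simpl INR. rewrite Cmult_0_l.
    replace (fun t => W 0 n x y t) with (fun _ : R => match n with O => RtoC 1 | _ => RtoC 0 end)
      by (apply functional_extensionality; intros t; now rewrite W_0).
    apply is_deriveC_const.
  - replace (fun t => W (S k) n x y t) with
      (fun t => ((cc x y) * W k n x y t + (RtoC (-2 * t) * W1 k n x y t
                     + (cc (- x) y) * W2 k n x y t))%C)
      by (apply functional_extensionality; intros t; rewrite W_S; Wneg;
          replace (cc (- x) y) with (- (cc x (- y)))%C by (unfold Copp; simpl; f_equal; ring); ring).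
    assert (H1 : forall n, is_deriveC (fun t => W1 k n x y t) z (shift (RtoC 0) (fun n => Wz k n x y z) n))
      by (intros m; apply (is_deriveC_shift (fun n t => W k n x y t)); auto).
    assert (H2 : is_deriveC (fun t => W2 k n x y t) z
       (shift (RtoC 0) (shift (RtoC 0) (fun n => Wz k n x y z)) n))
      by (apply (is_deriveC_shift (fun n t => W1 k n x y t)); auto).
    evar_last.
    + apply is_deriveC_plus; [|apply is_deriveC_plus; [|apply is_deriveC_scal, H2]].
      * apply is_deriveC_scal, IH.
      * apply is_deriveC_mult; [|apply H1].
        instantiate (1 := RtoC (-2)). dlin.
    + unfold Wz at 4. cbn [pred]. rewrite S_INR, RtoC_plus.
      replace (shift (RtoC 0) (fun n0 : nat => Wz k n0 x y z) n)
        with (RtoC (INR k) * (RtoC (-2) * W2 (pred k) n x y z))%C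
        by (destruct n; [unfold W1, W2; simpl; ring | reflexivity]).
      replace (shift (RtoC 0) (shift (RtoC 0) (fun n0 : nat => Wz k n0 x y z)) n)
        with (RtoC (INR k) * (RtoC (-2) * W3 (pred k) n x y z))%C
        by (destruct n as [|[|n]]; [unfold W2, W3; simpl; ring | unfold W2, W3, W1; simpl; ring | reflexivity]).
      unfold Wz.
      Wstep. cbn [pred]. rewrite W1_S.
      replace (cc (- x) y) with (- (cc x (- y)))%C by (unfold Copp; simpl; f_equal; ring).
      replace (RtoC (-2 * z)) with (- RtoC (2 * z))%C by (rewrite <- RtoC_opp; f_equal; ring).
      ring.
Qed.

(* Harmonicity with explicit second derivatives, a form stable under linear combinations. *)
Definition harmonicC (F : R -> R -> R -> C) : Prop :=
  exists Fx Fy Fz Fxx Fyy Fzz : R -> R -> R -> C,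
    forall x y z,
      is_deriveC (fun t => F t y z) x (Fx x y z) /\
      is_deriveC (fun t => F x t z) y (Fy x y z) /\
      is_deriveC (fun t => F x y t) z (Fz x y z) /\
      is_deriveC (fun t => Fx t y z) x (Fxx x y z) /\
      is_deriveC (fun t => Fy x t z) y (Fyy x y z) /\
      is_deriveC (fun t => Fz x y t) z (Fzz x y z) /\
      (Fxx x y z + Fyy x y z + Fzz x y z)%C = RtoC 0.

Lemma harmonicC_harmonic F : harmonicC F -> harmonic F.
Proof.
  intros (Fx & Fy & Fz & Fxx & Fyy & Fzz & H) x y z.
  assert (G : forall (pr : C -> R),
    (forall f t l, is_deriveC f t l -> is_derive (fun s => pr (f s)) t (pr l)) ->
    laplacian (fun a b c => pr (F a b c)) x y z = pr (Fxx x y z) + pr (Fyy x y z) + pr (Fzz x y z)).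
  { intros pr Hpr. unfold laplacian.
    f_equal; [f_equal|].
    - rewrite (Derive_ext _ (fun t => pr (Fx t y z)))
        by (intros t; apply is_derive_unique, (Hpr (fun t => F t y z)), H).
      apply is_derive_unique, (Hpr (fun t => Fx t y z)), H.
    - rewrite (Derive_ext _ (fun t => pr (Fy x t z)))
        by (intros t; apply is_derive_unique, (Hpr (fun t => F x t z)), H).
      apply is_derive_unique, (Hpr (fun t => Fy x t z)), H.
    - rewrite (Derive_ext _ (fun t => pr (Fz x y t)))
        by (intros t; apply is_derive_unique, (Hpr (fun t => F x y t)), H).
      apply is_derive_unique, (Hpr (fun t => Fz x y t)), H. }
  destruct (H x y z) as (_ & _ & _ & _ & _ & _ & E).
  rewrite (G Re) by (intros f t l [A _]; exact A).
  rewrite (G Im) by (intros f t l [_ A]; exact A).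
  split; [change 0 with (Re (RtoC 0)) | change 0 with (Im (RtoC 0))]; rewrite <- E; reflexivity.
Qed.

Lemma harmonicC_zero : harmonicC (fun _ _ _ => RtoC 0).
Proof.
  exists (fun _ _ _ => RtoC 0), (fun _ _ _ => RtoC 0), (fun _ _ _ => RtoC 0),
    (fun _ _ _ => RtoC 0), (fun _ _ _ => RtoC 0), (fun _ _ _ => RtoC 0).
  intros x y z. refine (conj _ (conj _ (conj _ (conj _ (conj _ (conj _ _)))))); try apply is_deriveC_const.
  ring.
Qed.

Lemma harmonicC_plus F G :
  harmonicC F -> harmonicC G -> harmonicC (fun x y z => F x y z + G x y z)%C.
Proof.
  intros (Fx & Fy & Fz & Fxx & Fyy & Fzz & HF) (Gx & Gy & Gz & Gxx & Gyy & Gzz & HG).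
  exists (fun x y z => Fx x y z + Gx x y z)%C, (fun x y z => Fy x y z + Gy x y z)%C,
    (fun x y z => Fz x y z + Gz x y z)%C, (fun x y z => Fxx x y z + Gxx x y z)%C,
    (fun x y z => Fyy x y z + Gyy x y z)%C, (fun x y z => Fzz x y z + Gzz x y z)%C.
  intros x y z.
  destruct (HF x y z) as (F1 & F2 & F3 & F4 & F5 & F6 & F7).
  destruct (HG x y z) as (G1 & G2 & G3 & G4 & G5 & G6 & G7).
  refine (conj _ (conj _ (conj _ (conj _ (conj _ (conj _ _)))))).
  - exact (is_deriveC_plus _ _ _ _ _ F1 G1).
  - exact (is_deriveC_plus _ _ _ _ _ F2 G2).
  - exact (is_deriveC_plus _ _ _ _ _ F3 G3).
  - exact (is_deriveC_plus _ _ _ _ _ F4 G4).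
  - exact (is_deriveC_plus _ _ _ _ _ F5 G5).
  - exact (is_deriveC_plus _ _ _ _ _ F6 G6).
  - transitivity ((Fxx x y z + Fyy x y z + Fzz x y z) + (Gxx x y z + Gyy x y z + Gzz x y z))%C;
      [ring|]. rewrite F7, G7. ring.
Qed.

Lemma harmonicC_scal c F : harmonicC F -> harmonicC (fun x y z => c * F x y z)%C.
Proof.
  intros (Fx & Fy & Fz & Fxx & Fyy & Fzz & HF).
  exists (fun x y z => c * Fx x y z)%C, (fun x y z => c * Fy x y z)%C,
    (fun x y z => c * Fz x y z)%C, (fun x y z => c * Fxx x y z)%C,
    (fun x y z => c * Fyy x y z)%C, (fun x y z => c * Fzz x y z)%C.
  intros x y z.
  destruct (HF x y z) as (F1 & F2 & F3 & F4 & F5 & F6 & F7).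
  refine (conj _ (conj _ (conj _ (conj _ (conj _ (conj _ _))))));
    [now apply is_deriveC_scal | now apply is_deriveC_scal | now apply is_deriveC_scal
    |now apply is_deriveC_scal | now apply is_deriveC_scal | now apply is_deriveC_scal |].
  transitivity (c * (Fxx x y z + Fyy x y z + Fzz x y z))%C; [ring|]. rewrite F7. ring.
Qed.

(** The gradient of the generating form is a null vector: (1 - s^2)^2 + (i(1 + s^2))^2 + (-2s)^2 =
    0. Hence every power of the form is harmonic for every s, and so is each coefficient of s^n. *)
Lemma harmonicC_W k n : harmonicC (W k n).
Proof.
  set (s2 := fun (V : nat -> nat -> R -> R -> R -> C) k n x y z =>
     shift (RtoC 0) (shift (RtoC 0) (fun n => V k n x y z)) n).
  set (s1 := fun (V : nat -> nat -> R -> R -> R -> C) k n x y z =>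
     shift (RtoC 0) (fun n => V k n x y z) n).
  exists (Wx k n), (Wy k n), (Wz k n),
    (fun x y z => RtoC (INR k) * (Wx (pred k) n x y z + RtoC (-1) * s2 Wx (pred k) n x y z))%C,
    (fun x y z => RtoC (INR k) * (Ci * (Wy (pred k) n x y z + s2 Wy (pred k) n x y z)))%C,
    (fun x y z => RtoC (INR k) * (RtoC (-2) * s1 Wz (pred k) n x y z))%C.
  intros x y z.
  refine (conj (W_derive_x _ _ _ _ _) (conj (W_derive_y _ _ _ _ _) (conj (W_derive_z _ _ _ _ _)
    (conj _ (conj _ (conj _ _)))))).
  - replace (fun t => Wx k n t y z) with
      (fun t => RtoC (INR k) * (W (pred k) n t y z + RtoC (-1) * W2 (pred k) n t y z))%C
      by (apply functional_extensionality; intros t; unfold Wx; ring).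
    apply is_deriveC_scal, is_deriveC_plus; [apply W_derive_x | apply is_deriveC_scal].
    apply (is_deriveC_shift (fun n t => W1 (pred k) n t y z)); intros m.
    apply (is_deriveC_shift (fun n t => W (pred k) n t y z)); intros m'. apply W_derive_x.
  - apply is_deriveC_scal, is_deriveC_scal, is_deriveC_plus; [apply W_derive_y |].
    apply (is_deriveC_shift (fun n t => W1 (pred k) n x t z)); intros m.
    apply (is_deriveC_shift (fun n t => W (pred k) n x t z)); intros m'. apply W_derive_y.
  - apply is_deriveC_scal, is_deriveC_scal.
    apply (is_deriveC_shift (fun n t => W (pred k) n x y t)); intros m'. apply W_derive_z.
  - unfold s1, s2. set (j := pred k). set (l := pred j).
    replace (shift (RtoC 0) (shift (RtoC 0) (fun n0 : nat => Wx j n0 x y z)) n)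
        with (RtoC (INR j) * (W2 l n x y z - W4 l n x y z))%C
        by (destruct n as [|[|m]]; [unfold W2, W4; simpl; ring | unfold W2, W4, W1, W3; simpl; ring | reflexivity]).
    replace (shift (RtoC 0) (shift (RtoC 0) (fun n0 : nat => Wy j n0 x y z)) n)
        with (RtoC (INR j) * (Ci * (W2 l n x y z + W4 l n x y z)))%C
        by (destruct n as [|[|m]]; [unfold W2, W4; simpl; ring | unfold W2, W4, W1, W3; simpl; ring | reflexivity]).
    replace (shift (RtoC 0) (fun n0 : nat => Wz j n0 x y z) n)
        with (RtoC (INR j) * (RtoC (-2) * W2 l n x y z))%C
        by (destruct n; [unfold W1, W2; simpl; ring | reflexivity]).
    unfold Wx, Wy. fold l.
    generalize (W l n x y z) (W2 l n x y z) (W4 l n x y z) (INR k) (INR j).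
    intros [a b] [c d] [e f] r s. unfold Cplus, Cmult, Cminus, Copp, RtoC, Ci.
    apply injective_projections; simpl; ring.
Qed.

(** * Finite sums and comparison of coefficients *)

Fixpoint rsum (f : nat -> R) (N : nat) : R :=
  match N with O => 0 | S n => rsum f n + f n end.

Fixpoint csum (f : nat -> C) (N : nat) : C :=
  match N with O => RtoC 0 | S n => Cplus (csum f n) (f n) end.

Lemma rsum_ext f g N : (forall n, (n < N)%nat -> f n = g n) -> rsum f N = rsum g N.
Proof.
  induction N as [|N IH]; intros H; simpl; [reflexivity|].
  rewrite IH by (intros; apply H; lia). now rewrite H by lia.
Qed.

Lemma csum_ext f g N : (forall n, (n < N)%nat -> f n = g n) -> csum f N = csum g N.
Proof.
  induction N as [|N IH]; intros H; simpl; [reflexivity|].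
  rewrite IH by (intros; apply H; lia). now rewrite H by lia.
Qed.

Lemma rsum_scal c f N : rsum (fun n => c * f n) N = c * rsum f N.
Proof. induction N as [|N IH]; simpl; [|rewrite IH]; ring. Qed.

Lemma rsum_plus f g N : rsum (fun n => f n + g n) N = rsum f N + rsum g N.
Proof. induction N as [|N IH]; simpl; [|rewrite IH]; ring. Qed.

Lemma csum_scal c f N : csum (fun n => (c * f n)%C) N = (c * csum f N)%C.
Proof. induction N as [|N IH]; simpl; [|rewrite IH]; ring. Qed.

Lemma csum_plus f g N : csum (fun n => (f n + g n)%C) N = (csum f N + csum g N)%C.
Proof. induction N as [|N IH]; simpl; [|rewrite IH]; ring. Qed.

Lemma Re_csum f N : Re (csum f N) = rsum (fun n => Re (f n)) N.
Proof. induction N as [|N IH]; simpl; [reflexivity|]. rewrite <- IH. reflexivity. Qed.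

Lemma Im_csum f N : Im (csum f N) = rsum (fun n => Im (f n)) N.
Proof. induction N as [|N IH]; simpl; [reflexivity|]. rewrite <- IH. reflexivity. Qed.

Lemma rsum_sum_f_R0 f N : sum_f_R0 f N = rsum f (S N).
Proof. induction N as [|N IH]; [simpl; ring|]. simpl sum_f_R0. rewrite IH. reflexivity. Qed.

Lemma rsum_S_l f N : rsum f (S N) = f O + rsum (fun n => f (S n)) N.
Proof. induction N as [|N IH]; [simpl; ring|]. change (rsum f (S (S N))) with (rsum f (S N) + f (S N)).
  rewrite IH. simpl. ring. Qed.

Lemma csum_S_l f N : csum f (S N) = (f O + csum (fun n => f (S n)) N)%C.
Proof. induction N as [|N IH]; [simpl; ring|]. change (csum f (S (S N))) with (csum f (S N) + f (S N))%C.
  rewrite IH. simpl. ring. Qed.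

Lemma rsum_0 f N : (forall n, (n < N)%nat -> f n = 0) -> rsum f N = 0.
Proof.
  induction N as [|N IH]; intros H; simpl; [reflexivity|].
  rewrite IH by (intros; apply H; lia). rewrite H by lia. ring.
Qed.

Lemma rsum_single f N m : (m < N)%nat -> (forall n, (n < N)%nat -> n <> m -> f n = 0) ->
  rsum f N = f m.
Proof.
  induction N as [|N IH]; intros Hm H; simpl; [lia|].
  destruct (Nat.eq_dec m N) as [->|E].
  - rewrite rsum_0 by (intros n Hn; apply H; lia). ring.
  - rewrite IH by (try lia; intros n Hn; apply H; lia). rewrite (H N) by lia. ring.
Qed.

Lemma rsum_const c N : rsum (fun _ => c) N = INR N * c.
Proof. induction N as [|N IH]; [simpl; ring|]. rewrite S_INR. simpl. rewrite IH. ring. Qed.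

Lemma rsum_le f g N : (forall n, (n < N)%nat -> f n <= g n) -> rsum f N <= rsum g N.
Proof.
  induction N as [|N IH]; intros H; simpl; [lra|].
  apply Rplus_le_compat; [apply IH; intros; apply H; lia | apply H; lia].
Qed.

Lemma rsum_ge_0 f N : (forall n, (n < N)%nat -> 0 <= f n) -> 0 <= rsum f N.
Proof.
  induction N as [|N IH]; intros H; simpl; [lra|].
  assert (0 <= rsum f N) by (apply IH; intros; apply H; lia).
  assert (0 <= f N) by (apply H; lia). lra.
Qed.

(** The constant term is O(s) as s tends to 0, hence zero; dividing by s lowers the degree. The
    range 0 < s < 1 suits [pairing_gen], which holds for s > 0. *)
Lemma poly_coef_zero (a : nat -> R) N :
  (forall s, 0 < s < 1 -> rsum (fun n => a n * s ^ n) N = 0) ->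
  forall n, (n < N)%nat -> a n = 0.
Proof.
  revert a; induction N as [|N IH]; intros a H n Hn; [lia|].
  assert (H0 : a O = 0).
  { set (M := rsum (fun n => Rabs (a (S n))) N).
    assert (HM : 0 <= M) by (apply rsum_ge_0; intros; apply Rabs_pos).
    assert (Hs : forall s, 0 < s < 1 -> Rabs (a O) <= s * M).
    { intros s Hs. generalize (H s Hs). rewrite rsum_S_l. intros E.
      replace (a O) with (- (s * rsum (fun n => a (S n) * s ^ n) N)).
      - rewrite Rabs_Ropp, Rabs_mult, (Rabs_pos_eq s) by lra.
        apply Rmult_le_compat_l; [lra|]. unfold M.
        clear - Hs. induction N as [|N IH]; simpl; [rewrite Rabs_R0; lra|].
        eapply Rle_trans; [apply Rabs_triang|]. apply Rplus_le_compat; [exact IH|].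
        rewrite Rabs_mult. rewrite <- (Rmult_1_r (Rabs (a (S N)))) at 2.
        apply Rmult_le_compat_l; [apply Rabs_pos|].
        rewrite Rabs_pos_eq by (apply pow_le; lra).
        rewrite <- (pow1 N). apply pow_incr; lra.
      - rewrite <- rsum_scal. rewrite pow_O, Rmult_1_r in E.
        assert (E2 : rsum (fun n => a (S n) * s ^ S n) N = rsum (fun n => s * (a (S n) * s ^ n)) N)
          by (apply rsum_ext; intros; simpl; ring).
        rewrite E2 in E. lra. }
    destruct (Req_dec (a O) 0) as [E|E]; [exact E|exfalso].
    assert (Hp : 0 < Rabs (a O)) by (apply Rabs_pos_lt; exact E).
    set (r := Rabs (a O) / (2 * (M + Rabs (a O)))).
    assert (Hr : 0 < r < 1).
    { unfold r; split; [apply Rdiv_lt_0_compat; lra|].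
      apply Rmult_lt_reg_r with (2 * (M + Rabs (a O))); [lra|].
      unfold Rdiv. rewrite Rmult_assoc, Rinv_l by lra. lra. }
    generalize (Hs r Hr).
    assert (r * M < Rabs (a O)); [|lra].
    apply Rmult_lt_reg_r with (2 * (M + Rabs (a O))); [lra|].
    replace (r * M * (2 * (M + Rabs (a O)))) with (Rabs (a O) * M) by (unfold r; field; lra).
    apply Rmult_lt_compat_l; lra. }
  destruct n as [|n]; [exact H0|].
  apply (IH (fun n => a (S n))); [|lia].
  intros s Hs. generalize (H s Hs). rewrite rsum_S_l, H0.
  rewrite (rsum_ext _ (fun n => s * (a (S n) * s ^ n))) by (intros; simpl; ring).
  rewrite rsum_scal. intros E.
  apply Rmult_eq_reg_l with s; lra.
Qed.

(** * Integration over the sphere *)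

Definition cont2 (g : R -> R -> R) : Prop :=
  forall p, continuous (fun p : R * R => g (fst p) (snd p)) p.

Lemma cont2_inner (g : R -> R -> R) phi : cont2 g -> forall t, continuous (fun t => g phi t * sin phi) t.
Proof.
  intros H t. apply continuous_Rmult; [|apply continuous_const].
  apply (continuous_slice g phi t). apply H.
Qed.

Lemma cont2_outer (g : R -> R -> R) : cont2 g ->
  forall phi, continuous (fun phi => RInt (fun theta => g phi theta * sin phi) 0 (2 * PI)) phi.
Proof.
  intros H phi.
  apply (continuous_RInt_param (fun phi theta => g phi theta * sin phi)).
  - generalize PI_RGT_0; lra.
  - intros x t. apply continuous_Rmult; [apply (H (x, t))|]. auto with conts.
Qed.

Lemma cont2_plus f g : cont2 f -> cont2 g -> cont2 (fun a b => f a b + g a b).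
Proof. intros Hf Hg p; apply continuous_Rplus; auto. Qed.

Lemma cont2_mult f g : cont2 f -> cont2 g -> cont2 (fun a b => f a b * g a b).
Proof. intros Hf Hg p; apply continuous_Rmult; auto. Qed.

Lemma cont2_const c : cont2 (fun _ _ => c).
Proof. intros p; apply continuous_const. Qed.

Lemma cont2_scal c g : cont2 g -> cont2 (fun a b => c * g a b).
Proof. intros H; apply cont2_mult; auto using cont2_const. Qed.

Lemma cont2_rsum (f : nat -> R -> R -> R) N : (forall n, cont2 (f n)) -> cont2 (fun a b => rsum (fun n => f n a b) N).
Proof.
  intros H; induction N as [|N IH]; simpl; [apply cont2_const|].
  apply (cont2_plus _ (f N)); auto.
Qed.

Lemma sphere_integral_plus f g : cont2 f -> cont2 g ->
  sphere_integral (fun a b => f a b + g a b) = sphere_integral f + sphere_integral g.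
Proof.
  intros Hf Hg. unfold sphere_integral.
  rewrite <- RInt_Rplus by (apply cont2_outer; auto).
  apply RInt_ext; intros phi _.
  rewrite <- RInt_Rplus by (apply cont2_inner; auto).
  apply RInt_ext; intros theta _. eqR. ring.
Qed.

Lemma sphere_integral_scal c g : cont2 g ->
  sphere_integral (fun a b => c * g a b) = c * sphere_integral g.
Proof.
  intros Hg. unfold sphere_integral.
  rewrite <- RInt_Rscal by (apply cont2_outer; auto).
  apply RInt_ext; intros phi _.
  rewrite <- RInt_Rscal by (apply cont2_inner; auto).
  apply RInt_ext; intros theta _. eqR. ring.
Qed.

Lemma sphere_integral_ext f g :
  (forall phi theta, 0 < phi < PI -> f phi theta = g phi theta) ->
  sphere_integral f = sphere_integral g.
Proof.
  intros H. unfold sphere_integral. apply RInt_ext; intros phi Hphi.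
  rewrite Rmin_left, Rmax_right in Hphi by (generalize PI_RGT_0; lra).
  apply RInt_ext; intros theta _. now rewrite H.
Qed.

Lemma sphere_integral_le f g : cont2 f -> cont2 g ->
  (forall phi theta, 0 < phi < PI -> f phi theta <= g phi theta) ->
  sphere_integral f <= sphere_integral g.
Proof.
  intros Hf Hg H. pose proof PI_RGT_0. unfold sphere_integral. apply RInt_le; [lra| | |].
  - apply ex_RInt_cont, cont2_outer; auto.
  - apply ex_RInt_cont, cont2_outer; auto.
  - intros phi Hphi. apply RInt_le; [lra| | |].
    + apply ex_RInt_cont, cont2_inner; auto.
    + apply ex_RInt_cont, cont2_inner; auto.
    + intros theta _. apply Rmult_le_compat_r; [|auto].
      left; apply sin_gt_0; lra.
Qed.

Lemma sphere_integral_rsum (f : nat -> R -> R -> R) N : (forall n, cont2 (f n)) ->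
  sphere_integral (fun a b => rsum (fun n => f n a b) N) = rsum (fun n => sphere_integral (f n)) N.
Proof.
  intros H; induction N as [|N IH]; simpl.
  - unfold sphere_integral. rewrite (RInt_ext _ (fun _ => 0)).
    + rewrite RInt_const. apply Rmult_0_r.
    + intros phi _. rewrite (RInt_ext _ (fun _ => 0)) by (intros; eqR; ring).
      rewrite RInt_const. apply Rmult_0_r.
  - rewrite (sphere_integral_plus (fun a b => rsum (fun n => f n a b) N) (f N)); auto.
    + now rewrite IH.
    + now apply cont2_rsum.
Qed.

Lemma sphere_integral_theta_zero (a : R -> R) (b : R -> R) :
  (forall t, continuous b t) -> RInt b 0 (2 * PI) = 0 ->
  sphere_integral (fun phi theta => a phi * b theta) = 0.
Proof.
  intros Hc Hb. unfold sphere_integral. rewrite (RInt_ext _ (fun _ => 0)).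
  - rewrite RInt_const. apply Rmult_0_r.
  - intros phi _. rewrite (RInt_ext _ (fun th => (a phi * sin phi) * b th)) by (intros; eqR; ring).
    rewrite RInt_Rscal by auto. rewrite Hb. apply Rmult_0_r.
Qed.

Lemma RInt_cos_full j : j <> 0 -> sin (j * (2 * PI)) = 0 ->
  RInt (fun t => cos (j * t)) 0 (2 * PI) = 0.
Proof.
  intros Hj Hs.
  rewrite (RInt_of_derive (fun t => / j * sin (j * t))).
  - rewrite Hs, !Rmult_0_r, sin_0. eqR; ring.
  - intros t. auto_derive; auto. field; auto.
  - intros t. auto with conts.
Qed.

Lemma RInt_sin_full j : j <> 0 -> cos (j * (2 * PI)) = 1 ->
  RInt (fun t => sin (j * t)) 0 (2 * PI) = 0.
Proof.
  intros Hj Hs.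
  rewrite (RInt_of_derive (fun t => - / j * cos (j * t))).
  - rewrite Hs, Rmult_0_r, cos_0. eqR; ring.
  - intros t. auto_derive; auto. field; auto.
  - intros t. auto with conts.
Qed.

Lemma sin_INR_diff m n : sin ((INR m - INR n) * (2 * PI)) = 0.
Proof.
  replace ((INR m - INR n) * (2 * PI)) with ((0 + 2 * INR m * PI) - (0 + 2 * INR n * PI)) by ring.
  rewrite sin_minus, !sin_period, !cos_period, sin_0. ring.
Qed.

Lemma cos_INR_diff m n : cos ((INR m - INR n) * (2 * PI)) = 1.
Proof.
  replace ((INR m - INR n) * (2 * PI)) with ((0 + 2 * INR m * PI) - (0 + 2 * INR n * PI)) by ring.
  rewrite cos_minus, !sin_period, !cos_period, sin_0, cos_0. ring.
Qed.

(** * The functions W on the sphere *)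

(** The real phi-profile of [W k n], obtained by stripping the phases from its recursion at x + iy =
    sin phi e^(i theta); up to a constant it is the associated Legendre function of degree k and
    order k - n. *)
Fixpoint wf (k n : nat) (phi : R) : R :=
  match k with
  | O => match n with O => 1 | _ => 0 end
  | S k => sin phi * wf k n phi - 2 * cos phi * shift 0 (fun n => wf k n phi) n
           - sin phi * shift 0 (shift 0 (fun n => wf k n phi)) n
  end.

Lemma cexpi_plus a b : cexpi (a + b) = (cexpi a * cexpi b)%C.
Proof.
  unfold cexpi, Cmult; simpl. rewrite cos_plus, sin_plus. f_equal; ring.
Qed.

Lemma cexpi_0 : cexpi 0 = RtoC 1.
Proof. unfold cexpi. now rewrite cos_0, sin_0. Qed.

Lemma W_sphere k n phi theta :
  W k n (sx phi theta) (sy phi theta) (sz phi theta)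
  = (RtoC (wf k n phi) * cexpi ((INR k - INR n) * theta))%C.
Proof.
  revert n; induction k as [|k IH]; intros n.
  - rewrite W_0. destruct n; simpl.
    + replace ((0 - 0) * theta) with 0 by ring. rewrite cexpi_0. ring.
    + ring.
  - rewrite W_S.
    replace (sx phi theta, sy phi theta) with (RtoC (sin phi) * cexpi theta)%C
      by (unfold sx, sy, cexpi, Cmult, RtoC; simpl; f_equal; ring).
    replace (@pair R R (sx phi theta) (- sy phi theta)) with (RtoC (sin phi) * cexpi (- theta))%C
      by (unfold sx, sy, cexpi, Cmult, RtoC; simpl; rewrite cos_neg, sin_neg; f_equal; ring).
    unfold sz.
    assert (E : forall m, (cexpi ((INR (S k) - INR m) * theta) = cexpi theta * cexpi ((INR k - INR m) * theta))%C).
    { intros m. rewrite <- cexpi_plus. f_equal. rewrite S_INR. ring. }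
    assert (E1 : (W1 k n (sx phi theta) (sy phi theta) (cos phi)
       = RtoC (shift 0 (fun n => wf k n phi) n) * cexpi ((INR (S k) - INR n) * theta))%C).
    { destruct n as [|n]; unfold W1; simpl shift; [ring|].
      fold (sz phi theta). rewrite IH. do 2 f_equal. rewrite !S_INR. ring. }
    assert (E2 : (cexpi (- theta) * W2 k n (sx phi theta) (sy phi theta) (cos phi)
       = RtoC (shift 0 (shift 0 (fun n => wf k n phi)) n) * cexpi ((INR (S k) - INR n) * theta))%C).
    { destruct n as [|[|n]]; unfold W2, W1; simpl shift; [ring|ring|].
      fold (sz phi theta). rewrite IH.
      transitivity (RtoC (wf k n phi) * (cexpi (- theta) * cexpi ((INR k - INR n) * theta)))%C; [ring|].
      rewrite <- cexpi_plus. do 2 f_equal. rewrite !S_INR. ring. }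
    change (W k n (sx phi theta) (sy phi theta) (cos phi)) with (W k n (sx phi theta) (sy phi theta) (sz phi theta)).
    rewrite IH, E1. cbn [wf].
    rewrite !RtoC_minus, !RtoC_mult.
    transitivity (RtoC (sin phi) * RtoC (wf k n phi) * (cexpi theta * cexpi ((INR k - INR n) * theta))
      - RtoC 2 * RtoC (cos phi) * (RtoC (shift 0 (fun n => wf k n phi) n) * cexpi ((INR (S k) - INR n) * theta))
      - RtoC (sin phi) * (cexpi (- theta) * W2 k n (sx phi theta) (sy phi theta) (cos phi)))%C; [ring|].
    rewrite E2, <- E. ring.
Qed.

Lemma wf_0 k phi : wf k 0 phi = sin phi ^ k.
Proof. induction k as [|k IH]; [reflexivity|]. cbn [wf shift]. rewrite IH. simpl. ring. Qed.

Lemma continuous_wf k n phi : continuous (wf k n) phi.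
Proof.
  revert n; induction k as [|k IH]; intros n.
  - apply continuous_const.
  - assert (H1 : forall n, continuous (fun phi => shift 0 (fun n => wf k n phi) n) phi).
    { intros [|m]; simpl; [apply continuous_const | apply IH]. }
    assert (H2 : forall n, continuous (fun phi => shift 0 (shift 0 (fun n => wf k n phi)) n) phi).
    { intros [|m]; simpl; [apply continuous_const | apply H1]. }
    cbn [wf]. specialize (IH n). specialize (H1 n). specialize (H2 n). auto 10 with conts.
Qed.

Definition Wp k m n phi theta : C :=
  (W k m (sx phi theta) (sy phi theta) (sz phi theta)
   * Cconj (W k n (sx phi theta) (sy phi theta) (sz phi theta)))%C.

Lemma Wp_Re k m n phi theta :
  Re (Wp k m n phi theta) = wf k m phi * wf k n phi * cos ((INR n - INR m) * theta).
Proof.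
  unfold Wp. rewrite !W_sphere.
  replace ((INR n - INR m) * theta) with ((INR k - INR m) * theta - (INR k - INR n) * theta) by ring.
  rewrite cos_minus. unfold cexpi, Cconj, Cmult, RtoC, Re; simpl. ring.
Qed.

Lemma Wp_Im k m n phi theta :
  Im (Wp k m n phi theta) = wf k m phi * wf k n phi * sin ((INR n - INR m) * theta).
Proof.
  unfold Wp. rewrite !W_sphere.
  replace ((INR n - INR m) * theta) with ((INR k - INR m) * theta - (INR k - INR n) * theta) by ring.
  rewrite sin_minus. unfold cexpi, Cconj, Cmult, RtoC, Im; simpl. ring.
Qed.

Lemma cont2_fst (f : R -> R) : (forall x, continuous f x) -> cont2 (fun a _ => f a).
Proof. intros H p. apply (continuous_fst_comp f). apply H. Qed.

Lemma cont2_Wp_Re k m n : cont2 (fun a b => Re (Wp k m n a b)).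
Proof.
  intros p. apply (continuous_ext (fun p : R * R => wf k m (fst p) * wf k n (fst p) * cos ((INR n - INR m) * snd p))).
  - intros q; now rewrite Wp_Re.
  - pose proof (continuous_wf k). auto 10 with conts.
Qed.

Lemma cont2_Wp_Im k m n : cont2 (fun a b => Im (Wp k m n a b)).
Proof.
  intros p. apply (continuous_ext (fun p : R * R => wf k m (fst p) * wf k n (fst p) * sin ((INR n - INR m) * snd p))).
  - intros q; now rewrite Wp_Im.
  - pose proof (continuous_wf k). auto 10 with conts.
Qed.

Lemma INR_diff_neq m n : m <> n -> INR n - INR m <> 0.
Proof. intros H E. apply H. apply INR_eq. lra. Qed.

(** Distinct indices carry distinct characters e^(i(k-n) theta), so orthogonality survives any
    weight that depends on phi alone. This is the form in which multiplicity one enters. *)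
Lemma sphere_integral_Wp_Re_off k m n (g : R -> R) : m <> n ->
  sphere_integral (fun phi theta => Re (Wp k m n phi theta) * g phi) = 0.
Proof.
  intros H.
  rewrite (sphere_integral_ext _ (fun phi theta => (wf k m phi * wf k n phi * g phi) * cos ((INR n - INR m) * theta)))
    by (intros; rewrite Wp_Re; ring).
  apply sphere_integral_theta_zero; [intros; auto with conts|].
  apply RInt_cos_full; [now apply INR_diff_neq | apply sin_INR_diff].
Qed.

Lemma sphere_integral_Wp_Im k m n :
  sphere_integral (fun phi theta => Im (Wp k m n phi theta)) = 0.
Proof.
  rewrite (sphere_integral_ext _ (fun phi theta => (wf k m phi * wf k n phi) * sin ((INR n - INR m) * theta)))
    by (intros; rewrite Wp_Im; ring).
  apply sphere_integral_theta_zero; [intros; auto with conts|].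
  destruct (Nat.eq_dec m n) as [->|H].
  - rewrite (RInt_ext _ (fun _ => 0)).
    + rewrite RInt_const. apply Rmult_0_r.
    + intros x _. replace ((INR n - INR n) * x) with 0 by ring. apply sin_0.
  - apply RInt_sin_full; [now apply INR_diff_neq | apply cos_INR_diff].
Qed.

(** * C^1 functions, and the linear forms [Zab] whose powers are the beams *)

Definition ex_C1 (h : R -> R -> R -> R) : Prop := exists hx hy hz, C1_3 h hx hy hz.

Lemma ex_C1_const c : ex_C1 (fun _ _ _ => c).
Proof.
  exists (fun _ _ _ => 0), (fun _ _ _ => 0), (fun _ _ _ => 0); split.
  - intros a b d t a' b' d' _ _ _. evar_last.
    + apply (is_derive_const (V := R_NormedModule)).
    + unfold zero; simpl; ring.
  - intros; repeat split; apply continuous_const.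
Qed.

Lemma ex_C1_x : ex_C1 (fun x _ _ => x).
Proof.
  exists (fun _ _ _ => 1), (fun _ _ _ => 0), (fun _ _ _ => 0); split.
  - intros a b d t a' b' d' Ha Hb Hd. evar_last; [exact Ha|eqR; ring].
  - intros; repeat split; auto; apply continuous_const.
Qed.

Lemma ex_C1_y : ex_C1 (fun _ y _ => y).
Proof.
  exists (fun _ _ _ => 0), (fun _ _ _ => 1), (fun _ _ _ => 0); split.
  - intros a b d t a' b' d' Ha Hb Hd. evar_last; [exact Hb|eqR; ring].
  - intros; repeat split; auto; apply continuous_const.
Qed.

Lemma ex_C1_z : ex_C1 (fun _ _ z => z).
Proof.
  exists (fun _ _ _ => 0), (fun _ _ _ => 0), (fun _ _ _ => 1); split.
  - intros a b d t a' b' d' Ha Hb Hd. evar_last; [exact Hd|eqR; ring].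
  - intros; repeat split; auto; apply continuous_const.
Qed.

Lemma ex_C1_plus f g : ex_C1 f -> ex_C1 g -> ex_C1 (fun x y z => f x y z + g x y z).
Proof.
  intros (fx & fy & fz & [F1 F2]) (gx & gy & gz & [G1 G2]).
  exists (fun x y z => fx x y z + gx x y z), (fun x y z => fy x y z + gy x y z),
    (fun x y z => fz x y z + gz x y z); split.
  - intros a b d t a' b' d' Ha Hb Hd. evar_last.
    + apply (is_derive_plus (V := R_NormedModule) (fun t => f (a t) (b t) (d t)) (fun t => g (a t) (b t) (d t)));
        [apply F1; eassumption | apply G1; eassumption].
    + unfold plus; simpl; ring.
  - intros U a b c x Ha Hb Hc.
    destruct (F2 U a b c x Ha Hb Hc) as (? & ? & ? & ?).
    destruct (G2 U a b c x Ha Hb Hc) as (? & ? & ? & ?).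
    repeat split; apply continuous_Rplus; auto.
Qed.

Lemma ex_C1_mult f g : ex_C1 f -> ex_C1 g -> ex_C1 (fun x y z => f x y z * g x y z).
Proof.
  intros (fx & fy & fz & [F1 F2]) (gx & gy & gz & [G1 G2]).
  exists (fun x y z => fx x y z * g x y z + f x y z * gx x y z),
    (fun x y z => fy x y z * g x y z + f x y z * gy x y z),
    (fun x y z => fz x y z * g x y z + f x y z * gz x y z); split.
  - intros a b d t a' b' d' Ha Hb Hd. evar_last.
    + apply (is_derive_Rmult (fun t => f (a t) (b t) (d t)) (fun t => g (a t) (b t) (d t)));
        [apply F1; eassumption | apply G1; eassumption].
    + simpl; ring.
  - intros U a b c x Ha Hb Hc.
    destruct (F2 U a b c x Ha Hb Hc) as (? & ? & ? & ?).
    destruct (G2 U a b c x Ha Hb Hc) as (? & ? & ? & ?).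
    repeat split; auto with conts.
Qed.

Lemma is_derive_Rpower q u : 0 < u -> is_derive (fun t => Rpower t q) u (q * Rpower u (q - 1)).
Proof.
  intros Hu. apply is_derive_Reals. apply derivable_pt_lim_power. exact Hu.
Qed.

Lemma continuous_Rpower_l {U : UniformSpace} (f : U -> R) q x :
  0 < f x -> continuous f x -> continuous (fun u => Rpower (f u) q) x.
Proof.
  intros Hp Hf. apply (continuous_comp_R (fun t => Rpower t q) f); auto.
  apply (ex_derive_continuous (V := R_NormedModule)). eexists. now apply is_derive_Rpower.
Qed.

(** Positivity of the base is what the added eps secures: the squared modulus of a beam's linear
    form vanishes on the axis of the beam. *)
Lemma ex_C1_Rpower f q : (forall x y z, 0 < f x y z) -> ex_C1 f ->
  ex_C1 (fun x y z => Rpower (f x y z) q).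
Proof.
  intros Hp (fx & fy & fz & [F1 F2]).
  exists (fun x y z => q * Rpower (f x y z) (q - 1) * fx x y z),
    (fun x y z => q * Rpower (f x y z) (q - 1) * fy x y z),
    (fun x y z => q * Rpower (f x y z) (q - 1) * fz x y z); split.
  - intros a b d t a' b' d' Ha Hb Hd. evar_last.
    + apply (is_derive_comp (fun t => Rpower t q) (fun t => f (a t) (b t) (d t)));
        [apply is_derive_Rpower, Hp | apply F1; eassumption].
    + unfold scal; simpl. unfold mult; simpl. ring.
  - intros U a b c x Ha Hb Hc.
    destruct (F2 U a b c x Ha Hb Hc) as (? & ? & ? & ?).
    assert (forall q, continuous (fun u => Rpower (f (a u) (b u) (c u)) q) x)
      by (intros q'; apply (continuous_Rpower_l (fun u => f (a u) (b u) (c u))); auto).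
    repeat split; auto with conts.
Qed.

Lemma ex_C1_ext f g : (forall x y z, f x y z = g x y z) -> ex_C1 f -> ex_C1 g.
Proof.
  intros E. replace g with f; [auto|].
  do 3 (apply functional_extensionality; intro); apply E.
Qed.

Definition ex_C1C (F : R -> R -> R -> C) : Prop :=
  ex_C1 (fun x y z => Re (F x y z)) /\ ex_C1 (fun x y z => Im (F x y z)).

Lemma ex_C1C_mult F G : ex_C1C F -> ex_C1C G -> ex_C1C (fun x y z => F x y z * G x y z)%C.
Proof.
  intros [F1 F2] [G1 G2]; split.
  - apply (ex_C1_ext (fun x y z => Re (F x y z) * Re (G x y z) + (-1) * (Im (F x y z) * Im (G x y z)))).
    + intros; unfold Re, Im, Cmult; simpl; ring.
    + apply ex_C1_plus; repeat apply ex_C1_mult; auto using ex_C1_const.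
  - apply (ex_C1_ext (fun x y z => Re (F x y z) * Im (G x y z) + Im (F x y z) * Re (G x y z))).
    + intros; unfold Re, Im, Cmult; simpl; ring.
    + apply ex_C1_plus; repeat apply ex_C1_mult; auto using ex_C1_const.
Qed.

Lemma ex_C1C_pow F k : ex_C1C F -> ex_C1C (fun x y z => F x y z ^ k)%C.
Proof.
  intros H; induction k as [|k IH]; simpl.
  - split; apply ex_C1_const.
  - now apply ex_C1C_mult.
Qed.

Lemma ex_C1C_conj F : ex_C1C F -> ex_C1C (fun x y z => Cconj (F x y z)).
Proof.
  intros [F1 F2]; split; [exact F1|].
  apply (ex_C1_ext (fun x y z => -1 * Im (F x y z))).
  - intros; unfold Cconj, Im; simpl; ring.
  - apply ex_C1_mult; auto using ex_C1_const.
Qed.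

(* The linear form of the null vector attached to the spinor (a,b):
   a^2 (x+iy) - 2ab z - b^2 (x-iy). *)
Definition Zab (a b x y z : R) : C :=
  (a ^ 2 * x - 2 * a * b * z - b ^ 2 * x, (a ^ 2 + b ^ 2) * y)%R.

Lemma ex_C1C_Zab a b : ex_C1C (Zab a b).
Proof.
  split.
  - apply (ex_C1_ext (fun x y z => (a ^ 2 - b ^ 2) * x + (- 2 * a * b) * z)).
    + intros; unfold Zab, Re; simpl; ring.
    + apply ex_C1_plus; apply ex_C1_mult; auto using ex_C1_const, ex_C1_x, ex_C1_z.
  - apply (ex_C1_ext (fun x y z => (a ^ 2 + b ^ 2) * y)).
    + intros; unfold Zab, Im; simpl; ring.
    + apply ex_C1_mult; auto using ex_C1_const, ex_C1_y.
Qed.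

(** Half-angle rule of spinors: turning the vector by 2g turns (a, b) by g. *)
Lemma Zab_rot a b g x y z :
  Zab a b (cos (2 * g) * x - sin (2 * g) * z) y (sin (2 * g) * x + cos (2 * g) * z)
  = Zab (a * cos g - b * sin g) (a * sin g + b * cos g) x y z.
Proof.
  unfold Zab. rewrite cos_2a, sin_2a.
  f_equal; [ring|].
  transitivity ((a ^ 2 + b ^ 2) * ((sin g)² + (cos g)²) * y); [rewrite sin2_cos2; ring | unfold Rsqr; ring].
Qed.

Lemma Zab_scal a b x y z : a <> 0 -> Zab a b x y z = (RtoC (a ^ 2) * Zab 1 (b / a) x y z)%C.
Proof.
  intros Ha. unfold Zab, Cmult, RtoC; simpl. f_equal; field; auto.
Qed.

Lemma csum_extend f N M : (N <= M)%nat -> (forall n, (N <= n < M)%nat -> f n = RtoC 0) ->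
  csum f M = csum f N.
Proof.
  intros H; induction H as [|M HM IH]; intros Hf; [reflexivity|].
  simpl. rewrite IH by (intros; apply Hf; lia). rewrite Hf by lia. ring.
Qed.

Lemma W_generating k s x y z :
  csum (fun n => RtoC (s ^ n) * W k n x y z)%C (2 * k + 1) = (Zab 1 s x y z ^ k)%C.
Proof.
  induction k as [|k IH].
  - simpl. rewrite W_0. ring.
  - simpl Cpow. rewrite <- IH.
    rewrite (csum_ext _ (fun n => ((x, y) * (RtoC (s ^ n) * W k n x y z)
       + (RtoC (-2 * z) * (RtoC (s ^ n) * W1 k n x y z)
       + @pair R R (- x)%R y * (RtoC (s ^ n) * W2 k n x y z)))%C)).
    2:{ intros n _. rewrite W_S.
        replace (RtoC (-2 * z)) with (- RtoC (2 * z))%C by (rewrite <- RtoC_opp; f_equal; ring).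
        replace (@pair R R (- x)%R y) with (- (@pair R R x (- y)%R))%C by (unfold Copp; simpl; f_equal; ring).
        ring. }
    rewrite !csum_plus, !csum_scal.
    (* One more factor adds two powers of s. The three sums are brought back to the same range:
       surplus top terms vanish by [W_large], and the shifted sums lose their zero leading terms. *)
    replace (2 * S k + 1)%nat with (S (S (2 * k + 1))) by lia.
    rewrite (csum_extend (fun n => (RtoC (s ^ n) * W k n x y z)%C) (2 * k + 1))
      by (try lia; intros n Hn; rewrite W_large by lia; ring).
    rewrite (csum_S_l (fun n => (RtoC (s ^ n) * W1 k n x y z)%C)).
    rewrite (csum_S_l (fun n => (RtoC (s ^ n) * W2 k n x y z)%C)).
    rewrite (csum_S_l (fun n => (RtoC (s ^ S n) * W2 k (S n) x y z)%C)).
    unfold W2, W1; cbn [shift].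
    rewrite (csum_ext (fun n => (RtoC (s ^ S n) * W k n x y z)%C) (fun n => (RtoC s * (RtoC (s ^ n) * W k n x y z))%C))
      by (intros; simpl pow; rewrite RtoC_mult; ring).
    rewrite (csum_ext (fun n => (RtoC (s ^ S (S n)) * W k n x y z)%C) (fun n => (RtoC (s * s) * (RtoC (s ^ n) * W k n x y z))%C))
      by (intros; simpl pow; rewrite !RtoC_mult; ring).
    rewrite !csum_scal.
    rewrite (csum_extend (fun n => (RtoC (s ^ n) * W k n x y z)%C) (2 * k + 1) (S (2 * k + 1)))
      by (try lia; intros n Hn; rewrite W_large by lia; ring).
    generalize (csum (fun n => (RtoC (s ^ n) * W k n x y z)%C) (2 * k + 1)); intros [p q].
    unfold Zab, Cmult, Cplus, RtoC; apply injective_projections; simpl; ring.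
Qed.

Lemma Zab_10_W k x y z : (Zab 1 0 x y z ^ k)%C = W k 0 x y z.
Proof.
  rewrite <- W_generating. replace (2 * k + 1)%nat with (S (2 * k)) by lia. rewrite csum_S_l.
  replace (csum _ (2 * k)) with (RtoC 0).
  - simpl. ring.
  - generalize (2 * k)%nat; intros N; induction N as [|N IH]; [reflexivity|].
    cbn [csum]. rewrite <- IH. cbn [pow]. rewrite Rmult_0_l. ring.
Qed.

Definition modsq (c : C) : R := Re c ^ 2 + Im c ^ 2.

Lemma modsq_ge_0 c : 0 <= modsq c.
Proof. unfold modsq. generalize (pow2_ge_0 (Re c)) (pow2_ge_0 (Im c)). lra. Qed.

Lemma cont2_C1 h : ex_C1 h -> cont2 (on_sphere_R h).
Proof.
  intros (hx & hy & hz & [_ H]) p. unfold on_sphere_R, sx, sy, sz.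
  destruct (H _ (fun p : R * R => sin (fst p) * cos (snd p)) (fun p => sin (fst p) * sin (snd p))
    (fun p => cos (fst p)) p) as [H0 _]; auto 10 with conts.
Qed.

(** * Pairing the functions W with a rotated, regularised beam *)

Section Pairing.
Variables (k : nat) (g q eps : R).
Hypotheses (Heps : 0 < eps) (Hc : 0 < cos g) (Hs : 0 < sin g).

(** Here [q] is the exponent of the squared modulus. It is used as k(p-2)/2 for the duality, as 0
    for the norms of the W, and as kp/2 in degree 0 for the mass of the beam. *)
Definition beamw (x y z : R) : R := Rpower (modsq (Zab (cos g) (sin g) x y z) + eps) q.
Definition beamw0 (phi : R) : R := Rpower (sin phi ^ 2 + eps) q.
Definition beam_int : R :=
  sphere_integral (fun phi _ => sin phi ^ (2 * k) * beamw0 phi).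

Lemma beamw_C1 a b : ex_C1 (fun x y z => Rpower (modsq (Zab a b x y z) + eps) q).
Proof.
  apply (ex_C1_Rpower (fun x y z => modsq (Zab a b x y z) + eps)).
  - intros. generalize (modsq_ge_0 (Zab a b x y z)); lra.
  - destruct (ex_C1C_Zab a b) as [H1 H2]. unfold modsq.
    apply ex_C1_plus; [|apply ex_C1_const].
    apply (ex_C1_ext (fun x y z => Re (Zab a b x y z) * Re (Zab a b x y z) + Im (Zab a b x y z) * Im (Zab a b x y z))).
    + intros; simpl; ring.
    + apply ex_C1_plus; apply ex_C1_mult; auto.
Qed.

Lemma modsq_Zab10 phi theta : modsq (Zab 1 0 (sx phi theta) (sy phi theta) (sz phi theta)) = sin phi ^ 2.
Proof.
  unfold modsq, Zab, sx, sy, Re, Im; simpl.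
  transitivity (sin phi ^ 2 * ((sin theta)² + (cos theta)²)); [unfold Rsqr; ring|].
  rewrite sin2_cos2. ring.
Qed.

Lemma continuous_beamw0 phi : continuous beamw0 phi.
Proof.
  apply (continuous_Rpower_l (fun phi => sin phi ^ 2 + eps)).
  - generalize (pow2_ge_0 (sin phi)); lra.
  - auto with conts.
Qed.

(** For the unrotated beam the weight depends on phi alone, so in the expansion in powers of s only
    n = 0 survives; that term has coefficient s^0 = 1, and the result is independent of s. *)
Lemma pairing_std s :
  sphere_integral (on_sphere_R (fun x y z =>
    Re (Zab 1 s x y z ^ k * Cconj (Zab 1 0 x y z ^ k))%C
    * Rpower (modsq (Zab 1 0 x y z) + eps) q)) = beam_int.
Proof.
  unfold on_sphere_R.
  rewrite (sphere_integral_ext _ (fun phi theta =>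
     rsum (fun n => s ^ n * (Re (Wp k n 0 phi theta) * beamw0 phi)) (2 * k + 1))).
  2:{ intros phi theta _. rewrite modsq_Zab10. fold (beamw0 phi).
      rewrite <- W_generating, Zab_10_W.
      rewrite (Cmult_comm (csum _ _)), <- csum_scal, Re_csum, Rmult_comm, <- rsum_scal.
      apply rsum_ext; intros n _. unfold Wp.
      rewrite <- (Rmult_comm (beamw0 phi)).
      replace (s ^ n * (beamw0 phi * Re (W k n (sx phi theta) (sy phi theta) (sz phi theta) *
      Cconj (W k 0 (sx phi theta) (sy phi theta) (sz phi theta)))%C)) with
       (beamw0 phi * (s ^ n * Re (W k n (sx phi theta) (sy phi theta) (sz phi theta) *
      Cconj (W k 0 (sx phi theta) (sy phi theta) (sz phi theta)))%C)) by ring.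
      f_equal. rewrite <- re_scal_l. f_equal. ring. }
  assert (HC : forall n, cont2 (fun phi theta => Re (Wp k n 0 phi theta) * beamw0 phi)).
  { intros n. apply cont2_mult; [apply cont2_Wp_Re | apply cont2_fst, continuous_beamw0]. }
  rewrite (sphere_integral_rsum (fun n phi theta => s ^ n * (Re (Wp k n 0 phi theta) * beamw0 phi)))
    by (intros n; apply (cont2_scal (s ^ n)), HC).
  rewrite (rsum_single _ _ 0%nat).
  - unfold beam_int. apply sphere_integral_ext. intros phi theta _.
    rewrite Wp_Re, wf_0. replace ((INR 0 - INR 0) * theta) with 0 by ring. rewrite cos_0.
    replace (2 * k)%nat with (k + k)%nat by lia. rewrite pow_add. ring.
  - lia.
  - intros n _ Hn. rewrite sphere_integral_scal by apply HC.
    rewrite sphere_integral_Wp_Re_off by auto. ring.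
Qed.

Definition beam_pair (n : nat) : R :=
  sphere_integral (on_sphere_R (fun x y z =>
    Re (W k n x y z * Cconj (Zab (cos g) (sin g) x y z ^ k))%C * beamw x y z)).

(* A rotation takes Zab (cos g) (sin g) to x + iy, whose k-th power pairs only with W k 0. *)
Lemma pairing_gen s : 0 < s ->
  sphere_integral (on_sphere_R (fun x y z =>
    Re (Zab 1 s x y z ^ k * Cconj (Zab (cos g) (sin g) x y z ^ k))%C * beamw x y z))
  = (cos g + s * sin g) ^ (2 * k) * beam_int.
Proof.
  intros Hs0.
  (* (a', b') is the spinor (1, s) turned back by g, so the rotation by 2g sends it to (1, s) and
     sends (1, 0) to (cos g, sin g). Positivity of a' allows rescaling to (1, b'/a'), which costs
     the factor a'^(2k). *)
  set (a' := cos g + s * sin g). set (b' := - sin g + s * cos g).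
  assert (Ha : 0 < a') by (unfold a'; nra).
  set (h := fun x y z => Re (Zab a' b' x y z ^ k * Cconj (Zab 1 0 x y z ^ k))%C
    * Rpower (modsq (Zab 1 0 x y z) + eps) q).
  assert (Hh : ex_C1 h).
  { apply ex_C1_mult; [|apply beamw_C1].
    apply ex_C1C_mult; [|apply ex_C1C_conj]; apply ex_C1C_pow, ex_C1C_Zab. }
  transitivity (sphere_integral (on_sphere_R (rot_y (2 * g) h))).
  { f_equal. unfold on_sphere_R, rot_y, h. do 2 (apply functional_extensionality; intro).
    rewrite !Zab_rot. unfold beamw.
    replace (a' * cos g - b' * sin g) with 1.
    2:{ unfold a', b'. transitivity ((sin g)² + (cos g)²); [now rewrite sin2_cos2 | unfold Rsqr; ring]. }
    replace (a' * sin g + b' * cos g) with s.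
    2:{ unfold a', b'. transitivity (s * ((sin g)² + (cos g)²)); [rewrite sin2_cos2; ring | unfold Rsqr; ring]. }
    replace (1 * cos g - 0 * sin g) with (cos g) by ring.
    replace (1 * sin g + 0 * cos g) with (sin g) by ring. reflexivity. }
  destruct Hh as (hx & hy & hz & Hh).
  rewrite (sphere_integral_rot_y h hx hy hz _ Hh).
  rewrite <- (pairing_std (b' / a')).
  rewrite <- sphere_integral_scal.
  - f_equal. unfold on_sphere_R, h. do 2 (apply functional_extensionality; intro).
    rewrite (Zab_scal a' b') by lra. rewrite Cpow_mult_l, <- RtoC_pow, <- Cmult_assoc, re_scal_l.
    rewrite pow_mult. ring.
  - apply (cont2_C1 (fun x y z => Re (Zab 1 (b' / a') x y z ^ k * Cconj (Zab 1 0 x y z ^ k))%C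
    * Rpower (modsq (Zab 1 0 x y z) + eps) q)).
    apply ex_C1_mult; [|apply beamw_C1].
    apply ex_C1C_mult; [|apply ex_C1C_conj]; apply ex_C1C_pow, ex_C1C_Zab.
Qed.

Lemma cont2_W_Re_Im k' n : cont2 (on_sphere_R (fun x y z => Re (W k' n x y z)))
  /\ cont2 (on_sphere_R (fun x y z => Im (W k' n x y z))).
Proof.
  split; unfold on_sphere_R; intros p;
  [ apply (continuous_ext (fun p : R * R => wf k' n (fst p) * cos ((INR k' - INR n) * snd p)))
  | apply (continuous_ext (fun p : R * R => wf k' n (fst p) * sin ((INR k' - INR n) * snd p)))];
  try (intros u; rewrite W_sphere; unfold cexpi, Cmult, RtoC, Re, Im; simpl; ring);
  pose proof (continuous_wf k'); auto 10 with conts.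
Qed.

Lemma cont2_beam_pair n : cont2 (on_sphere_R (fun x y z =>
    Re (W k n x y z * Cconj (Zab (cos g) (sin g) x y z ^ k))%C * beamw x y z)).
Proof.
  unfold on_sphere_R.
  apply cont2_mult; [|apply (cont2_C1 (fun x y z => beamw x y z)), beamw_C1].
  destruct (cont2_W_Re_Im k n) as [H1 H2].
  assert (H3 : ex_C1C (fun x y z => Cconj (Zab (cos g) (sin g) x y z ^ k)))
    by apply ex_C1C_conj, ex_C1C_pow, ex_C1C_Zab.
  destruct H3 as [H3 H4]. apply cont2_C1 in H3. apply cont2_C1 in H4.
  unfold on_sphere_R in *.
  intros p. apply continuous_Rminus; apply continuous_Rmult; [apply H1 | apply H3 | apply H2 | apply H4].
Qed.

(** Both sides are coefficients of s^n: the left one in [pairing_gen] expanded by [W_generating],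
    the right one in the binomial expansion of (cos g + s sin g)^(2k). *)
Lemma beam_pair_eq n : (n <= 2 * k)%nat ->
  beam_pair n = Binomial.C (2 * k) n * sin g ^ n * cos g ^ (2 * k - n) * beam_int.
Proof.
  intros Hn.
  cut (beam_pair n - Binomial.C (2 * k) n * sin g ^ n * cos g ^ (2 * k - n) * beam_int = 0); [lra|].
  apply (poly_coef_zero (fun n => beam_pair n - Binomial.C (2 * k) n * sin g ^ n * cos g ^ (2 * k - n) * beam_int) (S (2 * k))); [|lia].
  intros s Hs0.
  assert (E1 : rsum (fun n => beam_pair n * s ^ n) (S (2 * k)) = (cos g + s * sin g) ^ (2 * k) * beam_int).
  { rewrite <- pairing_gen by lra.
    rewrite (rsum_ext _ (fun n => sphere_integral (fun phi theta => s ^ n * on_sphere_R (fun x y z =>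
    Re (W k n x y z * Cconj (Zab (cos g) (sin g) x y z ^ k))%C * beamw x y z) phi theta))).
    2:{ intros m _. rewrite sphere_integral_scal by apply cont2_beam_pair. unfold beam_pair. ring. }
    rewrite <- sphere_integral_rsum by (intros m; apply cont2_scal, cont2_beam_pair).
    f_equal. do 2 (apply functional_extensionality; intro). unfold on_sphere_R.
    rewrite <- W_generating. replace (2 * k + 1)%nat with (S (2 * k)) by lia.
    rewrite (Cmult_comm (csum _ _)), <- csum_scal, Re_csum, Rmult_comm, <- rsum_scal.
    apply rsum_ext; intros m _.
    match goal with |- _ * (Re (?A * ?B)%C * ?D) = ?D * Re (?B * (RtoC ?E * ?A))%C =>
      replace (B * (RtoC E * A))%C with (RtoC E * (A * B))%C by ring end.
    rewrite re_scal_l. ring. }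
  assert (E2 : (cos g + s * sin g) ^ (2 * k) * beam_int
     = rsum (fun n => Binomial.C (2 * k) n * sin g ^ n * cos g ^ (2 * k - n) * beam_int * s ^ n) (S (2 * k))).
  { rewrite Rplus_comm, binomial, rsum_sum_f_R0, Rmult_comm, <- rsum_scal.
    apply rsum_ext; intros m _. rewrite Rpow_mult_distr. ring. }
  transitivity (rsum (fun n => beam_pair n * s ^ n) (S (2 * k))
     + (-1) * rsum (fun n => Binomial.C (2 * k) n * sin g ^ n * cos g ^ (2 * k - n) * beam_int * s ^ n) (S (2 * k))).
  - rewrite <- rsum_scal, <- rsum_plus. apply rsum_ext; intros m _. ring.
  - rewrite E1, E2. ring.
Qed.
End Pairing.

(** * Real powers with 0^p = 0, and elementary inequalities *)

Lemma rpow_pos_eq x p : 0 < x -> rpow x p = Rpower x p.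
Proof. intros H; unfold rpow; destruct (Rlt_dec 0 x); [reflexivity|contradiction]. Qed.

Lemma rpow_npos x p : x <= 0 -> rpow x p = 0.
Proof. intros H; unfold rpow; destruct (Rlt_dec 0 x); [lra|reflexivity]. Qed.

Lemma Rpower_pos x p : 0 < Rpower x p.
Proof. apply exp_pos. Qed.

Lemma rpow_ge_0 x p : 0 <= rpow x p.
Proof.
  unfold rpow; destruct (Rlt_dec 0 x); [left; apply Rpower_pos | lra].
Qed.

Lemma rpow_mult x y p : 0 <= x -> 0 <= y -> rpow (x * y) p = rpow x p * rpow y p.
Proof.
  intros [Hx|<-] [Hy|<-].
  - rewrite !rpow_pos_eq by (try apply Rmult_lt_0_compat; auto). now rewrite Rpower_mult_distr.
  - rewrite Rmult_0_r, !(rpow_npos 0) by lra. ring.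
  - rewrite Rmult_0_l, !(rpow_npos 0) by lra. ring.
  - rewrite Rmult_0_l, !(rpow_npos 0) by lra. ring.
Qed.

Lemma rpow_plus x a b : rpow x (a + b) = rpow x a * rpow x b.
Proof.
  unfold rpow; destruct (Rlt_dec 0 x); [apply Rpower_plus | ring].
Qed.

Lemma rpow_rpow x a b : rpow (rpow x a) b = rpow x (a * b).
Proof.
  destruct (Rlt_dec 0 x) as [Hx|Hx].
  - rewrite (rpow_pos_eq x a), (rpow_pos_eq x (a * b)), rpow_pos_eq by (auto; apply Rpower_pos).
    apply Rpower_mult.
  - now rewrite (rpow_npos x a), (rpow_npos x (a * b)), rpow_npos by lra.
Qed.

Lemma rpow_le x y p : 0 <= p -> x <= y -> rpow x p <= rpow y p.
Proof.
  intros Hp Hxy. destruct (Rlt_dec 0 x) as [Hx|Hx].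
  - rewrite !rpow_pos_eq by lra. apply Rle_Rpower_l; lra.
  - rewrite (rpow_npos x) by lra. apply rpow_ge_0.
Qed.

Lemma rpow_pow x k : 0 <= x -> (0 < k)%nat -> x ^ k = rpow x (INR k).
Proof.
  intros [Hx|<-] Hk.
  - rewrite rpow_pos_eq by auto. now rewrite Rpower_pow.
  - rewrite rpow_npos by lra. now apply pow_i.
Qed.

Lemma rpow_1 x : 0 <= x -> rpow x 1 = x.
Proof. intros [H|<-]; [rewrite rpow_pos_eq by auto; now apply Rpower_1 | apply rpow_npos; lra]. Qed.

Lemma continuous_rpow p x : 0 < p -> continuous (fun t => rpow t p) x.
Proof.
  intros Hp. destruct (Rtotal_order 0 x) as [Hx|[Hx|Hx]].
  - apply (continuous_ext_loc _ (fun t => Rpower t p)).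
    + exists (mkposreal x Hx); intros y Hy. symmetry; apply rpow_pos_eq.
      change (Rabs (y - x) < x) in Hy. apply Rabs_def2 in Hy. lra.
    + apply (continuous_Rpower_l (fun t => t)); auto. apply continuous_id.
  - subst x. intros P [e He].
    exists (mkposreal (Rpower e (/ p)) (Rpower_pos _ _)). intros y Hy.
    apply He. change (Rabs (rpow y p - rpow 0 p) < e).
    rewrite (rpow_npos 0) by lra. rewrite Rminus_0_r, Rabs_pos_eq by apply rpow_ge_0.
    change (Rabs (y - 0) < Rpower e (/ p)) in Hy. rewrite Rminus_0_r in Hy. apply Rabs_def2 in Hy.
    destruct (Rlt_dec 0 y) as [Hy0|Hy0].
    + rewrite rpow_pos_eq by auto.
      replace (pos e) with (Rpower (Rpower e (/ p)) p).
      * apply Rlt_Rpower_l; lra.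
      * rewrite Rpower_mult, Rinv_l by lra. apply Rpower_1, cond_pos.
    + rewrite rpow_npos by lra. apply cond_pos.
  - apply (continuous_ext_loc _ (fun t => 0)).
    + assert (Hx' : 0 < - x) by lra. exists (mkposreal (- x) Hx'); intros y Hy.
      symmetry; apply rpow_npos.
      change (Rabs (y - x) < - x) in Hy. apply Rabs_def2 in Hy. lra.
    + apply continuous_const.
Qed.

Lemma cont2_rpow g p : 0 < p -> cont2 g -> cont2 (fun a b => rpow (g a b) p).
Proof.
  intros Hp Hg u. apply (continuous_comp_R (fun t => rpow t p)); [apply Hg | now apply continuous_rpow].
Qed.

(** Uniform continuity of t^q on [0, 2]; the interval is large enough for y + e with y <= 1 and e <=
    1. *)
Lemma rpow_regularize q d : 0 < q -> 0 < d ->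
  exists e, 0 < e /\ forall y, 0 <= y <= 1 -> Rpower (y + e) q <= rpow y q + d.
Proof.
  intros Hq Hd.
  destruct (Heine_cor2 (f := fun t => rpow t q) (a := 0) (b := 2)
    (fun x _ => proj2 (continuity_pt_filterlim _ _) (continuous_rpow q x Hq)) (mkposreal d Hd)) as [e He].
  set (e' := Rmin (e / 2) 1).
  assert (He' : 0 < e' /\ e' < e /\ e' <= 1).
  { unfold e'. generalize (cond_pos e) (Rmin_l (e / 2) 1) (Rmin_r (e / 2) 1); intros.
    split; [apply Rmin_glb_lt; lra | lra]. }
  exists e'; split; [lra|]. intros y Hy.
  rewrite <- rpow_pos_eq by lra.
  generalize (He (y + e') y). simpl. intros H.
  assert (H' : Rabs (rpow (y + e') q - rpow y q) < d).
  { apply H; try lra. replace (y + e' - y) with e' by ring. rewrite Rabs_pos_eq; lra. }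
  apply Rabs_def2 in H'. lra.
Qed.

(** Mean value theorem between z and 1: c^(p-1) is at most 1 to the left of 1 and at least 1 to its
    right, so both cases give the tangent line bound. *)
Lemma bernoulli_real z p : 0 < z -> 1 <= p -> 1 + p * (z - 1) <= Rpower z p.
Proof.
  intros Hz Hp.
  assert (HE : Rpower 1 p = 1) by (unfold Rpower; rewrite ln_1, Rmult_0_r; apply exp_0).
  assert (HE' : Rpower 1 (p - 1) = 1) by (unfold Rpower; rewrite ln_1, Rmult_0_r; apply exp_0).
  destruct (Rtotal_order z 1) as [H|[->|H]].
  - destruct (MVT_cor2 (fun t => Rpower t p) (fun t => p * Rpower t (p - 1)) z 1 H) as [c [Hc1 Hc2]].
    { intros c Hc. apply derivable_pt_lim_power; lra. }
    rewrite HE in Hc1.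
    assert (Rpower c (p - 1) <= 1)
      by (apply Rle_trans with (Rpower 1 (p - 1)); [apply Rle_Rpower_l; lra | lra]).
    assert (p * Rpower c (p - 1) * (1 - z) <= p * 1 * (1 - z)).
    { apply Rmult_le_compat_r; [lra|]. apply Rmult_le_compat_l; lra. }
    lra.
  - rewrite HE. lra.
  - destruct (MVT_cor2 (fun t => Rpower t p) (fun t => p * Rpower t (p - 1)) 1 z H) as [c [Hc1 Hc2]].
    { intros c Hc. apply derivable_pt_lim_power; lra. }
    rewrite HE in Hc1.
    assert (1 <= Rpower c (p - 1))
      by (apply Rle_trans with (Rpower 1 (p - 1)); [lra | apply Rle_Rpower_l; lra]).
    assert (p * 1 * (z - 1) <= p * Rpower c (p - 1) * (z - 1)).
    { apply Rmult_le_compat_r; [lra|]. apply Rmult_le_compat_l; lra. }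
    lra.
Qed.

(* Young's inequality, as the tangent line bound for the convex function t^p at y. *)
Lemma young_rpow x y p : 0 <= x -> 0 <= y -> 1 < p ->
  p * (x * rpow y (p - 1)) - (p - 1) * rpow y p <= rpow x p.
Proof.
  intros Hx [Hy|<-] Hp.
  2:{ rewrite !(rpow_npos 0) by lra. generalize (rpow_ge_0 x p); lra. }
  destruct Hx as [Hx|<-].
  - rewrite !rpow_pos_eq by auto.
    generalize (bernoulli_real (x / y) p (Rdiv_lt_0_compat _ _ Hx Hy) ltac:(lra)). intros H.
    assert (E : Rpower x p = Rpower (x / y) p * Rpower y p).
    { rewrite Rpower_mult_distr by (auto; now apply Rdiv_lt_0_compat). f_equal. field. lra. }
    assert (E2 : Rpower y p = y * Rpower y (p - 1)).
    { rewrite <- (Rpower_1 y) at 2 by auto. rewrite <- Rpower_plus. f_equal; ring. }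
    rewrite E. apply Rle_trans with ((1 + p * (x / y - 1)) * Rpower y p).
    + rewrite E2. right. field. lra.
    + apply Rmult_le_compat_r; [left; apply Rpower_pos | exact H].
  - rewrite (rpow_npos 0 p) by lra. generalize (rpow_ge_0 y p). nra.
Qed.

(** The form is the product with e + i e' for orthonormal vectors e, e'. Adding the squared
    component along the axis e x e', which is (c^2 - s^2) Z + 2cs X up to sign, gives the squared
    length 1. *)
Lemma Zab_modsq_le_1 c s phi theta : c ^ 2 + s ^ 2 = 1 ->
  modsq (Zab c s (sx phi theta) (sy phi theta) (sz phi theta)) <= 1.
Proof.
  intros H. unfold modsq, Zab, Re, Im; cbn [fst snd]. rewrite H.
  set (X := sx phi theta). set (Y := sy phi theta). set (Z := sz phi theta).
  assert (E : X ^ 2 + Y ^ 2 + Z ^ 2 = 1).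
  { unfold X, Y, Z, sx, sy, sz.
    transitivity ((sin phi)² * ((sin theta)² + (cos theta)²) + (cos phi)²); [unfold Rsqr; ring|].
    rewrite sin2_cos2, Rmult_1_r. apply sin2_cos2. }
  assert (E2 : (c ^ 2 - s ^ 2) ^ 2 + (2 * c * s) ^ 2 = 1).
  { transitivity ((c ^ 2 + s ^ 2) ^ 2); [ring|rewrite H; ring]. }
  generalize (pow2_ge_0 ((c ^ 2 - s ^ 2) * Z + 2 * c * s * X)). intros E3.
  assert (E4 : (c ^ 2 * X - 2 * c * s * Z - s ^ 2 * X) ^ 2 + ((c ^ 2 - s ^ 2) * Z + 2 * c * s * X) ^ 2
     = ((c ^ 2 - s ^ 2) ^ 2 + (2 * c * s) ^ 2) * (X ^ 2 + Z ^ 2)) by ring.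
  rewrite E2 in E4. rewrite Rmult_1_l. lra.
Qed.

Lemma Cmod_sqrt_modsq c : Cmod c = sqrt (modsq c).
Proof. reflexivity. Qed.

Lemma sqrt_rpow x : 0 <= x -> sqrt x = rpow x (/ 2).
Proof.
  intros [H|<-]; [rewrite rpow_pos_eq by auto; symmetry; now apply Rpower_sqrt | rewrite sqrt_0; symmetry; apply rpow_npos; lra].
Qed.

Lemma Cmod_pow_rpow c k : (0 < k)%nat -> Cmod (c ^ k)%C = rpow (modsq c) (INR k / 2).
Proof.
  intros Hk. rewrite Cmod_pow, rpow_pow by (auto; apply Cmod_ge_0).
  rewrite Cmod_sqrt_modsq, sqrt_rpow, rpow_rpow by apply modsq_ge_0. f_equal. field.
Qed.

Lemma continuous_Cmod {U : UniformSpace} (f : U -> C) x :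
  continuous (fun u => Re (f u)) x -> continuous (fun u => Im (f u)) x ->
  continuous (fun u => Cmod (f u)) x.
Proof.
  intros H1 H2.
  apply (continuous_comp_R sqrt (fun u => modsq (f u))).
  - unfold modsq. auto with conts.
  - apply continuous_sqrt.
Qed.

(** * Lower bound for the L^p norm by duality with a beam *)

Section LpBound.
Variables (k : nat) (g p : R) (c : nat -> R).
Hypotheses (Hk : (0 < k)%nat) (Hp : 2 < p) (Hc : 0 < cos g) (Hs : 0 < sin g).

Let u (x y z : R) : C := csum (fun n => RtoC (c n) * W k n x y z)%C (2 * k + 1).
Let Z (x y z : R) : C := Zab (cos g) (sin g) x y z.
Let q := INR k * (p - 2) / 2.
(** The inner product of [u] with the k-th power of [Z], divided by the squared norm of that power.
    For the unit beam the inner product is therefore [pairing] times sqrt([sin_mass k]). *)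
Let pairing := rsum (fun n => c n * (Binomial.C (2 * k) n * sin g ^ n * cos g ^ (2 * k - n))) (2 * k + 1).

Lemma INR_k_pos : 0 < INR k.
Proof. now apply lt_0_INR. Qed.

Lemma q_pos : 0 < q.
Proof. unfold q. generalize INR_k_pos; intros. apply Rdiv_lt_0_compat; [apply Rmult_lt_0_compat|]; lra. Qed.

Lemma cont2_u : cont2 (on_sphere_R (fun x y z => Re (u x y z))) /\ cont2 (on_sphere_R (fun x y z => Im (u x y z))).
Proof.
  split; unfold on_sphere_R, u.
  - intros v. apply (continuous_ext (fun v : R * R => rsum (fun n => c n * on_sphere_R (fun x y z => Re (W k n x y z)) (fst v) (snd v)) (2 * k + 1))).
    + intros w. rewrite Re_csum. apply rsum_ext; intros n _. unfold on_sphere_R. now rewrite re_scal_l.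
    + apply (cont2_rsum (fun n a b => c n * on_sphere_R (fun x y z => Re (W k n x y z)) a b)).
      intros n. apply cont2_scal. exact (proj1 (cont2_W_Re_Im k n)).
  - intros v. apply (continuous_ext (fun v : R * R => rsum (fun n => c n * on_sphere_R (fun x y z => Im (W k n x y z)) (fst v) (snd v)) (2 * k + 1))).
    + intros w. rewrite Im_csum. apply rsum_ext; intros n _. unfold on_sphere_R. now rewrite im_scal_l.
    + apply (cont2_rsum (fun n a b => c n * on_sphere_R (fun x y z => Im (W k n x y z)) a b)).
      intros n. apply cont2_scal. exact (proj2 (cont2_W_Re_Im k n)).
Qed.

Lemma cont2_Cmod_u : cont2 (fun a b => Cmod (on_sphere u a b)).
Proof. intros v. destruct cont2_u as [H1 H2]. apply continuous_Cmod; [apply H1 | apply H2]. Qed.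

Lemma cont2_modsq_Z : cont2 (fun a b => modsq (on_sphere Z a b)).
Proof.
  destruct (ex_C1C_Zab (cos g) (sin g)) as [H1 H2]. apply cont2_C1 in H1. apply cont2_C1 in H2.
  intros v. unfold modsq. apply continuous_Rplus; apply continuous_Rpow; [apply H1 | apply H2].
Qed.

Lemma modsq_Z_le_1 a b : 0 <= modsq (on_sphere Z a b) <= 1.
Proof.
  split; [apply modsq_ge_0|]. apply Zab_modsq_le_1. generalize (sin2_cos2 g). unfold Rsqr; simpl; lra.
Qed.

(** The factor [pairing] is the same for every weight exponent r; only the mass [beam_int] changes.
    This is the identity <u, q |q|^(p-2)> = ||q||_p^p <u, q> in regularised form. *)
Lemma pairing_u e r : 0 < e ->
  sphere_integral (fun a b => Re (on_sphere u a b * Cconj (on_sphere Z a b ^ k))%C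
     * Rpower (modsq (on_sphere Z a b) + e) r) = pairing * beam_int k r e.
Proof.
  intros He. unfold pairing.
  rewrite Rmult_comm, <- rsum_scal.
  rewrite (rsum_ext _ (fun n => c n * beam_pair k g r e n)).
  2:{ intros n Hn. rewrite beam_pair_eq by (auto; lia). ring. }
  unfold beam_pair.
  rewrite (rsum_ext _ (fun n => sphere_integral (fun a b => c n * on_sphere_R (fun x y z =>
    Re (W k n x y z * Cconj (Zab (cos g) (sin g) x y z ^ k))%C * beamw g r e x y z) a b)))
    by (intros n _; rewrite sphere_integral_scal by (now apply cont2_beam_pair); reflexivity).
  rewrite <- (sphere_integral_rsum (fun n a b => c n * on_sphere_R (fun x y z =>
    Re (W k n x y z * Cconj (Zab (cos g) (sin g) x y z ^ k))%C * beamw g r e x y z) a b))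
    by (intros n; apply cont2_scal; now apply cont2_beam_pair).
  f_equal. do 2 (apply functional_extensionality; intro).
  unfold on_sphere, on_sphere_R, u, beamw, Z.
  rewrite (Cmult_comm (csum _ _)), <- csum_scal, Re_csum, Rmult_comm, <- rsum_scal.
  apply rsum_ext; intros m _.
  match goal with |- ?D * Re (?B * (RtoC ?E * ?A))%C = _ =>
      replace (B * (RtoC E * A))%C with (RtoC E * (A * B))%C by ring end.
  rewrite re_scal_l. ring.
Qed.

Let Ip := sphere_integral (fun phi _ => rpow (sin phi ^ 2) (INR k * p / 2)).

Lemma continuous_sin2_rpow r : 0 < r -> forall x, continuous (fun phi => rpow (sin phi ^ 2) r) x.
Proof.
  intros Hr x. apply (continuous_comp_R (fun t => rpow t r)); [auto with conts|].
  now apply continuous_rpow.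
Qed.

Lemma sphere_integral_const_pos d : 0 <= d -> 0 <= sphere_integral (fun _ _ => d).
Proof.
  intros Hd. apply Rle_trans with (sphere_integral (fun _ _ => 0)).
  - right. rewrite (sphere_integral_ext _ (fun _ _ => 0 * 0)) by (intros; ring).
    rewrite sphere_integral_scal by apply cont2_const. ring.
  - apply sphere_integral_le; auto using cont2_const.
Qed.

Lemma Rpower_ge_rpow y e r : 0 < r -> 0 <= y -> 0 < e -> rpow y r <= Rpower (y + e) r.
Proof.
  intros Hr Hy He. rewrite <- rpow_pos_eq by lra. apply rpow_le; lra.
Qed.

Lemma le_of_le_eps a b K : 0 <= K -> (forall d, 0 < d -> a <= b + d * K) -> a <= b.
Proof.
  intros HK H. destruct (Rle_dec a b) as [|Hn]; [assumption|exfalso].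
  assert (Hd : 0 < (a - b) / (2 * (K + 1))) by (apply Rdiv_lt_0_compat; lra).
  specialize (H _ Hd).
  assert ((a - b) / (2 * (K + 1)) * K < a - b); [|lra].
  apply Rmult_lt_reg_r with (2 * (K + 1)); [lra|].
  replace ((a - b) / (2 * (K + 1)) * K * (2 * (K + 1))) with ((a - b) * K) by (field; lra).
  apply Rmult_lt_compat_l; lra.
Qed.

Lemma cont2_u_Z r : 0 < r -> cont2 (fun a b => Cmod (on_sphere u a b) * rpow (modsq (on_sphere Z a b)) r).
Proof. intros Hr. apply cont2_mult; [apply cont2_Cmod_u | apply cont2_rpow; auto using cont2_modsq_Z]. Qed.

(** Limit of [pairing_u] as the regularisation disappears, by two one-sided bounds: (y + e)^q >= y^q
    on the side of the mass, and (y + e)^q <= y^q + d on the side of the integral with |u|. The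
    error is d times a fixed integral. *)
Lemma pairing_le : 0 <= pairing ->
  pairing * Ip <= sphere_integral (fun a b => Cmod (on_sphere u a b) * rpow (modsq (on_sphere Z a b)) (INR k * (p - 1) / 2)).
Proof.
  intros Ha. pose proof INR_k_pos. pose proof q_pos as Hq.
  assert (Hr : 0 < INR k * (p - 1) / 2) by (apply Rdiv_lt_0_compat; [apply Rmult_lt_0_compat|]; lra).
  assert (Hk2 : 0 < INR k / 2) by lra.
  set (K := sphere_integral (fun a b => Cmod (on_sphere u a b) * rpow (modsq (on_sphere Z a b)) (INR k / 2))).
  assert (HK : 0 <= K).
  { apply Rle_trans with (sphere_integral (fun _ _ => 0)); [apply sphere_integral_const_pos; lra|].
    apply sphere_integral_le; [apply cont2_const | now apply cont2_u_Z|].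
    intros; apply Rmult_le_pos; [apply Cmod_ge_0 | apply rpow_ge_0]. }
  apply le_of_le_eps with K; [exact HK|]. intros d Hd.
  destruct (rpow_regularize q d Hq Hd) as [e [He1 He2]].
  apply Rle_trans with (pairing * beam_int k q e).
  - apply Rmult_le_compat_l; [exact Ha|]. unfold Ip, beam_int.
    apply sphere_integral_le.
    + apply cont2_fst. apply continuous_sin2_rpow. apply Rdiv_lt_0_compat; [apply Rmult_lt_0_compat|]; lra.
    + apply cont2_fst. intros x. apply continuous_Rmult; [auto with conts | now apply continuous_beamw0].
    + intros phi _ _. replace (INR k * p / 2) with (INR k + q) by (unfold q; field).
      rewrite rpow_plus, <- rpow_pow by (auto; apply pow2_ge_0).
      rewrite <- pow_mult. apply Rmult_le_compat_l; [rewrite pow_mult; apply pow_le, pow2_ge_0|].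
      apply Rpower_ge_rpow; auto; apply pow2_ge_0.
  - rewrite <- pairing_u by auto.
    apply Rle_trans with (sphere_integral (fun a b => Cmod (on_sphere u a b) * rpow (modsq (on_sphere Z a b)) (INR k * (p - 1) / 2)
       + d * (Cmod (on_sphere u a b) * rpow (modsq (on_sphere Z a b)) (INR k / 2)))).
    + apply sphere_integral_le.
      * destruct cont2_u as [H1 H2].
        assert (H3 : ex_C1C (fun x y z => Cconj (Z x y z ^ k)))
          by apply ex_C1C_conj, ex_C1C_pow, ex_C1C_Zab.
        destruct H3 as [H3 H4]. apply cont2_C1 in H3. apply cont2_C1 in H4.
        apply cont2_mult.
        -- intros v. apply continuous_Rminus; apply continuous_Rmult; [apply H1 | apply H3 | apply H2 | apply H4].
        -- apply (cont2_C1 (fun x y z => Rpower (modsq (Zab (cos g) (sin g) x y z) + e) q)). now apply beamw_C1.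
      * apply cont2_plus; [now apply cont2_u_Z | apply cont2_scal; now apply cont2_u_Z].
      * intros a b _.
        apply Rle_trans with (Cmod (on_sphere u a b) * rpow (modsq (on_sphere Z a b)) (INR k / 2) * Rpower (modsq (on_sphere Z a b) + e) q).
        -- apply Rmult_le_compat_r; [left; apply Rpower_pos|].
           eapply Rle_trans; [apply Rle_abs|]. eapply Rle_trans; [apply re_le_Cmod|].
           rewrite Cmod_mult, Cmod_conj, Cmod_pow_rpow by auto. lra.
        -- replace (INR k * (p - 1) / 2) with (INR k / 2 + q) by (unfold q; field).
           rewrite rpow_plus.
           generalize (He2 _ (modsq_Z_le_1 a b)). intros H'.
           assert (0 <= Cmod (on_sphere u a b) * rpow (modsq (on_sphere Z a b)) (INR k / 2))
             by (apply Rmult_le_pos; [apply Cmod_ge_0 | apply rpow_ge_0]).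
           nra.
    + rewrite (sphere_integral_plus _ (fun a b => d * (Cmod (on_sphere u a b) * rpow (modsq (on_sphere Z a b)) (INR k / 2)))).
      * rewrite sphere_integral_scal by (now apply cont2_u_Z). unfold K. lra.
      * now apply cont2_u_Z.
      * apply cont2_scal; now apply cont2_u_Z.
Qed.

(** [Ip] is the same integral for the unrotated beam, so this is rotation invariance, again up to a
    regularisation that tends to 0. *)
Lemma beam_norm_le :
  sphere_integral (fun a b => rpow (modsq (on_sphere Z a b)) (INR k * p / 2)) <= Ip.
Proof.
  pose proof INR_k_pos.
  assert (Hr : 0 < INR k * p / 2) by (apply Rdiv_lt_0_compat; [apply Rmult_lt_0_compat|]; lra).
  apply le_of_le_eps with (sphere_integral (fun _ _ => 1)); [apply sphere_integral_const_pos; lra|].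
  intros d Hd.
  destruct (rpow_regularize _ d Hr Hd) as [e [He1 He2]].
  apply Rle_trans with (sphere_integral (fun a b => Rpower (modsq (on_sphere Z a b) + e) (INR k * p / 2))).
  - apply sphere_integral_le.
    + apply cont2_rpow; auto using cont2_modsq_Z.
    + apply (cont2_C1 (fun x y z => Rpower (modsq (Zab (cos g) (sin g) x y z) + e) (INR k * p / 2))). now apply beamw_C1.
    + intros a b _. apply Rpower_ge_rpow; auto; apply modsq_ge_0.
  (* In degree 0 the only function is W = 1, and the pairing formula says that the integral of the
     weight alone does not depend on g. *)
  - generalize (beam_pair_eq 0 g (INR k * p / 2) e He1 Hc Hs 0 (le_n 0)).
    unfold beam_pair, beam_int, on_sphere_R. intros E.
    rewrite (sphere_integral_ext _ (fun phi theta => Re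
         (W 0 0 (sx phi theta) (sy phi theta) (sz phi theta) *
          Cconj (Zab (cos g) (sin g) (sx phi theta) (sy phi theta) (sz phi theta) ^ 0))%C *
       beamw g (INR k * p / 2) e (sx phi theta) (sy phi theta) (sz phi theta))).
    2:{ intros a b _. rewrite W_0. unfold beamw, on_sphere, Z.
        replace (Re (RtoC 1 * Cconj (Zab (cos g) (sin g) (sx a b) (sy a b) (sz a b) ^ 0))%C) with 1
          by (unfold Cconj, Cmult, Re; simpl; ring). ring. }
    rewrite E. simpl Nat.mul. rewrite C_n_0. simpl pow. rewrite !Rmult_1_l.
    unfold Ip. rewrite <- sphere_integral_scal by apply cont2_const.
    rewrite <- sphere_integral_plus.
    + apply sphere_integral_le.
      * apply cont2_fst. intros x. apply continuous_Rmult; [apply continuous_const | now apply continuous_beamw0].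
      * apply cont2_plus; [|apply cont2_scal, cont2_const]. apply cont2_fst, continuous_sin2_rpow; auto.
      * intros phi _ _. rewrite Rmult_1_l, Rmult_1_r. apply He2.
        split; [apply pow2_ge_0|]. generalize (SIN_bound phi); intros. nra.
    + apply cont2_fst, continuous_sin2_rpow; auto.
    + apply cont2_scal, cont2_const.
Qed.

(** Young's inequality with y = lam |Z|^k is integrated. The pairing contributes at least p lam^p Ip
    and the beam takes away at most (p - 1) lam^p Ip, which leaves lam^p Ip. *)
Lemma Lp_lower_bound lam : 0 < lam -> lam <= pairing ->
  sphere_integral (fun a b => rpow (Cmod (on_sphere u a b)) p) >= rpow lam p * Ip.
Proof.
  intros Hl Ha. apply Rle_ge. pose proof INR_k_pos.
  assert (HI : 0 <= Ip).
  { apply Rle_trans with (sphere_integral (fun _ _ => 0)); [apply sphere_integral_const_pos; lra|].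
    assert (0 < INR k * p / 2) by (apply Rdiv_lt_0_compat; [apply Rmult_lt_0_compat|]; lra).
    apply sphere_integral_le; [apply cont2_const | apply cont2_fst, continuous_sin2_rpow; auto |].
    intros; apply rpow_ge_0. }
  generalize (pairing_le ltac:(lra)) beam_norm_le.
  set (X := sphere_integral _). set (Y := sphere_integral (fun a b => rpow (modsq (on_sphere Z a b)) (INR k * p / 2))).
  intros HX HY.
  assert (Hr : 0 < INR k * (p - 1) / 2) by (apply Rdiv_lt_0_compat; [apply Rmult_lt_0_compat|]; lra).
  assert (Hr' : 0 < INR k * p / 2) by (apply Rdiv_lt_0_compat; [apply Rmult_lt_0_compat|]; lra).
  apply Rle_trans with (p * rpow lam (p - 1) * X + (- (p - 1) * rpow lam p) * Y).
  - assert (E : rpow lam p = lam * rpow lam (p - 1)).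
    { replace p with (1 + (p - 1)) at 1 by ring. rewrite rpow_plus, rpow_1 by lra. reflexivity. }
    assert (0 <= rpow lam (p - 1)) by apply rpow_ge_0.
    apply Rle_trans with (p * rpow lam (p - 1) * (lam * Ip) + (- (p - 1) * rpow lam p) * Ip).
    + rewrite E. right; ring.
    + apply Rplus_le_compat.
      * apply Rmult_le_compat_l; [apply Rmult_le_pos; lra|].
        eapply Rle_trans; [|exact HX]. apply Rmult_le_compat_r; auto.
      * assert (0 <= (p - 1) * rpow lam p) by (apply Rmult_le_pos; [lra | apply rpow_ge_0]). nra.
  - unfold X, Y.
    rewrite <- !sphere_integral_scal by (try (now apply cont2_u_Z); apply cont2_rpow; auto using cont2_modsq_Z).
    rewrite <- sphere_integral_plus
      by (apply cont2_scal; try (now apply cont2_u_Z); apply cont2_rpow; auto using cont2_modsq_Z).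
    apply sphere_integral_le.
    + apply cont2_plus; apply cont2_scal; [now apply cont2_u_Z | apply cont2_rpow; auto using cont2_modsq_Z].
    + apply cont2_rpow; [lra | apply cont2_Cmod_u].
    + intros a b _.
      generalize (young_rpow (Cmod (on_sphere u a b)) (lam * rpow (modsq (on_sphere Z a b)) (INR k / 2)) p
        (Cmod_ge_0 _) (Rmult_le_pos _ _ (Rlt_le _ _ Hl) (rpow_ge_0 _ _)) ltac:(lra)).
      rewrite !rpow_mult, !rpow_rpow by (try lra; apply rpow_ge_0).
      replace (INR k / 2 * (p - 1)) with (INR k * (p - 1) / 2) by field.
      replace (INR k / 2 * p) with (INR k * p / 2) by field. lra.
Qed.
End LpBound.

(** * Binomial probabilities near the mode *)

Lemma binomial_step N n : (n < N)%nat ->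
  Binomial.C N (S n) * INR (S n) = Binomial.C N n * (INR N - INR n).
Proof.
  intros H. unfold Binomial.C.
  replace (N - n)%nat with (S (N - S n)) by lia.
  assert (E : INR N - INR n = INR (S (N - S n))).
  { rewrite <- minus_INR by lia. f_equal; lia. }
  rewrite E. rewrite !fact_simpl, !mult_INR.
  generalize (INR_fact_neq_0 n) (INR_fact_neq_0 (N - S n)) (INR_fact_neq_0 N); intros.
  assert (INR (S n) <> 0) by (apply not_0_INR; lia).
  assert (INR (S (N - S n)) <> 0) by (apply not_0_INR; lia).
  field; auto.
Qed.

Lemma binomial_pos N n : 0 < Binomial.C N n.
Proof.
  unfold Binomial.C. apply Rdiv_lt_0_compat; [|apply Rmult_lt_0_compat]; apply INR_fact_lt_0.
Qed.

(* Binomial(N, n0/N) probability of n, with mean (and mode) n0. *)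
Definition binprob (N n0 n : nat) : R :=
  Binomial.C N n * (INR n0 / INR N) ^ n * (INR (N - n0) / INR N) ^ (N - n).

Lemma binprob_ge_0 N n0 n : 0 <= binprob N n0 n.
Proof.
  assert (H : 0 <= / INR N).
  { destruct (pos_INR N) as [H|H]; [left; now apply Rinv_0_lt_compat | rewrite <- H, Rinv_0; lra]. }
  unfold binprob.
  apply Rmult_le_pos; [apply Rmult_le_pos; [left; apply binomial_pos|]|]; apply pow_le;
    apply Rmult_le_pos; auto; apply pos_INR.
Qed.

Lemma binprob_sym N n0 n : (n0 <= N)%nat -> (n <= N)%nat -> binprob N n0 n = binprob N (N - n0) (N - n).
Proof.
  intros H1 H2. unfold binprob. rewrite (pascal_step1 N n) by lia.
  replace (N - (N - n0))%nat with n0 by lia. replace (N - (N - n))%nat with n by lia. ring.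
Qed.

Lemma binprob_step N n0 n : (n < N)%nat -> (n0 <= N)%nat ->
  binprob N n0 (S n) * (INR (S n) * INR (N - n0)) = binprob N n0 n * ((INR N - INR n) * INR n0).
Proof.
  intros H H0. unfold binprob.
  assert (0 < INR N) by (apply lt_0_INR; lia).
  replace (N - n)%nat with (S (N - S n)) by lia. simpl pow.
  generalize (binomial_step N n H); intros E.
  transitivity (Binomial.C N (S n) * INR (S n) * ((INR n0 / INR N) ^ n * (INR n0 / INR N) * (INR (N - n0) / INR N) ^ (N - S n) * INR (N - n0))); [ring|].
  rewrite E. field. lra.
Qed.

(** With A = n0 and B = N - n0, the ratio of the terms t+1 and t steps above the mode is (1 -
    t/B)/(1 + (t+1)/A) >= 1 - (2t+1)/mu. The odd numbers 2t+1 add up to squares, and the cross terms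
    that are dropped are nonnegative. *)
Lemma binprob_up N n0 j mu : 0 < mu -> mu <= INR n0 -> mu <= INR (N - n0) -> (n0 + j <= N)%nat ->
  binprob N n0 n0 * (1 - INR j ^ 2 / mu) <= binprob N n0 (n0 + j).
Proof.
  intros Hmu H1 H2. induction j as [|j IH]; intros Hj.
  - rewrite Nat.add_0_r. simpl INR. right. field. lra.
  - specialize (IH ltac:(lia)).
    (* If the claimed factor is not positive there is nothing to prove; otherwise the ratio bound
       below is nonnegative and may be multiplied. *)
    destruct (Rle_dec (1 - INR (S j) ^ 2 / mu) 0) as [Hn|Hn].
    { apply Rle_trans with 0; [|apply binprob_ge_0].
      generalize (binprob_ge_0 N n0 n0). nra. }
    set (M := binprob N n0 n0) in *. assert (HM : 0 <= M) by apply binprob_ge_0.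
    replace (n0 + S j)%nat with (S (n0 + j)) by lia.
    generalize (binprob_step N n0 (n0 + j) ltac:(lia) ltac:(lia)).
    set (P1 := binprob N n0 (S (n0 + j))). set (P0 := binprob N n0 (n0 + j)) in *.
    assert (HP1 : 0 <= P1) by apply binprob_ge_0.
    rewrite S_INR, plus_INR.
    assert (EB : INR N = INR n0 + INR (N - n0)) by (rewrite <- plus_INR; f_equal; lia).
    rewrite EB. rewrite S_INR in Hn |- *.
    set (A := INR n0) in *. set (B := INR (N - n0)) in *. set (t := INR j) in *.
    assert (Ht : 0 <= t) by apply pos_INR.
    replace (A + B - (A + t)) with (B - t) by ring. intros E.
    set (i := / mu) in *.
    assert (Hi : 0 < i) by (apply Rinv_0_lt_compat; auto).
    unfold Rdiv in *. fold i in Hn, IH |- *.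
    assert (HAi : 1 <= A * i) by (replace 1 with (mu * i) by (unfold i; field; lra); apply Rmult_le_compat_r; lra).
    assert (HBi : 1 <= B * i) by (replace 1 with (mu * i) by (unfold i; field; lra); apply Rmult_le_compat_r; lra).
    set (r := 1 - (2 * t + 1) * i).
    assert (Hr0 : 0 <= r) by (unfold r; nra).
    assert (Hs0 : 0 <= 1 - t ^ 2 * i) by nra.
    (* the ratio of consecutive terms is at least r *)
    assert (Hr : r * ((A + t + 1) * B) <= (B - t) * A).
    { unfold r.
      assert (Q1 : A <= A * B * i) by nra.
      assert (Q2 : B <= A * B * i) by nra.
      assert (Q3 : 0 <= (2 * t + 1) * i * (t + 1) * B) by (repeat apply Rmult_le_pos; lra).
      nra. }
    assert (HAB : 0 < (A + t + 1) * B) by (apply Rmult_lt_0_compat; lra).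
    assert (HP0 : 0 <= P0) by apply binprob_ge_0.
    assert (K : P0 * r <= P1).
    { apply Rmult_le_reg_r with ((A + t + 1) * B); [exact HAB|].
      rewrite E, Rmult_assoc. apply Rmult_le_compat_l; auto. }
    apply Rle_trans with (P0 * r); [|exact K].
    apply Rle_trans with (M * (1 - t ^ 2 * i) * r); [|apply Rmult_le_compat_r; auto].
    rewrite Rmult_assoc. apply Rmult_le_compat_l; [exact HM|].
    unfold r.
    assert (0 <= t ^ 2 * i * ((2 * t + 1) * i)) by (repeat apply Rmult_le_pos; try lra; apply pow2_ge_0).
    nra.
Qed.

Lemma binprob_near N n0 n mu d : 0 < mu -> mu <= INR n0 -> mu <= INR (N - n0) -> (n0 <= N)%nat -> (n <= N)%nat ->
  (INR n - INR n0) ^ 2 <= d ->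
  binprob N n0 n0 * (1 - d / mu) <= binprob N n0 n.
Proof.
  intros Hmu H1 H2 Hn0 Hn Hd.
  apply Rle_trans with (binprob N n0 n0 * (1 - (INR n - INR n0) ^ 2 / mu)).
  { apply Rmult_le_compat_l; [apply binprob_ge_0|].
    assert ((INR n - INR n0) ^ 2 / mu <= d / mu); [|lra].
    apply Rmult_le_compat_r; auto. left; now apply Rinv_0_lt_compat. }
  destruct (le_lt_dec n0 n) as [H|H].
  - generalize (binprob_up N n0 (n - n0) mu Hmu H1 H2 ltac:(lia)).
    rewrite minus_INR by auto. now replace (n0 + (n - n0))%nat with n by lia.
  - rewrite (binprob_sym N n0 n), (binprob_sym N n0 n0) by lia.
    generalize (binprob_up N (N - n0) (n0 - n) mu Hmu H2).
    replace (N - (N - n0))%nat with n0 by lia. intros K. specialize (K H1 ltac:(lia)).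
    replace (N - n0 + (n0 - n))%nat with (N - n)%nat in K by lia.
    rewrite minus_INR in K by lia.
    now replace ((INR n - INR n0) ^ 2) with ((INR n0 - INR n) ^ 2) by ring.
Qed.

Lemma bernoulli_nat x n : -1 <= x -> 1 + INR n * x <= (1 + x) ^ n.
Proof.
  intros Hx. induction n as [|n IH]; [simpl; lra|].
  rewrite S_INR. simpl pow.
  apply Rle_trans with ((1 + x) * (1 + INR n * x)).
  - generalize (pos_INR n) (pow2_ge_0 x); intros. nra.
  - apply Rmult_le_compat_l; [lra | exact IH].
Qed.

(** The sequence (1 + 1/n)^n. Its monotonicity governs how the probability of the mode varies with
    the mode. *)
Definition eseq (n : nat) : R := ((INR n + 1) / INR n) ^ n.

Lemma eseq_pos n : (0 < n)%nat -> 0 < eseq n.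
Proof.
  intros H. apply lt_0_INR in H. apply pow_lt, Rdiv_lt_0_compat; lra.
Qed.

Lemma eseq_incr n : (0 < n)%nat -> eseq n <= eseq (S n).
Proof.
  intros H. apply lt_0_INR in H. unfold eseq. rewrite S_INR. set (x := INR n) in *.
  replace ((x + 1 + 1) / (x + 1)) with ((1 + - / ((x + 1) ^ 2)) * ((x + 1) / x)) by (field; lra).
  rewrite Rpow_mult_distr.
  assert (Hx : 0 < (x + 1) / x) by (apply Rdiv_lt_0_compat; lra).
  assert (B : 1 + INR (S n) * - / ((x + 1) ^ 2) <= (1 + - / ((x + 1) ^ 2)) ^ S n).
  { apply bernoulli_nat. assert (/ (x + 1) ^ 2 <= / 1); [|lra]. apply Rinv_le_contravar; nra. }
  rewrite S_INR in B. fold x in B.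
  replace (1 + (x + 1) * - / (x + 1) ^ 2) with (x / (x + 1)) in B by (field; lra).
  apply Rle_trans with (x / (x + 1) * ((x + 1) / x) ^ S n).
  - simpl pow. right. field. lra.
  - apply Rmult_le_compat_r; [left; now apply pow_lt | exact B].
Qed.

Lemma eseq_mono a b : (0 < b)%nat -> (b <= a)%nat -> eseq b <= eseq a.
Proof.
  intros Hb H; induction H as [|a Ha IH]; [lra|].
  eapply Rle_trans; [exact IH | apply eseq_incr; lia].
Qed.

Lemma eseq_pow n : (0 < n)%nat -> (INR n + 1) ^ n = eseq n * INR n ^ n.
Proof.
  intros H. apply lt_0_INR in H. unfold eseq. rewrite <- Rpow_mult_distr. f_equal. field. lra.
Qed.

(** Consecutive mode probabilities have the exact ratio [eseq n] / [eseq (N - S n)], which is at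
    least 1 once N - n - 1 <= n. To the right of the middle the mode probability thus grows. *)
Lemma binprob_mode_incr N n : (S n < N)%nat -> (0 < n)%nat -> (N <= 2 * n + 1)%nat ->
  binprob N n n <= binprob N (S n) (S n).
Proof.
  intros H1 H2 H3.
  set (b := (N - S n)%nat).
  assert (Hb : (0 < b)%nat) by (unfold b; lia).
  assert (Heb : 0 < eseq b) by now apply eseq_pos.
  apply Rmult_le_reg_r with (eseq b); [exact Heb|].
  assert (E : binprob N (S n) (S n) * eseq b = binprob N n n * eseq n).
  { unfold binprob. fold b. replace (N - n)%nat with (S b) by (unfold b; lia).
    assert (HN : 0 < INR N) by (apply lt_0_INR; lia).
    assert (Hstep := binomial_step N n ltac:(lia)).
    assert (EB : INR N - INR n = INR (S b)) by (rewrite <- minus_INR by lia; f_equal; unfold b; lia).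
    rewrite EB in Hstep.
    unfold Rdiv. rewrite !Rpow_mult_distr.
    transitivity (Binomial.C N (S n) * INR (S n) * (INR n + 1) ^ n * INR b ^ b * eseq b * ((/ INR N) ^ S n * (/ INR N) ^ b)).
    - rewrite (S_INR n). simpl pow. ring.
    - rewrite Hstep, eseq_pow by auto.
      rewrite (S_INR b).
      transitivity (Binomial.C N n * INR n ^ n * ((INR b + 1) * (eseq b * INR b ^ b)) * eseq n * ((/ INR N) ^ n * (/ INR N) ^ S b)).
      + simpl pow. ring.
      + rewrite <- eseq_pow by auto. simpl pow. ring. }
  rewrite E. apply Rmult_le_compat_l; [apply binprob_ge_0|].
  apply eseq_mono; auto. unfold b; lia.
Qed.

(** The classical C(2k,k) / 4^k >= 1/(2 sqrt k), squared: it is an equality at k = 1, and each step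
    multiplies the right-hand side by (2k+1)^2 / (4k(k+1)) >= 1. *)
Lemma central_binomial k : (0 < k)%nat -> 1 <= 4 * INR k * binprob (2 * k) k k ^ 2.
Proof.
  assert (E : forall k, (0 < k)%nat -> binprob (2 * k) k k = Binomial.C (2 * k) k * (/ 4) ^ k).
  { intros j Hj. unfold binprob. replace (2 * j - j)%nat with j by lia.
    rewrite mult_INR. apply lt_0_INR in Hj.
    replace (INR j / (INR 2 * INR j)) with (/ 2) by (simpl INR; field; lra).
    replace (/ 4) with (/ 2 * / 2) by lra. rewrite Rpow_mult_distr. ring. }
  intros Hk. rewrite E by auto.
  induction k as [|k IH]; [lia|].
  destruct k as [|k].
  - unfold Binomial.C. simpl. lra.
  - specialize (IH ltac:(lia)). set (j := S k) in *.
    assert (Hj : 0 < INR j) by (apply lt_0_INR; unfold j; lia).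
    clearbody j.
    assert (EC : Binomial.C (2 * S j) (S j) = Binomial.C (2 * j) j * (2 * (2 * INR j + 1)) / (INR j + 1)).
    { unfold Binomial.C. replace (2 * S j - S j)%nat with (S j) by lia. replace (2 * j - j)%nat with j by lia.
      replace (2 * S j)%nat with (S (S (2 * j))) by lia.
      rewrite !fact_simpl, !mult_INR, !S_INR, mult_INR. simpl (INR 2).
      generalize (INR_fact_neq_0 j); intros. field. split; auto; lra. }
    rewrite EC, S_INR. cbn [pow]. cbn [pow] in IH.
    set (c := Binomial.C (2 * j) j) in *. set (q := (/ 4) ^ j) in *. set (x := INR j) in *.
    apply Rle_trans with (4 * x * (c * q * (c * q * 1)) * ((2 * x + 1) ^ 2 / (4 * x * (x + 1)))).
    + apply Rle_trans with (1 * ((2 * x + 1) ^ 2 / (4 * x * (x + 1)))).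
      * rewrite Rmult_1_l. apply Rmult_le_reg_r with (4 * x * (x + 1)); [nra|].
        replace ((2 * x + 1) ^ 2 / (4 * x * (x + 1)) * (4 * x * (x + 1))) with ((2 * x + 1) ^ 2)
          by (field; lra). nra.
      * apply Rmult_le_compat_r; [|exact IH].
        apply Rdiv_le_0_compat; [apply pow2_ge_0 | nra].
    + right. field. lra.
Qed.

Lemma binprob_mode_lower k n : (0 < k)%nat -> (k <= n)%nat -> (n < 2 * k)%nat ->
  1 <= 4 * INR k * binprob (2 * k) n n ^ 2.
Proof.
  intros Hk H. induction H as [|n Hn IH]; intros H2; [now apply central_binomial|].
  specialize (IH ltac:(lia)).
  generalize (binprob_mode_incr (2 * k) n ltac:(lia) ltac:(lia) ltac:(lia)) (binprob_ge_0 (2 * k) n n).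
  intros H3 H4. assert (0 < INR k) by now apply lt_0_INR.
  eapply Rle_trans; [exact IH|]. apply Rmult_le_compat_l; [lra|].
  apply pow_incr; lra.
Qed.

(** * The Legendre function of the Gaussian beam *)

(** [d] counts coefficients, so the degree is below d. *)
Definition is_poly (d : nat) (f : R -> R) : Prop :=
  exists a : nat -> R, forall x, f x = rsum (fun n => a n * x ^ n) d.

Lemma is_derive_rsum (a : nat -> R) d x :
  is_derive (fun x => rsum (fun n => a n * x ^ n) (S d)) x
    (rsum (fun n => a (S n) * INR (S n) * x ^ n) d).
Proof.
  induction d as [|d IH].
  - apply (is_derive_ext (fun _ => a O)); [intros t; simpl; ring|].
    apply (is_derive_const (V := R_NormedModule)).
  - change (is_derive (fun x => rsum (fun n => a n * x ^ n) (S d) + a (S d) * x ^ S d) x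
      (rsum (fun n => a (S n) * INR (S n) * x ^ n) d + a (S d) * INR (S d) * x ^ d)).
    apply (is_derive_plus (V := R_NormedModule) (fun x => rsum (fun n => a n * x ^ n) (S d)) (fun x => a (S d) * x ^ S d)); [exact IH|].
    auto_derive; auto. change (pred (S d)) with d. rewrite ?S_INR. change (match d with O => 1 | S _ => INR d + 1 end) with (INR (S d)). rewrite S_INR. ring.
Qed.

Lemma is_poly_Derive d f : is_poly (S d) f -> is_poly d (Derive f).
Proof.
  intros [a Ha]. exists (fun n => a (S n) * INR (S n)). intros x.
  rewrite (Derive_ext _ _ _ Ha). apply is_derive_unique, is_derive_rsum.
Qed.

Lemma is_poly_Derive_n n d f : is_poly (n + d) f -> is_poly d (Derive_n f n).
Proof.
  revert d; induction n as [|n IH]; intros d H; [exact H|].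
  simpl. apply is_poly_Derive, IH. now replace (n + S d)%nat with (S n + d)%nat by lia.
Qed.

Lemma is_poly_scal c d f : is_poly d f -> is_poly d (fun x => c * f x).
Proof.
  intros [a Ha]. exists (fun n => c * a n). intros x. rewrite Ha, <- rsum_scal.
  apply rsum_ext; intros; ring.
Qed.

Lemma is_poly_mul_x d f : is_poly d f -> is_poly (S d) (fun x => x * f x).
Proof.
  intros [a Ha]. exists (shift 0 a). intros x. rewrite Ha, rsum_S_l, <- rsum_scal. simpl shift.
  rewrite Rmult_0_l, Rplus_0_l. apply rsum_ext; intros; simpl; ring.
Qed.

Lemma is_poly_S d f : is_poly d f -> is_poly (S d) f.
Proof.
  intros [a Ha]. exists (fun n => if Nat.ltb n d then a n else 0). intros x. rewrite Ha. simpl.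
  rewrite Nat.ltb_irrefl, Rmult_0_l, Rplus_0_r.
  apply rsum_ext; intros n Hn. apply Nat.ltb_lt in Hn. now rewrite Hn.
Qed.

Lemma is_poly_plus d f g : is_poly d f -> is_poly d g -> is_poly d (fun x => f x + g x).
Proof.
  intros [a Ha] [b Hb]. exists (fun n => a n + b n). intros x. rewrite Ha, Hb, <- rsum_plus.
  apply rsum_ext; intros; ring.
Qed.

Lemma is_poly_ext d f g : (forall x, f x = g x) -> is_poly d f -> is_poly d g.
Proof. intros E [a Ha]. exists a. intros x. now rewrite <- E. Qed.

Lemma is_poly_rodrigues k : is_poly (2 * k + 1) (fun t => (t ^ 2 - 1) ^ k).
Proof.
  induction k as [|k IH].
  - exists (fun _ => 1). intros x; simpl; ring.
  - replace (2 * S k + 1)%nat with (S (S (2 * k + 1))) by lia.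
    apply (is_poly_ext _ (fun t => t * (t * (t ^ 2 - 1) ^ k) + (-1) * (t ^ 2 - 1) ^ k)).
    + intros x; simpl; ring.
    + apply is_poly_plus; [now do 2 apply is_poly_mul_x|].
      apply is_poly_scal. now do 2 apply is_poly_S.
Qed.

(** (t^2 - 1)^k has degree 2k, and 2k derivatives are taken in all. Hence P_k^k(cos phi) is a
    constant times sin^k phi; the normalisation of the beam absorbs that constant. *)
Lemma legendre_top_derivative k : exists c, forall x, Derive_n (legendreP k) k x = c.
Proof.
  assert (H : is_poly 1 (Derive_n (legendreP k) k)).
  { apply is_poly_Derive_n. apply is_poly_scal. apply is_poly_Derive_n.
    replace (k + (k + 1))%nat with (2 * k + 1)%nat by lia. apply is_poly_rodrigues. }
  destruct H as [a Ha]. exists (a O). intros x. rewrite Ha. simpl. ring.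
Qed.

Lemma Cmod_cexpi t : Cmod (cexpi t) = 1.
Proof.
  unfold Cmod, cexpi; simpl.
  replace (cos t * (cos t * 1) + sin t * (sin t * 1)) with ((sin t)² + (cos t)²) by (unfold Rsqr; ring).
  rewrite sin2_cos2. apply sqrt_1.
Qed.

(** The squared L^2 norm of (x+iy)^k, the beam before normalisation. *)
Definition sin_mass (k : nat) : R := sphere_integral (fun phi _ => sin phi ^ (2 * k)).

Lemma sin_mass_pos k : 0 < sin_mass k.
Proof.
  unfold sin_mass, sphere_integral. pose proof PI_RGT_0.
  apply RInt_gt_0; [lra| |].
  - intros phi Hphi. rewrite RInt_const.
    assert (0 < sin phi) by (apply sin_gt_0; lra).
    apply Rmult_lt_0_compat; [lra|]. apply Rmult_lt_0_compat; [now apply pow_lt | auto].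
  - intros phi _. apply (cont2_outer (fun phi _ => sin phi ^ (2 * k))).
    apply cont2_fst. auto with conts.
Qed.

Lemma beam0_Cmod k : exists c, 0 <= c /\ forall phi theta, 0 < phi < PI ->
  Cmod (beam0 k phi theta) = c * sin phi ^ k.
Proof.
  destruct (legendre_top_derivative k) as [c Hc]. exists (Rabs c). split; [apply Rabs_pos|].
  intros phi theta Hphi. unfold beam0, assoc_legendreP.
  rewrite Cmod_mult, Cmod_cexpi, Rmult_1_r, Cmod_R, Hc.
  assert (Hs : 0 < sin phi) by (apply sin_gt_0; lra).
  replace (1 - cos phi ^ 2) with (Rsqr (sin phi)) by (generalize (sin2_cos2 phi); unfold Rsqr; lra).
  rewrite sqrt_Rsqr by lra.
  rewrite !Rabs_mult, pow_1_abs, (Rabs_pos_eq (sin phi ^ k)) by (apply pow_le; lra). ring.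
Qed.

(* Only an upper bound: if the Legendre constant vanished, [beam_const k] would be [/ 0 = 0]. *)
Lemma Qk_Cmod k : (0 < k)%nat -> exists c, 0 <= c <= / sqrt (sin_mass k) /\
  forall phi theta, 0 < phi < PI -> Cmod (Qk k phi theta) = c * sin phi ^ k.
Proof.
  intros Hk. destruct (beam0_Cmod k) as [c [Hc0 Hc]].
  pose proof (sin_mass_pos k) as HA. assert (HsA : 0 < sqrt (sin_mass k)) by now apply sqrt_lt_R0.
  assert (EN : Lp_norm_coord 2 (beam0 k) = c * sqrt (sin_mass k)).
  { unfold Lp_norm_coord.
    rewrite (sphere_integral_ext _ (fun phi _ => c ^ 2 * sin phi ^ (2 * k))).
    - rewrite sphere_integral_scal by (apply cont2_fst; auto with conts). fold (sin_mass k).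
      rewrite <- sqrt_rpow by (apply Rmult_le_pos; [apply pow2_ge_0 | lra]).
      rewrite sqrt_mult by (try apply pow2_ge_0; lra). now rewrite sqrt_pow2.
    - intros phi theta Hphi. rewrite Hc by auto.
      assert (0 < sin phi) by (apply sin_gt_0; lra).
      change 2 with (INR 2) at 1. rewrite <- rpow_pow; [|apply Rmult_le_pos; [auto|apply pow_le; lra]|lia].
      rewrite Rpow_mult_distr. f_equal. rewrite <- pow_mult. f_equal. lia. }
  exists (/ (c * sqrt (sin_mass k)) * c). split.
  - destruct Hc0 as [Hc0|<-].
    + replace (/ (c * sqrt (sin_mass k)) * c) with (/ sqrt (sin_mass k)) by (field; lra).
      split; [left; now apply Rinv_0_lt_compat | lra].
    + rewrite Rmult_0_r. split; [lra | left; now apply Rinv_0_lt_compat].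
  - intros phi theta Hphi. unfold Qk, beam_const. rewrite EN, Cmod_mult, Cmod_R, Hc by auto.
    rewrite Rabs_pos_eq; [ring|].
    destruct Hc0 as [Hc0|<-].
    + left. apply Rinv_0_lt_compat. now apply Rmult_lt_0_compat.
    + rewrite Rmult_0_l, Rinv_0. lra.
Qed.

(** * Finite Fourier sums *)

(** Multiplication by 2 sin(be/2) makes the sums telescope. The endpoints differ by L be, an integer
    multiple of 2 PI written as a difference of naturals. *)
Lemma rsum_trig_zero (al be : R) (L a b : nat) :
  sin (be / 2) <> 0 -> INR L * be = (INR a - INR b) * (2 * PI) ->
  rsum (fun r => cos (al + be * INR r)) L = 0 /\ rsum (fun r => sin (al + be * INR r)) L = 0.
Proof.
  intros Hs Hb.
  assert (H1 : forall N, 2 * sin (be / 2) * rsum (fun r => cos (al + be * INR r)) N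
     = sin (al - be / 2 + INR N * be) - sin (al - be / 2)).
  { induction N as [|N IH]; [simpl; rewrite Rmult_0_l, Rplus_0_r; ring|].
    simpl rsum. rewrite Rmult_plus_distr_l, IH, S_INR.
    replace (al - be / 2 + (INR N + 1) * be) with ((al + be * INR N) + be / 2) by field.
    replace (al - be / 2 + INR N * be) with ((al + be * INR N) - be / 2) by field.
    rewrite (sin_plus (al + be * INR N)), (sin_minus (al + be * INR N)). ring. }
  assert (H2 : forall N, 2 * sin (be / 2) * rsum (fun r => sin (al + be * INR r)) N
     = cos (al - be / 2) - cos (al - be / 2 + INR N * be)).
  { induction N as [|N IH]; [simpl; rewrite Rmult_0_l, Rplus_0_r; ring|].
    simpl rsum. rewrite Rmult_plus_distr_l, IH, S_INR.
    replace (al - be / 2 + (INR N + 1) * be) with ((al + be * INR N) + be / 2) by field.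
    replace (al - be / 2 + INR N * be) with ((al + be * INR N) - be / 2) by field.
    rewrite (cos_plus (al + be * INR N)), (cos_minus (al + be * INR N)). ring. }
  split; apply Rmult_eq_reg_l with (2 * sin (be / 2)); try lra.
  - rewrite H1, Hb, sin_plus, sin_INR_diff, cos_INR_diff. ring.
  - rewrite H2, Hb, cos_plus, sin_INR_diff, cos_INR_diff. ring.
Qed.

Lemma rsum_block (f : nat -> R) b L N : (b + L <= N)%nat ->
  rsum (fun n => if ((b <=? n)%nat && (n <? b + L)%nat)%bool then f n else 0) N = rsum (fun r => f (b + r)%nat) L.
Proof.
  intros H. replace N with (b + L + (N - (b + L)))%nat by lia.
  generalize (N - (b + L))%nat; intros M.
  assert (E : forall n m f, rsum f (n + m) = rsum f n + rsum (fun r => f (n + r)%nat) m).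
  { intros n m h; induction m as [|m IH]; [rewrite Nat.add_0_r; simpl; ring|].
    rewrite Nat.add_succ_r. simpl. rewrite IH. ring. }
  rewrite !E.
  rewrite (rsum_0 _ b).
  2:{ intros n Hn. destruct (Nat.leb_spec b n); [lia|reflexivity]. }
  rewrite (rsum_0 _ M).
  2:{ intros n Hn. destruct (Nat.ltb_spec (b + L + n) (b + L)); [lia|]. now rewrite Bool.andb_false_r. }
  rewrite Rplus_0_l, Rplus_0_r. apply rsum_ext. intros n Hn.
  destruct (Nat.leb_spec b (b + n)); [|lia]. destruct (Nat.ltb_spec (b + n) (b + L)); [reflexivity|lia].
Qed.

(** * Linear combinations of the W *)

Definition comb (k : nat) (c : nat -> C) (x y z : R) : C :=
  csum (fun n => c n * W k n x y z)%C (2 * k + 1).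

Lemma spherical_harmonic_comb k c : spherical_harmonic k (comb k c).
Proof.
  set (P := fix P N := match N with O => nil | S n => P n ++ pmul (c n) 0 0 0 (wpoly k n) end).
  assert (E : forall N, poly_eval (P N) = fun x y z => csum (fun n => c n * W k n x y z)%C N).
  { intros N. do 3 (apply functional_extensionality; intro). induction N as [|N IH]; [reflexivity|].
    simpl P. rewrite poly_eval_app, IH, poly_eval_pmul. simpl csum. unfold W. f_equal.
    simpl pow. rewrite !Rmult_1_l. ring. }
  exists (P (2 * k + 1)%nat). split; [|split].
  - generalize (2 * k + 1)%nat; intros N. induction N as [|N IH]; [apply homogeneous_nil|].
    simpl. apply homogeneous_app; [exact IH|]. apply (homogeneous_pmul k _ 0 0 0), homogeneous_wpoly.
  - apply harmonicC_harmonic. rewrite E. generalize (2 * k + 1)%nat; intros N.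
    induction N as [|N IH]; [apply harmonicC_zero|]. simpl.
    apply (harmonicC_plus _ (fun x y z => c N * W k N x y z)%C); [exact IH|].
    apply harmonicC_scal, harmonicC_W.
  - intros x y z _. now rewrite E.
Qed.

(** At g = PI/4 with weight exponent 0 the beam is c^(2k) times the sum of all W_m. Pairing it with
    W_n leaves c^(2k) ||W_n||^2 by orthogonality, and [beam_pair_eq] evaluates the same pairing. *)
Lemma Wp_mass k n : (n <= 2 * k)%nat ->
  sphere_integral (fun a b => Re (Wp k n n a b)) = Binomial.C (2 * k) n * sin_mass k.
Proof.
  intros Hn.
  assert (Hc : 0 < cos (PI / 4)) by (rewrite cos_PI4; apply Rdiv_lt_0_compat; [lra | apply sqrt_lt_R0; lra]).
  assert (Hs : sin (PI / 4) = cos (PI / 4)) by apply sin_cos_PI4.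
  generalize (beam_pair_eq k (PI / 4) 0 1 Rlt_0_1 Hc ltac:(lra) n Hn).
  rewrite Hs. set (c := cos (PI / 4)) in *. rewrite Rmult_assoc, Rmult_assoc.
  rewrite <- (Rmult_assoc (c ^ n)), <- pow_add. replace (n + (2 * k - n))%nat with (2 * k)%nat by lia.
  assert (E1 : beam_int k 0 1 = sin_mass k).
  { apply sphere_integral_ext; intros phi _ _. unfold beamw0. rewrite Rpower_O; [ring|].
    generalize (pow2_ge_0 (sin phi)); lra. }
  rewrite E1.
  assert (E2 : beam_pair k (PI / 4) 0 1 n = c ^ (2 * k) * sphere_integral (fun a b => Re (Wp k n n a b))).
  { unfold beam_pair.
    transitivity (sphere_integral (fun a b => c ^ (2 * k) * rsum (fun m => Re (Wp k n m a b)) (2 * k + 1))).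
    - apply sphere_integral_ext. intros a b _. unfold on_sphere_R, beamw. rewrite Hs. fold c.
      rewrite Rpower_O by (generalize (modsq_ge_0 (Zab c c (sx a b) (sy a b) (sz a b))); lra).
      rewrite Zab_scal by lra. replace (c / c) with 1 by (field; lra).
      rewrite Cpow_mult_l, <- RtoC_pow, <- pow_mult, <- W_generating.
      rewrite <- csum_scal, Rmult_1_r, <- rsum_scal.
      assert (EC : forall f N, Cconj (csum f N) = csum (fun m => Cconj (f m)) N).
      { intros f N; induction N as [|N IH]; simpl; [unfold Cconj, RtoC; simpl; f_equal; ring|].
        now rewrite Cplus_conj, IH. }
      rewrite EC, <- csum_scal, !Re_csum. apply rsum_ext. intros m _.
      rewrite pow1, !Cmult_conj. unfold Wp.
      assert (ER : forall r, Cconj (RtoC r) = RtoC r) by (intros r; unfold Cconj, RtoC; simpl; f_equal; ring).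
      rewrite !ER. rewrite <- re_scal_l. f_equal. ring.
    - rewrite sphere_integral_scal by (apply (cont2_rsum (fun m a b => Re (Wp k n m a b))); intros; apply cont2_Wp_Re).
      f_equal. rewrite (sphere_integral_rsum (fun m a b => Re (Wp k n m a b))) by (intros; apply cont2_Wp_Re).
      apply (rsum_single (fun m => sphere_integral (fun a b => Re (Wp k n m a b)))); [lia|].
      intros m _ Hm. rewrite <- (sphere_integral_Wp_Re_off k n m (fun _ => 1)) by auto.
      apply sphere_integral_ext. intros; ring. }
  rewrite E2. intros E. apply Rmult_eq_reg_l with (c ^ (2 * k)); [rewrite E; ring|].
  apply Rgt_not_eq, pow_lt, Hc.
Qed.

Lemma csum_mult_conj f g N M :
  (csum f N * Cconj (csum g M))%C = csum (fun n => csum (fun m => f n * Cconj (g m))%C M) N.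
Proof.
  rewrite Cmult_comm, <- csum_scal. apply csum_ext; intros n _.
  rewrite csum_scal, Cmult_comm. f_equal.
  induction M as [|M IH]; simpl; [unfold Cconj, RtoC; simpl; f_equal; ring|].
  now rewrite Cplus_conj, IH.
Qed.

Lemma inner_comb k c d :
  inner_re (comb k c) (comb k d)
    = rsum (fun n => Re (c n * Cconj (d n))%C * (Binomial.C (2 * k) n * sin_mass k)) (2 * k + 1) /\
  inner_im (comb k c) (comb k d)
    = rsum (fun n => Im (c n * Cconj (d n))%C * (Binomial.C (2 * k) n * sin_mass k)) (2 * k + 1).
Proof.
  set (N := (2 * k + 1)%nat).
  assert (E : forall a b, (on_sphere (comb k c) a b * Cconj (on_sphere (comb k d) a b))%C
    = csum (fun n => csum (fun m => (c n * Cconj (d m)) * Wp k n m a b)%C N) N).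
  { intros a b. unfold on_sphere, comb. rewrite csum_mult_conj. fold N.
    apply csum_ext; intros n _. apply csum_ext; intros m _. rewrite Cmult_conj. unfold Wp. ring. }
  assert (R0 : forall n m, n <> m -> sphere_integral (fun a b => Re (Wp k n m a b)) = 0).
  { intros n m H. rewrite <- (sphere_integral_Wp_Re_off k n m (fun _ => 1)) by auto.
    apply sphere_integral_ext; intros; ring. }
  (* Treats both parts at once: (al, be) is (Re, - Im) for the real part of a product and (Im, Re)
     for the imaginary part. *)
  assert (G : forall (al be : C -> R),
    forall F : R -> R -> R,
    (forall a b, F a b = rsum (fun n => rsum (fun m => al (c n * Cconj (d m))%C * Re (Wp k n m a b)
       + be (c n * Cconj (d m))%C * Im (Wp k n m a b)) N) N) ->
    sphere_integral F = rsum (fun n => al (c n * Cconj (d n))%C * (Binomial.C (2 * k) n * sin_mass k)) N).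
  { intros al be F HF.
    assert (C0 : forall n m, cont2 (fun a b => al (c n * Cconj (d m))%C * Re (Wp k n m a b)
       + be (c n * Cconj (d m))%C * Im (Wp k n m a b))).
    { intros n m. apply cont2_plus; apply cont2_scal; [apply cont2_Wp_Re | apply cont2_Wp_Im]. }
    rewrite (sphere_integral_ext _ _ (fun a b _ => HF a b)).
    rewrite (sphere_integral_rsum (fun n a b => rsum (fun m => al (c n * Cconj (d m))%C * Re (Wp k n m a b)
       + be (c n * Cconj (d m))%C * Im (Wp k n m a b)) N)).
    2:{ intros n. apply (cont2_rsum (fun m a b => al (c n * Cconj (d m))%C * Re (Wp k n m a b)
       + be (c n * Cconj (d m))%C * Im (Wp k n m a b))). auto. }
    apply rsum_ext; intros n Hn.
    rewrite (sphere_integral_rsum (fun m a b => al (c n * Cconj (d m))%C * Re (Wp k n m a b)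
       + be (c n * Cconj (d m))%C * Im (Wp k n m a b))) by auto.
    rewrite (rsum_ext _ (fun m => al (c n * Cconj (d m))%C * sphere_integral (fun a b => Re (Wp k n m a b)))).
    - rewrite (rsum_single _ _ n Hn).
      + rewrite Wp_mass by (unfold N in Hn; lia). reflexivity.
      + intros m _ Hm. rewrite R0 by auto. ring.
    - intros m _.
      rewrite (sphere_integral_plus _ _ (cont2_scal _ _ (cont2_Wp_Re k n m)) (cont2_scal _ _ (cont2_Wp_Im k n m))).
      rewrite (sphere_integral_scal _ _ (cont2_Wp_Re k n m)), (sphere_integral_scal _ _ (cont2_Wp_Im k n m)).
      rewrite sphere_integral_Wp_Im. ring. }
  split; unfold inner_re, inner_im.
  - apply (G Re (fun z => - Im z)). intros a b. rewrite E, Re_csum. apply rsum_ext; intros n _.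
    rewrite Re_csum. apply rsum_ext; intros m _. unfold Cmult at 1, Re, Im; simpl. ring.
  - apply (G Im Re). intros a b. rewrite E, Im_csum. apply rsum_ext; intros n _.
    rewrite Im_csum. apply rsum_ext; intros m _. unfold Cmult at 1, Re, Im; simpl. ring.
Qed.

Lemma RInt_periodic_shift (f : R -> R) al : (forall t, continuous f t) -> (forall t, f (t + 2 * PI) = f t) ->
  RInt (fun t => f (t - al)) 0 (2 * PI) = RInt f 0 (2 * PI).
Proof.
  intros Hc Hp.
  assert (Hex : forall a b, ex_RInt f a b) by (intros; now apply ex_RInt_cont).
  assert (S : forall v a b, RInt (fun t => f (t + v)) a b = RInt f (a + v) (b + v)).
  { intros v a b. generalize (RInt_comp_lin (V := R_CompleteNormedModule) f 1 v a b (Hex _ _)).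
    rewrite !Rmult_1_l. intros <-. apply RInt_ext; intros t _. rewrite Rmult_1_l.
    unfold scal; simpl; unfold mult; simpl. now rewrite !Rmult_1_l. }
  transitivity (RInt f (0 + - al) (2 * PI + - al)); [apply S|].
  rewrite <- (RInt_Chasles (V := R_CompleteNormedModule) f (0 + - al) 0 (2 * PI + - al)) by auto.
  rewrite <- (RInt_Chasles (V := R_CompleteNormedModule) f 0 (2 * PI) (2 * PI + - al)) by auto.
  replace (RInt f (2 * PI) (2 * PI + - al)) with (RInt f 0 (- al)).
  - rewrite <- (opp_RInt_swap (V := R_CompleteNormedModule) f 0 (0 + - al)) by auto.
    rewrite Rplus_0_l. unfold plus, opp; simpl. eqR. ring.
  - rewrite (RInt_ext f (fun t => f (t + 2 * PI))) by (intros; now rewrite Hp).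
    rewrite S. f_equal; ring.
Qed.

Lemma sphere_integral_shift (G : R -> R -> R) al : cont2 G -> (forall a b, G a (b + 2 * PI) = G a b) ->
  sphere_integral (fun a b => G a (b - al)) = sphere_integral G.
Proof.
  intros Hc Hp. unfold sphere_integral. apply RInt_ext; intros phi _.
  apply (RInt_periodic_shift (fun t => G phi t * sin phi)).
  - now apply cont2_inner.
  - intros t. now rewrite Hp.
Qed.

(** e^(i al n) e^(i(k-n) theta) = e^(i k al) e^(i(k-n)(theta - al)): the phases are a rotation about
    the z-axis and a global factor of modulus 1. *)
Lemma comb_Cmod_shift k (c : nat -> R) al phi theta :
  Cmod (on_sphere (comb k (fun n => RtoC (c n) * cexpi (al * INR n))%C) phi theta)
  = Cmod (on_sphere (comb k (fun n => RtoC (c n))) phi (theta - al)).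
Proof.
  rewrite <- (Rmult_1_l (Cmod (on_sphere (comb k (fun n => RtoC (c n))) _ _))), <- (Cmod_cexpi (INR k * al)), <- Cmod_mult.
  f_equal. unfold on_sphere, comb. rewrite <- csum_scal. apply csum_ext; intros n _.
  rewrite !W_sphere.
  transitivity (RtoC (c n) * RtoC (wf k n phi) * (cexpi (al * INR n) * cexpi ((INR k - INR n) * theta)))%C; [ring|].
  transitivity (RtoC (c n) * RtoC (wf k n phi) * (cexpi (INR k * al) * cexpi ((INR k - INR n) * (theta - al))))%C; [|ring].
  rewrite <- !cexpi_plus. do 2 f_equal. ring.
Qed.

Lemma Lp_norm_comb_shift k (c : nat -> R) al p : 0 < p ->
  sphere_integral (fun a b => rpow (Cmod (on_sphere (comb k (fun n => RtoC (c n) * cexpi (al * INR n))%C) a b)) p)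
  = sphere_integral (fun a b => rpow (Cmod (on_sphere (comb k (fun n => RtoC (c n))) a b)) p).
Proof.
  intros Hp.
  rewrite <- (sphere_integral_shift (fun a b => rpow (Cmod (on_sphere (comb k (fun n => RtoC (c n))) a b)) p) al).
  - apply sphere_integral_ext; intros a b _. now rewrite comb_Cmod_shift.
  - apply cont2_rpow; auto. apply (cont2_Cmod_u k c).
  - intros a b. unfold on_sphere, sx, sy, sz.
    replace (b + 2 * PI) with (b + 2 * INR 1 * PI) by (simpl; ring). now rewrite cos_period, sin_period.
Qed.

(** |Qk| is at most sin^k phi / sqrt([sin_mass k]), so half its L^p norm is bounded by the beam
    integral with the constant 1/(2 sqrt([sin_mass k])). For the unit beam this constant stands for
    an inner product of 1/2. *)
Lemma half_Qk_Lp_le k (v : R -> R -> R -> C) p : (0 < k)%nat -> 2 < p ->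
  sphere_integral (fun a b => rpow (Cmod (on_sphere v a b)) p)
    >= rpow (/ (2 * sqrt (sin_mass k))) p * sphere_integral (fun phi _ => rpow (sin phi ^ 2) (INR k * p / 2)) ->
  Lp_norm p v >= / 2 * Lp_norm_coord p (Qk k).
Proof.
  intros Hk Hp H. apply Rle_ge. apply Rge_le in H.
  destruct (Qk_Cmod k Hk) as [c [[Hc0 Hc1] Hc]].
  assert (HA : 0 < sqrt (sin_mass k)) by (apply sqrt_lt_R0, sin_mass_pos).
  assert (Hkp : 0 < INR k) by now apply lt_0_INR.
  assert (Hr : 0 < INR k * p / 2) by (apply Rdiv_lt_0_compat; [apply Rmult_lt_0_compat|]; lra).
  unfold Lp_norm, Lp_norm_coord.
  set (I := sphere_integral (fun phi _ => rpow (sin phi ^ 2) (INR k * p / 2))) in *.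
  assert (HI : 0 <= I).
  { apply Rle_trans with (sphere_integral (fun _ _ => 0)); [apply sphere_integral_const_pos; lra|].
    apply sphere_integral_le; [apply cont2_const | apply cont2_fst, continuous_sin2_rpow; auto |].
    intros; apply rpow_ge_0. }
  rewrite (sphere_integral_ext (fun phi theta => rpow (Cmod (Qk k phi theta)) p) (fun phi _ => rpow c p * rpow (sin phi ^ 2) (INR k * p / 2))).
  2:{ intros phi theta Hphi. assert (0 < sin phi) by (apply sin_gt_0; lra).
      rewrite Hc, rpow_mult by (auto; apply pow_le; lra). f_equal.
      rewrite !rpow_pow by (auto; lra || lia). rewrite !rpow_rpow. f_equal. simpl. field. }
  rewrite sphere_integral_scal by (apply cont2_fst, continuous_sin2_rpow; auto). fold I.
  replace (/ 2) with (rpow (rpow (/ 2) p) (/ p)).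
  2:{ rewrite rpow_rpow, Rinv_r by lra. apply rpow_1; lra. }
  rewrite <- rpow_mult by (try apply Rmult_le_pos; auto; apply rpow_ge_0).
  apply rpow_le; [left; apply Rinv_0_lt_compat; lra|].
  eapply Rle_trans; [|exact H]. rewrite <- Rmult_assoc. apply Rmult_le_compat_r; [exact HI|].
  rewrite <- rpow_mult by lra. apply rpow_le; [lra|].
  rewrite Rinv_mult. apply Rmult_le_compat_l; lra.
Qed.

(** * The orthonormal family *)

(** Dividing by the norm sqrt(C(2k,n) [sin_mass k]) of [W k n] makes this the constant 1/sqrt L on
    the block in the normalised basis. *)
Definition block_coef (k L b n : nat) : R :=
  if ((b <=? n)%nat && (n <? b + L)%nat)%bool
  then / sqrt (INR L * (Binomial.C (2 * k) n * sin_mass k)) else 0.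

(* The quotient i / L selects a block of L consecutive W's, the remainder i mod L a discrete
   frequency inside it. *)
Definition packet (k L i : nat) : R -> R -> R -> C :=
  comb k (fun n => RtoC (block_coef k L (k + L * (i / L)) n)
                   * cexpi (2 * PI * INR (i mod L) / INR L * INR n))%C.

Lemma block_coef_sq k L b n : (0 < L)%nat -> (b <= n < b + L)%nat ->
  block_coef k L b n * block_coef k L b n * (Binomial.C (2 * k) n * sin_mass k) = / INR L.
Proof.
  intros HL Hn. unfold block_coef.
  destruct (Nat.leb_spec b n); [|lia]. destruct (Nat.ltb_spec n (b + L)); [|lia]. simpl andb.
  apply lt_0_INR in HL.
  assert (HC : 0 < Binomial.C (2 * k) n * sin_mass k) by (apply Rmult_lt_0_compat; [apply binomial_pos | apply sin_mass_pos]).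
  set (M := Binomial.C (2 * k) n * sin_mass k) in *. cbv iota.
  assert (HLM : 0 < INR L * M) by now apply Rmult_lt_0_compat.
  rewrite <- Rinv_mult, sqrt_sqrt by lra. field. lra.
Qed.

Lemma sin_freq_neq L a b : (a < L)%nat -> (b < L)%nat -> a <> b ->
  sin ((2 * PI * INR a / INR L - 2 * PI * INR b / INR L) / 2) <> 0.
Proof.
  intros Ha Hb Hab. assert (HL : 0 < INR L) by (apply lt_0_INR; lia). pose proof PI_RGT_0 as Hpi.
  assert (G : forall a b, (b < a)%nat -> (a < L)%nat -> 0 < sin ((2 * PI * INR a / INR L - 2 * PI * INR b / INR L) / 2)).
  { intros x y Hy Hx. replace ((2 * PI * INR x / INR L - 2 * PI * INR y / INR L) / 2) with (PI * ((INR x - INR y) / INR L)) by (field; lra).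
    apply lt_INR in Hy. apply lt_INR in Hx.
    assert (0 < (INR x - INR y) / INR L) by (apply Rdiv_lt_0_compat; lra).
    assert ((INR x - INR y) / INR L < 1).
    { apply Rmult_lt_reg_r with (INR L); [auto|]. unfold Rdiv. rewrite Rmult_assoc, Rinv_l by lra.
      generalize (pos_INR y); lra. }
    apply sin_gt_0; nra. }
  destruct (Nat.lt_total a b) as [H|[H|H]]; [|contradiction|].
  - specialize (G b a H Hb).
    replace ((2 * PI * INR a / INR L - 2 * PI * INR b / INR L) / 2) with (- ((2 * PI * INR b / INR L - 2 * PI * INR a / INR L) / 2)) by (field; lra).
    rewrite sin_neg. lra.
  - specialize (G a b H Ha). lra.
Qed.

(** Different quotients give disjoint blocks, hence vanishing products. In a common block all
    weights become 1/L, and distinct remainders give frequencies whose trigonometric sums over L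
    consecutive indices vanish. *)
Lemma packet_orthonormal k L i j : (0 < L)%nat ->
  (k + L * (i / L) + L <= 2 * k + 1)%nat -> (k + L * (j / L) + L <= 2 * k + 1)%nat ->
  inner_re (packet k L i) (packet k L j) = (if Nat.eqb i j then 1 else 0) /\
  inner_im (packet k L i) (packet k L j) = 0.
Proof.
  intros HL Hi Hj.
  assert (HL' : 0 < INR L) by now apply lt_0_INR.
  unfold packet.
  set (ai := 2 * PI * INR (i mod L) / INR L). set (aj := 2 * PI * INR (j mod L) / INR L).
  set (bi := (k + L * (i / L))%nat) in *. set (bj := (k + L * (j / L))%nat) in *.
  destruct (inner_comb k (fun n => RtoC (block_coef k L bi n) * cexpi (ai * INR n))%C
     (fun n => RtoC (block_coef k L bj n) * cexpi (aj * INR n))%C) as [-> ->].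
  assert (EP : forall n, ((RtoC (block_coef k L bi n) * cexpi (ai * INR n)) * Cconj (RtoC (block_coef k L bj n) * cexpi (aj * INR n)))%C
    = (RtoC (block_coef k L bi n * block_coef k L bj n) * cexpi ((ai - aj) * INR n))%C).
  { intros n. replace ((ai - aj) * INR n) with (ai * INR n - aj * INR n) by ring.
    unfold cexpi, Cconj, Cmult, RtoC; simpl. rewrite cos_minus, sin_minus. f_equal; ring. }
  assert (ER : rsum (fun n => Re ((RtoC (block_coef k L bi n) * cexpi (ai * INR n)) * Cconj (RtoC (block_coef k L bj n) * cexpi (aj * INR n)))%C
     * (Binomial.C (2 * k) n * sin_mass k)) (2 * k + 1)
     = rsum (fun n => (block_coef k L bi n * block_coef k L bj n * (Binomial.C (2 * k) n * sin_mass k)) * cos ((ai - aj) * INR n)) (2 * k + 1)).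
  { apply rsum_ext; intros n _. rewrite EP, re_scal_l. unfold cexpi, Re; simpl. ring. }
  assert (EI : rsum (fun n => Im ((RtoC (block_coef k L bi n) * cexpi (ai * INR n)) * Cconj (RtoC (block_coef k L bj n) * cexpi (aj * INR n)))%C
     * (Binomial.C (2 * k) n * sin_mass k)) (2 * k + 1)
     = rsum (fun n => (block_coef k L bi n * block_coef k L bj n * (Binomial.C (2 * k) n * sin_mass k)) * sin ((ai - aj) * INR n)) (2 * k + 1)).
  { apply rsum_ext; intros n _. rewrite EP, im_scal_l. unfold cexpi, Im; simpl. ring. }
  rewrite ER, EI. clear ER EI EP.
  destruct (Nat.eq_dec (i / L) (j / L)) as [Eq|Neq].
  - assert (Eb : bj = bi) by (unfold bi, bj; now rewrite Eq). rewrite Eb.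
    assert (ES : forall F : nat -> R, rsum (fun n => block_coef k L bi n * block_coef k L bi n * (Binomial.C (2 * k) n * sin_mass k) * F n) (2 * k + 1)
      = / INR L * rsum (fun r => F (bi + r)%nat) L).
    { intros F. rewrite <- rsum_scal. rewrite <- (rsum_block (fun n => / INR L * F n) bi L (2 * k + 1)) by exact Hi.
      apply rsum_ext; intros n _.
      destruct (Nat.leb_spec bi n); destruct (Nat.ltb_spec n (bi + L)); simpl andb; cbv iota;
        try (unfold block_coef; destruct (Nat.leb_spec bi n); destruct (Nat.ltb_spec n (bi + L)); try lia; simpl; ring).
      rewrite block_coef_sq by (auto; lia). reflexivity. }
    rewrite (ES (fun n => cos ((ai - aj) * INR n))), (ES (fun n => sin ((ai - aj) * INR n))).
    destruct (Nat.eqb_spec i j) as [->|Hij].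
    + replace (ai - aj) with 0 by (unfold ai, aj; ring).
      rewrite (rsum_ext (fun r => cos (0 * INR (bi + r))) (fun _ => 1)) by (intros; now rewrite Rmult_0_l, cos_0).
      rewrite (rsum_ext (fun r => sin (0 * INR (bi + r))) (fun _ => 0)) by (intros; now rewrite Rmult_0_l, sin_0).
      rewrite !rsum_const. split; field; lra.
    + assert (Hm : i mod L <> j mod L).
      { intros E. apply Hij. rewrite (Nat.div_mod_eq i L), (Nat.div_mod_eq j L). now rewrite Eq, E. }
      destruct (rsum_trig_zero ((ai - aj) * INR bi) (ai - aj) L (i mod L) (j mod L)) as [T1 T2].
      * apply sin_freq_neq; auto; apply Nat.mod_upper_bound; lia.
      * unfold ai, aj. field. lra.
      * rewrite (rsum_ext (fun r => cos ((ai - aj) * INR (bi + r))) (fun r => cos ((ai - aj) * INR bi + (ai - aj) * INR r)))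
          by (intros; rewrite plus_INR; f_equal; ring).
        rewrite (rsum_ext (fun r => sin ((ai - aj) * INR (bi + r))) (fun r => sin ((ai - aj) * INR bi + (ai - aj) * INR r)))
          by (intros; rewrite plus_INR; f_equal; ring).
        rewrite T1, T2. split; ring.
  - assert (Hij : Nat.eqb i j = false) by (apply Nat.eqb_neq; congruence). rewrite Hij.
    assert (Z : forall n, block_coef k L bi n * block_coef k L bj n = 0).
    { intros n. unfold block_coef.
      destruct (Nat.leb_spec bi n); destruct (Nat.ltb_spec n (bi + L)); simpl andb; cbv iota; try ring.
      destruct (Nat.leb_spec bj n); destruct (Nat.ltb_spec n (bj + L)); simpl andb; cbv iota; try ring.
      exfalso. unfold bi, bj in *. destruct (Nat.lt_total (i / L) (j / L)) as [H'|[H'|H']]; [|auto|]; nia. }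
    split; apply rsum_0; intros n _; rewrite Z; ring.
Qed.

(** Up to the factor 1/sqrt([sin_mass k]), the pairing of the packet with the beam is the sum over
    the block of sqrt([binprob N n0 n]) / sqrt L. Each term is at least 1/(2L), and there are L of
    them. *)
Lemma packet_Lp k L i p : (20 <= L)%nat -> (L * L <= k)%nat -> (k < (L + 1) * (L + 1))%nat ->
  (10 * i <= k + 1)%nat -> 2 < p ->
  Lp_norm p (packet k L i) >= / 2 * Lp_norm_coord p (Qk k).
Proof.
  intros HL HL1 HL2 Hi Hp.
  assert (Hk : (0 < k)%nat) by nia.
  assert (HkR : 0 < INR k) by now apply lt_0_INR.
  assert (HLR : 20 <= INR L) by (apply le_INR in HL; simpl in HL; lra).
  set (b := (k + L * (i / L))%nat). set (n0 := (b + L / 2)%nat). set (N := (2 * k)%nat).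
  assert (Hdiv : (L * (i / L) <= i)%nat) by (apply Nat.Div0.mul_div_le).
  assert (HL20 : (20 * L <= k)%nat) by nia.
  assert (Hhalf : (2 * (L / 2) <= L < 2 * (L / 2) + 2)%nat).
  { generalize (Nat.div_mod_eq L 2) (Nat.mod_upper_bound L 2 ltac:(lia)). lia. }
  (* The block starts at most (k+1)/10 above k, and its half-length is at most k/40 because L >= 20;
     so at least 4k/5 indices remain above its centre [n0]. *)
  assert (Hn0 : (k <= n0)%nat /\ (5 * (N - n0) >= 4 * k)%nat /\ (n0 < N)%nat) by (unfold n0, b, N; lia).
  assert (HbL : (b + L <= 2 * k + 1)%nat) by (unfold b; lia).
  destruct Hn0 as (Hn1 & Hn2 & Hn3).
  assert (HN : 0 < INR N) by (apply lt_0_INR; unfold N; lia).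
  assert (HnR : 0 < INR n0) by (apply lt_0_INR; lia).
  assert (HmR : 0 < INR (N - n0)) by (apply lt_0_INR; lia).
  assert (ENn : INR (N - n0) / INR N = 1 - INR n0 / INR N) by (rewrite minus_INR by lia; field; lra).
  set (x := INR n0 / INR N) in *.
  assert (Hx : 0 < x < 1).
  { assert (0 < INR (N - n0) / INR N) by now apply Rdiv_lt_0_compat.
    split; [unfold x; now apply Rdiv_lt_0_compat | lra]. }
  (* the beam whose coefficients in the W basis concentrate at the block *)
  set (g := asin (sqrt x)).
  assert (Hsx : 0 < sqrt x) by (apply sqrt_lt_R0; lra).
  assert (Hsx1 : sqrt x < 1) by (rewrite <- sqrt_1; apply sqrt_lt_1; lra).
  assert (Hsin : sin g = sqrt x) by (apply sin_asin; lra).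
  assert (Hcos : cos g = sqrt (1 - x)).
  { unfold g. rewrite cos_asin by lra. f_equal. rewrite Rsqr_sqrt by lra. reflexivity. }
  assert (Hcg : 0 < cos g) by (rewrite Hcos; apply sqrt_lt_R0; lra).
  assert (Hsg : 0 < sin g) by lra.
  pose proof (sin_mass_pos k) as HA. assert (HsA : 0 < sqrt (sin_mass k)) by now apply sqrt_lt_R0.
  apply half_Qk_Lp_le; auto.
  unfold packet. fold b. rewrite (Lp_norm_comb_shift k (block_coef k L b)) by lra.
  apply (Lp_lower_bound k g p (block_coef k L b) Hk Hp Hcg Hsg).
  { apply Rinv_0_lt_compat. lra. }
  assert (HP : forall n, (b <= n < b + L)%nat -> / (4 * INR L) <= binprob N n0 n).
  { intros n Hn.
    assert (Hmu : 4 / 5 * INR k <= INR (N - n0)).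
    { apply le_INR in Hn2. rewrite !mult_INR in Hn2. simpl in Hn2. lra. }
    assert (Hmu' : 4 / 5 * INR k <= INR n0) by (apply le_INR in Hn1; lra).
    (* Points of the block are within L/2 of [n0], and L^2 <= k. With mu = 4k/5 the relative loss is
       (1/4)/(4/5) = 5/16, which leaves the factor 11/16. *)
    assert (Hd : (INR n - INR n0) ^ 2 <= INR k / 4).
    { assert (K1 : 2 * INR n <= 2 * INR n0 + INR L).
      { apply Rle_trans with (INR (2 * n)); [rewrite mult_INR; simpl; lra|].
        apply Rle_trans with (INR (2 * n0 + L)); [apply le_INR; unfold n0; lia|].
        rewrite plus_INR, mult_INR. simpl; lra. }
      assert (K2 : 2 * INR n0 <= 2 * INR n + INR L).
      { apply Rle_trans with (INR (2 * n0)); [rewrite mult_INR; simpl; lra|].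
        apply Rle_trans with (INR (2 * n + L)); [apply le_INR; unfold n0; lia|].
        rewrite plus_INR, mult_INR. simpl; lra. }
      apply le_INR in HL1. rewrite mult_INR in HL1. nra. }
    generalize (binprob_near N n0 n (4 / 5 * INR k) (INR k / 4) ltac:(lra) Hmu' Hmu ltac:(lia) ltac:(unfold N; lia) Hd).
    replace (1 - INR k / 4 / (4 / 5 * INR k)) with (11 / 16) by (field; lra).
    intros K. generalize (binprob_mode_lower k n0 Hk Hn1 Hn3). fold N. intros K2.
    eapply Rle_trans; [|exact K].
    generalize (binprob_ge_0 N n0 n0). set (M := binprob N n0 n0) in *. intros HM.
    assert (HkL : INR k <= (INR L + 1) ^ 2).
    { apply lt_INR in HL2. rewrite mult_INR, plus_INR in HL2. simpl INR in HL2 |- *. simpl pow. lra. }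
    assert (K3 : 1 <= (2 * (INR L + 1) * M) ^ 2).
    { apply Rle_trans with (1 := K2). replace ((2 * (INR L + 1) * M) ^ 2) with (4 * (INR L + 1) ^ 2 * M ^ 2) by ring.
      apply Rmult_le_compat_r; [apply pow2_ge_0 | lra]. }
    assert (K4 : 1 <= 2 * (INR L + 1) * M).
    { assert (0 <= 2 * (INR L + 1) * M) by (apply Rmult_le_pos; lra).
      destruct (Rle_dec 1 (2 * (INR L + 1) * M)) as [|Hn']; [assumption|exfalso]. nra. }
    (* (11/16) / (2(L+1)) >= 1/(4L) as soon as 3L >= 8. *)
    apply Rmult_le_reg_r with (4 * INR L); [lra|]. rewrite Rinv_l by lra. nra. }
  (* The required bound is spread evenly over the L indices of the block and then checked term by
     term. *)
  apply Rle_trans with (rsum (fun n => if ((b <=? n)%nat && (n <? b + L)%nat)%bool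
      then / (2 * sqrt (sin_mass k) * INR L) else 0) (2 * k + 1)).
  { rewrite (rsum_block (fun _ => / (2 * sqrt (sin_mass k) * INR L)) b L) by exact HbL.
    rewrite rsum_const. right. field. split; lra. }
  apply rsum_le. intros n HnN. unfold block_coef.
  destruct (Nat.leb_spec b n); destruct (Nat.ltb_spec n (b + L)); simpl andb; cbv iota; try lra.
  specialize (HP n ltac:(lia)).
  pose proof (binomial_pos (2 * k) n) as HC. set (Cn := Binomial.C (2 * k) n) in *.
  set (v := sin g ^ n * cos g ^ (2 * k - n)).
  assert (Hv : 0 <= v) by (apply Rmult_le_pos; apply pow_le; lra).
  assert (EP : binprob N n0 n = Cn * v ^ 2).
  { unfold binprob. fold x. rewrite ENn. unfold v. fold Cn N.
    replace (Binomial.C N n) with Cn by reflexivity.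
    rewrite Rpow_mult_distr, <- !pow_mult, !(Nat.mul_comm _ 2), !pow_mult, Hsin, Hcos.
    rewrite !pow2_sqrt by lra. ring. }
  rewrite EP in HP.
  assert (HCA : 0 <= Cn * sin_mass k) by (apply Rmult_le_pos; lra).
  rewrite (sqrt_mult (INR L)), (sqrt_mult Cn) by lra.
  assert (HsL : 0 < sqrt (INR L)) by (apply sqrt_lt_R0; lra).
  assert (HsC : 0 < sqrt Cn) by now apply sqrt_lt_R0.
  replace (/ (sqrt (INR L) * (sqrt Cn * sqrt (sin_mass k))) * (Cn * sin g ^ n * cos g ^ (2 * k - n)))
    with (/ sqrt (sin_mass k) * (/ sqrt (INR L) * (sqrt Cn * v))).
  2:{ transitivity (/ (sqrt (INR L) * (sqrt Cn * sqrt (sin_mass k))) * (sqrt Cn * sqrt Cn * sin g ^ n * cos g ^ (2 * k - n))).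
      - unfold v. field. lra.
      - now rewrite (sqrt_sqrt Cn) by lra. }
  replace (/ (2 * sqrt (sin_mass k) * INR L)) with (/ sqrt (sin_mass k) * (/ sqrt (INR L) * (/ (2 * sqrt (INR L))))).
  2:{ transitivity (/ (2 * sqrt (sin_mass k) * (sqrt (INR L) * sqrt (INR L)))).
      - field. lra.
      - now rewrite (sqrt_sqrt (INR L)) by lra. }
  apply Rmult_le_compat_l; [left; now apply Rinv_0_lt_compat|].
  apply Rmult_le_compat_l; [left; now apply Rinv_0_lt_compat|].
  apply Rsqr_incr_0_var; [|apply Rmult_le_pos; lra].
  unfold Rsqr. eapply Rle_trans; [|eapply Rle_trans; [exact HP|]].
  - right. transitivity (/ (4 * (sqrt (INR L) * sqrt (INR L)))).
    + field. lra.
    + now rewrite (sqrt_sqrt (INR L)) by lra.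
  - right. transitivity (sqrt Cn * sqrt Cn * v ^ 2).
    + now rewrite (sqrt_sqrt Cn) by lra.
    + ring.
Qed.

Lemma good_constant_small D : 0 < D -> D <= / 20 -> good_constant D.
Proof.
  (* 400 = 20^2 ensures that the block length is at least 20. *)
  intros HD0 HD. exists 400%nat. intros k Hk m.
  set (L := Nat.sqrt k).
  destruct (Nat.sqrt_spec k (Nat.le_0_l k)) as [HL1 HL2]. fold L in HL1, HL2.
  assert (HL : (20 <= L)%nat) by nia.
  (* This is where D <= 1/20 enters: each i < m then satisfies 10 i <= k + 1, so every block lies in
     the range that [packet_Lp] accepts. *)
  assert (Hm : (20 * m <= 2 * k + 1)%nat).
  { unfold m, nat_floor. set (r := D * (2 * INR k + 1)).
    assert (Hr0 : 0 <= r) by (apply Rmult_le_pos; [lra | generalize (pos_INR k); lra]).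
    assert (Hr : 20 * r <= 2 * INR k + 1) by (unfold r; generalize (pos_INR k); nra).
    destruct (base_Int_part r) as [H1 H2].
    assert (Hz : (0 <= Int_part r)%Z).
    { apply Z.lt_succ_r, lt_IZR. unfold Z.succ. rewrite plus_IZR. lra. }
    apply INR_le. rewrite plus_INR, !mult_INR, (INR_IZR_INZ (Z.to_nat _)), Z2Nat.id by exact Hz.
    simpl INR. lra. }
  exists (packet k L). split; [|split].
  - intros i _. apply spherical_harmonic_comb.
  - intros i j Hi Hj.
    assert (Hi' : (L * (i / L) <= i)%nat) by apply Nat.Div0.mul_div_le.
    assert (Hj' : (L * (j / L) <= j)%nat) by apply Nat.Div0.mul_div_le.
    apply packet_orthonormal; [lia | nia | nia].
  - intros i Hi p Hp. apply packet_Lp; lia || lra || nia.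
Qed.

(** For D > 1/20 the exponential is above 1 - 20/72 by e^x >= 1 + x, and multiplied by more than 7
    it is far above 1/25. *)
Lemma admissible_small D : 0 < D < 1 -> admissible D -> D <= / 20.
Proof.
  intros HD HA. destruct (Rle_dec D (/ 20)) as [|Hn]; [assumption|exfalso].
  unfold admissible, c0, Rpower in HA. rewrite ln_exp in HA.
  assert (HDi : / D < 20) by (rewrite <- (Rinv_inv 20); apply Rinv_lt_contravar; lra || nra).
  assert (HDi0 : 0 < / D) by (apply Rinv_0_lt_compat; lra).
  generalize (exp_ineq1_le (- / D * / 72)). intros H. nra.
Qed.

(* (7 + 1296/400) e^(-400/72) <= 1/25 amounts to 2^8 <= e^(50/9), that is 2 <= e^(25/36). *)
Lemma admissible_400 : admissible (/ 400).
Proof.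
  unfold admissible, c0, Rpower. rewrite ln_exp, Rinv_inv.
  assert (H2 : 2 <= exp (25 / 36)).
  (* The quadratic Taylor bound at 25/36 itself stays below 2. At an eighth of the argument it is
     sharp enough: its eighth power is just above 2. *)
  { assert (H : 1 + 25 / 288 + (25 / 288) ^ 2 / 2 <= exp (25 / 288)).
    { eapply Rle_trans; [|apply (exp_ge_taylor (25 / 288) 2); lra]. simpl. lra. }
    replace (exp (25 / 36)) with (exp (25 / 288) ^ 8).
    - eapply Rle_trans; [|apply pow_incr; split; [|exact H]]; lra.
    - simpl. rewrite Rmult_1_r, <- !exp_plus. f_equal. field. }
  assert (H3 : 256 <= exp (50 / 9)).
  { replace (exp (50 / 9)) with (exp (25 / 36) ^ 8).
    - replace 256 with (2 ^ 8) by ring. apply pow_incr; lra.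
    - simpl. rewrite Rmult_1_r, <- !exp_plus. f_equal. field. }
  replace (- (400) * / 72) with (- (50 / 9)) by field.
  rewrite exp_Ropp.
  assert (/ exp (50 / 9) <= / 256) by (apply Rinv_le_contravar; lra). lra.
Qed.

Theorem theorem1p3 :
  (exists D : R, 0 < D < 1 /\ good_constant D) /\
  (forall D : R, 0 < D < 1 -> admissible D -> good_constant D) /\
  (0 < / 400 < 1 /\ admissible (/ 400)).
Proof.
  split; [|split; [|split]].
  - exists (/ 400). split; [lra|]. apply good_constant_small; lra.
  - intros D HD HA. apply good_constant_small; [lra | now apply admissible_small].
  - lra.
  - apply admissible_400.
Qed.
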